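(* Let $N>2$ be an integer with $3\nmid N$. Then the multiplicities $d(\cdot)$ of the irreducible representations of $G=\mathrm{PSL}_2(\mathbb{Z})/\Phi(N)\simeq(\mathbb{Z}/N\mathbb{Z})^2\rtimes S_3$ inside the canonical representation $\rho_{\Phi(N)}$ on $S_2(\Phi(N))$ are given by $$d(\rho_1)=d(\rho_2)=d(\rho_3)=0,\qquad d(\rho_\alpha^+)=0,\quad \alpha=1,\dots,N-1,$$ $$d(\rho_\alpha^-)=\begin{cases}1&\text{if }\alpha=1,\dots,\left\lfloor\frac{N-1}{2}\right\rfloor,\\ 0&\text{if }\alpha=\left\lfloor\frac{N-1}{2}\right\rfloor+1,\dots,N-1,\end{cases}$$ $$d(\rho_{\alpha_i,\beta_i})=\begin{cases}1&\text{if }\alpha_i+\beta_i<N,\\0&\text{if }\alpha_i+\beta_i\ge N,\end{cases}\qquad \alpha_i,\beta_i\neq0.$$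
   Context: In $\mathrm{PSL}_2(\mathbb{Z})$ let $S=\begin{pmatrix}0&-1\\1&0\end{pmatrix}$, $T=\begin{pmatrix}1&1\\0&1\end{pmatrix}$, $A=\begin{pmatrix}1&2\\0&1\end{pmatrix}$, $B=\begin{pmatrix}1&0\\-2&1\end{pmatrix}$, $U=\begin{pmatrix}2&1\\1&1\end{pmatrix}$. The image of $\Gamma(2)$ in $\mathrm{PSL}_2(\mathbb{Z})$ is free on $A,B$, and $\Phi(N)$ is the kernel of the homomorphism from it to $\mathbb{Z}/N\mathbb{Z}\times\mathbb{Z}/N\mathbb{Z}$ with $A\mapsto(1,0)$, $B\mapsto(0,1)$. $\Phi(N)$ is normal in $\mathrm{PSL}_2(\mathbb{Z})$, and $G=\mathrm{PSL}_2(\mathbb{Z})/\Phi(N)$ is the semidirect product of $(\mathbb{Z}/N\mathbb{Z})^2=\langle A,B\rangle$ by $S_3=\langle S,U\rangle$, with $SAS=B$, $UAU^2=B$, $UBU^2=A^{-1}B^{-1}$ in $G$. The curve $X(\Phi(N))$ is a model of the Fermat curve $X^N+Y^N=Z^N$. $\rho_{\Phi(N)}$ is the action of $G$ on the space $S_2(\Phi(N))$ of weight two cusp forms, $\rho_{\Phi(N)}(\gamma)f=f|_2\gamma=f\left(\frac{a\tau+b}{c\tau+d}\right)(c\tau+d)^{-2}$ for $\gamma=\begin{pmatrix}a&b\\c&d\end{pmatrix}$. (It is a right action; multiplicities are those of characters in the class function $g\mapsto\operatorname{Tr}\rho_{\Phi(N)}(g)$ on $G$.) Irreducible representations of $G$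 when $3\nmid N$. Let $\zeta_N=e^{2\pi i/N}$ and let $\chi_{\alpha,\beta}$ be the character of $(\mathbb{Z}/N\mathbb{Z})^2$ with $\chi_{\alpha,\beta}(A)=\zeta_N^\alpha$, $\chi_{\alpha,\beta}(B)=\zeta_N^\beta$; $S_3$ acts on these characters by $(g\chi)(x)=\chi(g^{-1}xg)$. The irreducible representations are: - $\rho_1,\rho_2,\rho_3$: the inflations to $G$ of the trivial, sign and two-dimensional irreducible representations of $S_3$; - $\rho_\alpha^{\pm}$, $\alpha=1,\dots,N-1$ (dimension 3): the representation induced to $G$ from $(\mathbb{Z}/N\mathbb{Z})^2\rtimes\langle S\rangle$ of the character equal to $\chi_{\alpha,\alpha}$ on $(\mathbb{Z}/N\mathbb{Z})^2$ and sending $S\mapsto\pm1$; - $\rho_{\alpha_i,\beta_i}$, $i=1,\dots,\frac16(N-1)(N-2)$ (dimension 6): the representation induced to $G$ from $(\mathbb{Z}/N\mathbb{Z})^2$ of $\chi_{\alpha_i,\beta_i}$, where $\chi_{\alpha_i,\beta_i}$ are representatives of the $S_3$-orbits of size 6, chosen with $\alpha_i,\beta_i\in\{1,\dots,N-1\}$ (always possible). *)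

(* Defs.v *)
From mathcomp Require Import all_boot all_order all_fingroup all_algebra.
From mathcomp Require Import boolp classical_sets reals topology normedtype.
From mathcomp Require Import derive trigo.
From mathcomp Require Import complex.

Set Implicit Arguments.
Unset Strict Implicit.
Unset Printing Implicit Defensive.

Import Order.TTheory GRing.Theory Num.Theory numFieldNormedType.Exports.
Local Open Scope ring_scope.

(** * The modular group and the Fermat groups

    A subgroup of PSL_2(Z) is represented by its full preimage in SL_2(Z),
    hence always contains -1. *)

Definition mx22 (a b c d : int) : 'M[int]_2 :=
  \matrix_(i < 2, j < 2)
    if i == 0 then (if j == 0 then a else b) else (if j == 0 then c else d).

Definition mxS := mx22 0 (-1) 1 0.
Definition mxA := mx22 1 2 0 1.
Definition mxB := mx22 1 0 (-2) 1.
Definition mxU := mx22 2 1 1 1.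

Definition SL2Z (g : 'M[int]_2) : Prop := \det g = 1.

Definition Gamma2 (g : 'M[int]_2) : Prop :=
  SL2Z g /\ forall i j, (2 %| (g - 1%:M) i j)%Z.

(** The values of [phi] outside [Gamma2] are irrelevant.  Since the image of
    Gamma(2) in PSL_2(Z) is free on A and B, such a [phi] exists and is unique
    on [Gamma2]; [phi (- 1%:M) = 0] says that it factors through PSL_2(Z). *)
Definition fermat_hom (N : nat) (phi : 'M[int]_2 -> 'Z_N * 'Z_N) : Prop :=
  [/\ forall g h, Gamma2 g -> Gamma2 h -> phi (g *m h) = phi g + phi h,
      phi (- 1%:M) = 0,
      phi mxA = (1, 0)
    & phi mxB = (0, 1)].

Definition Phi (N : nat) (phi : 'M[int]_2 -> 'Z_N * 'Z_N) (g : 'M[int]_2) :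
  Prop := Gamma2 g /\ phi g = 0.

(** [pr] exhibits [gT] as the quotient of SL_2(Z) by [K], that is, as the
    quotient of PSL_2(Z) by the image of [K] when [K] contains -1. *)
Definition quotient_of_SL2Z (K : 'M[int]_2 -> Prop) (gT : finGroupType)
    (pr : 'M[int]_2 -> gT) : Prop :=
  [/\ forall g h, SL2Z g -> SL2Z h -> pr (g *m h) = (pr g * pr h)%g,
      forall x, exists2 g, SL2Z g & pr g = x
    & forall g, SL2Z g -> (pr g = 1%g <-> K g)].

(** * Cusp forms of weight two *)

Section CuspForms.
Variable R : realType.
Implicit Types (f : R[i] -> R[i]) (g : 'M[int]_2) (z : R[i]).

Definition upper_half_plane z : Prop := 0 < complex.Im z.

Definition slash2 g f : R[i] -> R[i] := fun z =>
  let num := (g 0 0)%:~R * z + (g 0 1)%:~R in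
  let den := (g 1 0)%:~R * z + (g 1 1)%:~R in
  f (num / den) * den ^- 2.

(** A function on the upper half-plane is represented by its extension by 0 to
    R[i], so that equality of functions on R[i] is equality on the half-plane.
    [slash2 g] preserves this convention when \det g = 1. *)
Definition cusp_form2 (K : 'M[int]_2 -> Prop) f : Prop :=
  [/\ forall z, ~ upper_half_plane z -> f z = 0,
      forall z, upper_half_plane z ->
        derivable (f : R[i]^o -> R[i]^o) z 1,
      forall g, K g -> slash2 g f =1 f
    & forall g, SL2Z g -> forall eps : R, 0 < eps ->
        exists Y : R, forall z, Y < complex.Im z ->
          `|slash2 g f z| < real_complex R eps].

(** [t] is the trace of [L] on the finite-dimensional space [V]. *)
Definition trace_on (V : (R[i] -> R[i]) -> Prop)
    (L : (R[i] -> R[i]) -> R[i] -> R[i]) (t : R[i]) : Prop :=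
  exists (n : nat) (b : 'I_n -> R[i] -> R[i]) (M : 'M[R[i]]_n),
    [/\ forall i, V (b i),
        forall f, V f ->
          exists! c : 'rV[R[i]]_n, forall z, f z = \sum_j c 0 j * b j z,
        forall i z, L (b i) z = \sum_j M i j * b j z
      & t = \tr M].

(** [psi] is the class function x |-> Tr rho_K(x) on the quotient by [K]. *)
Definition canonical_character (K : 'M[int]_2 -> Prop) (gT : finGroupType)
    (pr : 'M[int]_2 -> gT) (psi : gT -> R[i]) : Prop :=
  forall g, SL2Z g -> trace_on (cusp_form2 K) (slash2 g) (psi (pr g)).

End CuspForms.

(** * Class functions on a finite group, with values in R[i]

    [multiplicity] and [ind_char] are the formulas of [cfdot] and [cfInd] in
    mathcomp's classfun, whose class functions take their values in [algC]. *)

Section ClassFunctions.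
Variables (R : realType) (gT : finGroupType).

(** Multiplicity of the irreducible character [chi] in [psi]. *)
Definition multiplicity (psi chi : gT -> R[i]) : R[i] :=
  (#|gT|%:R)^-1 * \sum_(x : gT) psi x * (chi x)^*%C.

(** Character induced from the subgroup [H] by [xi], which vanishes off [H]. *)
Definition ind_char (H : {set gT}) (xi : gT -> R[i]) : gT -> R[i] :=
  fun x => (#|H|%:R)^-1 * \sum_(y : gT) xi (x ^ y)%g.

End ClassFunctions.

(** * Irreducible characters of (Z/N)^2 ><| S_3

    Here (Z/N)^2 = <a, b>, with basis (a, b), and S_3 = <s, u>, with s of
    order 2 and u of order 3. *)

Section Irreducible.
Variables (R : realType) (N : nat) (gT : finGroupType) (a b s u : gT).

Definition zeta : R[i] :=
  Complex (cos (2 * pi / N%:R)) (sin (2 * pi / N%:R)).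

Definition transl : {set gT} := <<[set a; b]>>%g.
Definition transl_s : {set gT} := <<[set a; b; s]>>%g.
Definition sym3 : {set gT} := <<[set s; u]>>%g.

(** The projection onto S_3, realized as the group of permutations
    i |-> +/- i + k of Z/3: u goes to i |-> 1 + i and s to i |-> - i. *)
Definition s3_proj (x : gT) : 'S_3 :=
  if [pick t : 'I_3 * 'I_2 | x \in (transl :* (u ^+ t.1 * s ^+ t.2))%g]
  is Some t
  then (perm (@addrI 'I_3 1%R) ^+ t.1 * perm (@oppr_inj 'I_3) ^+ t.2)%g
  else 1%g.

Definition rho1 (x : gT) : R[i] := 1.

Definition rho2 (x : gT) : R[i] := (-1) ^+ odd_perm (s3_proj x).

(** The two-dimensional irreducible representation of S_3 is the permutation
    representation on three points minus the trivial one. *)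
Definition rho3 (x : gT) : R[i] := \tr (perm_mx (s3_proj x)) - 1.

(** The character of <a, b> with a |-> zeta^al, b |-> zeta^be, extended by 0. *)
Definition chi_ab (al be : nat) (x : gT) : R[i] :=
  if [pick t : 'I_N * 'I_N | x == (a ^+ t.1 * b ^+ t.2)%g] is Some t
  then zeta ^+ (al * t.1 + be * t.2) else 0.

(** The character of <a, b> ><| <s> that is equal to [chi_ab al al] on <a, b>
    and sends s to [eps], extended by 0. *)
Definition chi_s (eps : R[i]) (al : nat) (x : gT) : R[i] :=
  if [pick t : 'I_N * 'I_N * 'I_2 | x == (a ^+ t.1.1 * b ^+ t.1.2 * s ^+ t.2)%g]
  is Some t
  then zeta ^+ (al * t.1.1 + al * t.1.2) * eps ^+ t.2 else 0.

Definition rho_pm (eps : R[i]) (al : nat) : gT -> R[i] :=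
  ind_char transl_s (chi_s eps al).

Definition rho_ab (al be : nat) : gT -> R[i] :=
  ind_char transl (chi_ab al be).

(** Cardinality of the orbit of [chi_ab al be] under
    (g chi)(x) = chi (g^-1 x g); in mathcomp, x ^ g = g^-1 * x * g. *)
Definition orbit_size (al be : nat) : nat :=
  size (undup [seq [ffun x => chi_ab al be (x ^ g)%g] | g in sym3]).

End Irreducible.

(* Main.v *)
(** For i + j + k = N with i, j, k >= 1, the functions
    f_ijk = theta_2^(4i/N) theta_4^(4j/N) theta_3^(4k/N) are cusp forms of weight
    two for Phi(N): no theta constant vanishes, so roots are taken with
    holomorphic logarithms, and T and S permute the exponents up to scalars.
    A and B multiply f_ijk by zeta^i and zeta^j, hence the f_ijk are independent;
    they span, since a cusp form with the same eigenvalues divided by f_ijk is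
    invariant under Gamma(2) and has limits at the cusps, hence is constant.
    Thus the translations act with each character (i, j), i + j < N, exactly
    once, and S acts by f_ijk |-> - f_jik. This gives the traces on translations
    and on translations times S, and the multiplicities follow by Frobenius
    reciprocity; no nonzero translation-invariant vector exists, which settles
    the representations inflated from S_3. *)

Require Import Defs.
From mathcomp Require Import all_boot all_order all_fingroup all_algebra.
From mathcomp Require Import boolp classical_sets reals complex.
From mathcomp Require Import topology normedtype sequences derive exp trigo.
From mathcomp Require Import ring lra zify.

Set Implicit Arguments.
Unset Strict Implicit.
Unset Printing Implicit Defensive.

Import Order.TTheory GRing.Theory Num.Theory numFieldNormedType.Exports.
Local Open Scope ring_scope.

(** Complex analysis enters through the coordinate [ce w = e^(2 pi i w)]. Cauchy's formula is proved
    once, for functions of period 1 on the upper half-plane, from Goursat's theorem on rectangles.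
    The map [w |-> p + r * ce w] carries it from the cusp to punctured discs, so removable
    singularities, the maximum principle and limits of holomorphic functions all rest on it. The
    action of S on the theta constants comes from Jacobi's transformation of the odd theta function,
    read at the three half-periods; Euler's product identity gives the cube of the constant in it.
    Roots require exact laws for logarithms, so those of theta_3 and theta_2 are transported from
    that of theta_4 by T and S; what remains is the effect of S on theta_3 and of T on theta_2.
    Eigenspaces are indexed by i, j in 1..N, so k = N - i - j may be negative and f_ijk need not be
    cuspidal. The quotient by f_ijk still has limits at the cusps because i, j, k are at most N;
    when k <= 0, the cusp where f_ijk has exponent k forces the constant to be 0. *)

Local Notation cnorm := ComplexField.Normc.normc.

(** * The real-valued norm on [R[i]], real and imaginary parts *)

Section ComplexNorm.
Variable R : realType.
Implicit Types (x y z w : R[i]) (a b r : R).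

Lemma N_ge0 z : 0 <= cnorm z.
Proof. by case: z => a b; rewrite /= sqrtr_ge0. Qed.

Lemma NE z : `|z| = real_complex R (cnorm z).
Proof. by case: z => a b; rewrite normc_def. Qed.

Lemma N0 : cnorm (0 : R[i]) = 0. Proof. exact: ComplexField.Normc.normc0. Qed.
Lemma N1 : cnorm (1 : R[i]) = 1. Proof. exact: ComplexField.Normc.normc1. Qed.

Lemma N_eq0 z : (cnorm z == 0) = (z == 0).
Proof.
apply/eqP/eqP => [/ComplexField.Normc.eq0_normc //|->]; exact: N0.
Qed.

Lemma N_gt0 z : (0 < cnorm z) = (z != 0).
Proof. by rewrite lt_def N_ge0 andbT N_eq0. Qed.

Lemma NM z w : cnorm (z * w) = cnorm z * cnorm w.
Proof. exact: ComplexField.Normc.normcM. Qed.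

Lemma NV z : cnorm z^-1 = (cnorm z)^-1.
Proof. exact: ComplexField.Normc.normcV. Qed.

Lemma NN z : cnorm (- z) = cnorm z. Proof. exact: normcN. Qed.

Lemma NX z n : cnorm (z ^+ n) = cnorm z ^+ n.
Proof.
by elim: n => [|n IH]; rewrite ?expr0 ?N1 // !exprS NM IH.
Qed.

Lemma ND z w : cnorm (z + w) <= cnorm z + cnorm w. Proof. exact: le_normcD. Qed.

Lemma NB z w : cnorm (z - w) <= cnorm z + cnorm w.
Proof. by rewrite (le_trans (ND _ _)) ?NN. Qed.

Lemma NBC z w : cnorm (z - w) = cnorm (w - z).
Proof. by rewrite -NN opprB. Qed.

Lemma NBD y z w : cnorm (z - w) <= cnorm (z - y) + cnorm (y - w).
Proof. by rewrite (le_trans _ (ND _ _)) // addrA subrK. Qed.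

Lemma N_lerB z w : cnorm z - cnorm w <= cnorm (z - w).
Proof. by rewrite lerBlDr (le_trans _ (ND _ _)) // subrK. Qed.

Lemma Nreal a : cnorm (real_complex R a) = `|a|.
Proof. by rewrite /= expr0n /= addr0 sqrtr_sqr. Qed.

Lemma Nnat n : cnorm (n%:R : R[i]) = n%:R.
Proof. by rewrite -(rmorph_nat (real_complex R)) Nreal normr_nat. Qed.

Lemma Ni : cnorm ('i%C : R[i]) = 1.
Proof. by rewrite /= expr0n expr1n /= add0r sqrtr1. Qed.

Lemma N_ge_Re z : `|complex.Re z| <= cnorm z.
Proof. by have := normc_ge_Re z; rewrite NE lecR. Qed.

Lemma N_ge_Im z : `|complex.Im z| <= cnorm z.
Proof.
have := N_ge_Re (z * 'i%C); rewrite ReiNIm normrN NM Ni mulr1; exact.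
Qed.

Lemma N_le_ReIm z : cnorm z <= `|complex.Re z| + `|complex.Im z|.
Proof.
rewrite {1}[z]complexE (le_trans (ND _ _)) // NM Ni mul1r !Nreal //.
Qed.

Lemma sqrN z : cnorm z ^+ 2 = complex.Re z ^+ 2 + complex.Im z ^+ 2.
Proof. by case: z => a b /=; rewrite sqr_sqrtr // addr_ge0 ?sqr_ge0. Qed.

Lemma Neq_small z w : (forall e, 0 < e -> cnorm (z - w) <= e) -> z = w.
Proof.
move=> H; apply/eqP; rewrite -subr_eq0 -N_eq0 eq_le N_ge0 andbT.
by apply/ler_addgt0Pl => e e0; rewrite addr0 H.
Qed.

Lemma Cext z w :
  complex.Re z = complex.Re w -> complex.Im z = complex.Im w -> z = w.
Proof. by case: z w => [a b] [c d] /= -> ->. Qed.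

Lemma ReD z w : complex.Re (z + w) = complex.Re z + complex.Re w.
Proof. by case: z w => [a b] [c d]. Qed.
Lemma ImD z w : complex.Im (z + w) = complex.Im z + complex.Im w.
Proof. by case: z w => [a b] [c d]. Qed.
Lemma ReN z : complex.Re (- z) = - complex.Re z. Proof. by case: z. Qed.
Lemma ImN z : complex.Im (- z) = - complex.Im z. Proof. by case: z. Qed.
Lemma ReM z w : complex.Re (z * w) =
  complex.Re z * complex.Re w - complex.Im z * complex.Im w.
Proof. by case: z w => [a b] [c d]. Qed.
Lemma ImM z w : complex.Im (z * w) =
  complex.Re z * complex.Im w + complex.Im z * complex.Re w.
Proof. by case: z w => [a b] [c d]. Qed.
Lemma ReC a : complex.Re (real_complex R a) = a. Proof. by []. Qed.
Lemma ImC a : complex.Im (real_complex R a) = 0. Proof. by []. Qed.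
Lemma Re_nat n : complex.Re (n%:R : R[i]) = n%:R.
Proof. by rewrite -(rmorph_nat (real_complex R)). Qed.
Lemma Im_nat n : complex.Im (n%:R : R[i]) = 0.
Proof. by rewrite -(rmorph_nat (real_complex R)). Qed.

End ComplexNorm.

(** * Complex differentiability *)

Section Diff.
Variable R : realType.
Local Notation C := R[i].
Implicit Types (f g : C -> C) (z d : C).

Definition ccont f z := forall e : R, 0 < e ->
  exists2 r : R, 0 < r & forall h, cnorm h < r -> cnorm (f (z + h) - f z) <= e.

(** The form without quotient needs no exception at [h = 0], and all bounds are real numbers, within
    reach of linear arithmetic. *)
Definition cdiff f z d := forall e : R, 0 < e ->
  exists2 r : R, 0 < r &
    forall h, cnorm h < r -> cnorm (f (z + h) - f z - d * h) <= e * cnorm h.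

Definition hol f z := exists d, cdiff f z d.

Lemma min2_gt0 (a b : R) : 0 < a -> 0 < b -> 0 < Num.min a b.
Proof. by move=> a0 b0; rewrite lt_min a0. Qed.

Lemma cdiff_lip f z d : cdiff f z d -> exists2 r : R, 0 < r &
  forall h, cnorm h < r -> cnorm (f (z + h) - f z) <= (cnorm d + 1) * cnorm h.
Proof.
move=> /(_ 1 ltr01) [r r0 H]; exists r => // h /H.
have := ND (f (z + h) - f z - d * h) (d * h); rewrite subrK NM.
lra.
Qed.

Lemma cdiff_cont f z d : cdiff f z d -> ccont f z.
Proof.
move=> /cdiff_lip[r r0 H] e e0; have Nd := N_ge0 d.
exists (Num.min r (e / (cnorm d + 1))); first by rewrite min2_gt0 // divr_gt0 //; lra.
move=> h; rewrite lt_min => /andP[/H h1 h2]; apply: le_trans h1 _.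
by rewrite mulrC -ler_pdivlMr ?ltW //; lra.
Qed.

Lemma hol_cont f z : hol f z -> ccont f z.
Proof. by move=> [d /cdiff_cont]. Qed.

Lemma ccont_local f g z (r : R) : 0 < r ->
  (forall h, cnorm h < r -> f (z + h) = g (z + h)) -> ccont f z -> ccont g z.
Proof.
move=> r0 fg H e /H[s s0 Hs]; exists (Num.min r s); first exact: min2_gt0.
move=> h; rewrite lt_min => /andP[h1 h2].
have := fg 0; rewrite N0 addr0 => /(_ r0) fz.
by rewrite -fg // -fz Hs.
Qed.

Lemma cdiff_local f g z d (r : R) : 0 < r ->
  (forall h, cnorm h < r -> f (z + h) = g (z + h)) -> cdiff f z d -> cdiff g z d.
Proof.
move=> r0 fg H e /H[s s0 Hs]; exists (Num.min r s); first exact: min2_gt0.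
move=> h; rewrite lt_min => /andP[h1 h2].
have := fg 0; rewrite N0 addr0 => /(_ r0) fz.
by rewrite -fg // -fz Hs.
Qed.

Lemma hol_local f g z (r : R) : 0 < r ->
  (forall h, cnorm h < r -> f (z + h) = g (z + h)) -> hol f z -> hol g z.
Proof. by move=> r0 fg [d H]; exists d; apply: cdiff_local fg H. Qed.

Lemma cdiff_cst c z : cdiff (fun=> c) z 0.
Proof.
move=> e e0; exists 1 => // h _; rewrite subrr mul0r subr0 N0.
by rewrite mulr_ge0 ?N_ge0 // ltW.
Qed.

Lemma cdiff_id z : cdiff (fun w => w) z 1.
Proof.
move=> e e0; exists 1 => // h _.
rewrite mul1r (_ : _ - _ - _ = 0) ?N0 ?mulr_ge0 ?N_ge0 ?ltW //; ring.
Qed.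

Lemma cdiffD f g z d d' :
  cdiff f z d -> cdiff g z d' -> cdiff (fun w => f w + g w) z (d + d').
Proof.
move=> Hf Hg e e0; have e2 : 0 < e / 2 by lra.
have [r r0 {}Hf] := Hf _ e2; have [s s0 {}Hg] := Hg _ e2.
exists (Num.min r s); first exact: min2_gt0.
move=> h; rewrite lt_min => /andP[/Hf h1 /Hg h2].
rewrite (_ : f (z + h) + g (z + h) - (f z + g z) - (d + d') * h =
  (f (z + h) - f z - d * h) + (g (z + h) - g z - d' * h)); last by ring.
by apply: le_trans (ND _ _) _; lra.
Qed.

Lemma cdiffM f g z d d' :
  cdiff f z d -> cdiff g z d' ->
  cdiff (fun w => f w * g w) z (d * g z + f z * d').
Proof.
move=> Hf Hg e e0.
have [r1 r10 Hl] := cdiff_lip Hg.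
set M := cnorm (g z) + (cnorm d' + 1); set K := cnorm (f z) + 1; set L := cnorm d * (cnorm d' + 1) + 1.
have ? := N_ge0 (g z); have ? := N_ge0 d'; have ? := N_ge0 (f z); have ? := N_ge0 d.
have M0 : 0 < M by rewrite /M; lra.
have K0 : 0 < K by rewrite /K; lra.
have L0 : 0 < L by rewrite /L ltr_wpDl // mulr_ge0 //; lra.
have e1 : 0 < e / 3 / M by rewrite !divr_gt0.
have e2 : 0 < e / 3 / K by rewrite !divr_gt0.
have [r r0 {}Hf] := Hf _ e1; have [s s0 {}Hg] := Hg _ e2.
exists (Num.min (Num.min r1 1) (Num.min (Num.min r s) (e / 3 / L))).
  by rewrite !lt_min r10 r0 s0 ltr01 !divr_gt0.
move=> h; rewrite !lt_min => /andP[/andP[h1 hl1] /andP[/andP[h2 h3] h4]].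
have gl := Hl _ h1; have fl := Hf _ h2; have gd := Hg _ h3.
have Nh := N_ge0 h.
(* Three errors, each at most a third of [e * cnorm h]; the last one is quadratic in [h], whence the
   bound [e / 3 / L] on the radius. *)
rewrite (_ : _ - _ - _ = (f (z + h) - f z - d * h) * g (z + h)
   + f z * (g (z + h) - g z - d' * h) + d * h * (g (z + h) - g z)); last by ring.
have gb : cnorm (g (z + h)) <= M.
  have := ND (g (z + h) - g z) (g z); rewrite subrK /M.
  have : (cnorm d' + 1) * cnorm h <= (cnorm d' + 1) * 1 by rewrite ler_wpM2l //; lra.
  lra.
have t1 : cnorm ((f (z + h) - f z - d * h) * g (z + h)) <= e / 3 * cnorm h.
  rewrite NM (le_trans (ler_pM _ _ fl gb)) ?N_ge0 //.
  by rewrite mulrAC divfK // gt_eqF.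
have t2 : cnorm (f z * (g (z + h) - g z - d' * h)) <= e / 3 * cnorm h.
  rewrite NM (@le_trans _ _ (K * (e / 3 / K * cnorm h))) //.
    by rewrite ler_pM ?N_ge0 // /K; lra.
  by rewrite mulrA (mulrC K) divfK // gt_eqF.
have t3 : cnorm (d * h * (g (z + h) - g z)) <= e / 3 * cnorm h.
  rewrite !NM (@le_trans _ _ (L * cnorm h * cnorm h)) //.
    rewrite (@le_trans _ _ (cnorm d * cnorm h * ((cnorm d' + 1) * cnorm h))) //.
      by rewrite ler_wpM2l // mulr_ge0.
    rewrite (_ : _ * _ = cnorm d * (cnorm d' + 1) * cnorm h * cnorm h); last by ring.
    by rewrite !ler_wpM2r // /L lerDl.
  rewrite ler_wpM2r //.
  by rewrite mulrC -ler_pdivlMr // ltW.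
apply: le_trans (ND _ _) _; have := ND ((f (z + h) - f z - d * h) * g (z + h)) (f z * (g (z + h) - g z - d' * h)).
lra.
Qed.

Lemma cdiff_comp f g z d d' :
  cdiff f z d -> cdiff g (f z) d' -> cdiff (fun w => g (f w)) z (d' * d).
Proof.
move=> Hf Hg e e0.
have [r1 r10 Hl] := cdiff_lip Hf.
have ? := N_ge0 d'; have ? := N_ge0 d.
set K := cnorm d' + 1; set L := cnorm d + 1.
have K0 : 0 < K by rewrite /K; lra.
have L0 : 0 < L by rewrite /L; lra.
have e1 : 0 < e / 2 / K by rewrite !divr_gt0.
have e2 : 0 < e / 2 / L by rewrite !divr_gt0.
have [r r0 {}Hf] := Hf _ e1; have [s s0 {}Hg] := Hg _ e2.
exists (Num.min (Num.min r1 r) (s / L)).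
  by rewrite !lt_min r10 r0 divr_gt0.
move=> h; rewrite !lt_min => /andP[/andP[h1 h2]]; rewrite ltr_pdivlMr // mulrC => h3.
have fl := Hl _ h1; have fd := Hf _ h2.
set k := f (z + h) - f z.
have -> : f (z + h) = f z + k by rewrite /k; ring.
have kl : cnorm k <= L * cnorm h by [].
have gd := Hg k (le_lt_trans kl h3).
rewrite (_ : _ - _ - _ = (g (f z + k) - g (f z) - d' * k) + d' * (k - d * h)); last by ring.
have Nh := N_ge0 h.
have t1 : cnorm (g (f z + k) - g (f z) - d' * k) <= e / 2 * cnorm h.
  apply: le_trans gd _; rewrite (@le_trans _ _ (e / 2 / L * (L * cnorm h))) //.
    by rewrite ler_wpM2l // ltW.
  by rewrite mulrA divfK // gt_eqF.
have t2 : cnorm (d' * (k - d * h)) <= e / 2 * cnorm h.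
  rewrite NM (@le_trans _ _ (K * (e / 2 / K * cnorm h))) //.
    by rewrite ler_pM ?N_ge0 // /K; lra.
  by rewrite mulrA (mulrC K) divfK // gt_eqF.
by apply: le_trans (ND _ _) _; lra.
Qed.

Lemma cdiffV z : z != 0 -> cdiff (fun w : C => w^-1) z (- z^-1 ^+ 2).
Proof.
move=> z0 e e0; have Nz : 0 < cnorm z by rewrite N_gt0.
exists (Num.min (cnorm z / 2) (e * cnorm z ^+ 3 / 2)).
  by rewrite !lt_min !divr_gt0 // mulr_gt0 // exprn_gt0.
move=> h; rewrite lt_min => /andP[h1 h2].
have zh : cnorm z / 2 <= cnorm (z + h).
  by have := ND (z + h) (- h); rewrite NN addrK; lra.
have zh0 : z + h != 0 by rewrite -N_gt0; lra.
rewrite (_ : _ - _ - _ = h * h / ((z + h) * z ^+ 2)); last by field; rewrite zh0 z0.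
rewrite NM NM NV NM NX mulrAC.
have Nh := N_ge0 h.
rewrite ler_wpM2r // ler_pdivrMr; last by rewrite mulr_gt0 ?exprn_gt0 //; lra.
apply: le_trans (ltW h2) _.
rewrite (_ : _ / 2 = e * (cnorm z / 2 * cnorm z ^+ 2)); last by ring.
by rewrite (ler_wpM2l (ltW e0)) // ler_wpM2r // exprn_ge0 // N_ge0.
Qed.

Lemma hol_cst c z : hol (fun=> c) z. Proof. by exists 0; apply: cdiff_cst. Qed.
Lemma hol_id z : hol (fun w => w) z. Proof. by exists 1; apply: cdiff_id. Qed.
Lemma holD f g z : hol f z -> hol g z -> hol (fun w => f w + g w) z.
Proof. by move=> [d ?] [d' ?]; exists (d + d'); apply: cdiffD. Qed.
Lemma holM f g z : hol f z -> hol g z -> hol (fun w => f w * g w) z.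
Proof. by move=> [d ?] [d' ?]; exists (d * g z + f z * d'); apply: cdiffM. Qed.
Lemma hol_comp f g z : hol f z -> hol g (f z) -> hol (fun w => g (f w)) z.
Proof. by move=> [d ?] [d' ?]; exists (d' * d); apply: cdiff_comp. Qed.
Lemma holZ c f z : hol f z -> hol (fun w => c * f w) z.
Proof. exact/holM/hol_cst. Qed.
Lemma holN f z : hol f z -> hol (fun w => - f w) z.
Proof.
move=> /(holZ (- 1)); apply: (@hol_local _ _ _ 1) => // h _; by rewrite mulN1r.
Qed.
Lemma holB f g z : hol f z -> hol g z -> hol (fun w => f w - g w) z.
Proof. by move=> Hf Hg; apply: holD => //; apply: holN. Qed.
Lemma holV f z : hol f z -> f z != 0 -> hol (fun w => (f w)^-1) z.
Proof. by move=> Hf fz; apply: hol_comp Hf _; exists (- (f z)^-1 ^+ 2); apply: cdiffV. Qed.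
Lemma holX f z n : hol f z -> hol (fun w => f w ^+ n) z.
Proof.
move=> Hf; elim: n => [|n IH]; first exact: hol_cst.
have := holM Hf IH; apply: (@hol_local _ _ _ 1) => // h _; by rewrite exprS.
Qed.

Lemma ccontZ c f z : ccont f z -> ccont (fun w => c * f w) z.
Proof.
move=> Hf e e0; have Nc := N_ge0 c.
have [|r r0 H] := Hf (e / (cnorm c + 1)); first by rewrite divr_gt0 //; lra.
exists r => // h /H; rewrite -mulrBr NM ler_pdivlMr; last by lra.
by have := N_ge0 (f (z + h) - f z); nra.
Qed.

Lemma ccont_comp f g z : ccont f z -> ccont g (f z) -> ccont (fun w => g (f w)) z.
Proof.
move=> Hf Hg e e0; have [s s0 {}Hg] := Hg _ e0.
have [|r r0 {}Hf] := Hf (s / 2); first by lra.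
exists r => // h /Hf h1.
set k := f (z + h) - f z in h1 *.
have -> : f (z + h) = f z + k by rewrite /k; ring.
by apply: Hg; apply: le_lt_trans h1 _; lra.
Qed.

End Diff.

(** * Compactness by bisection of rectangles and intervals *)

Section Cousin.
Variable R : realType.

Lemma exists_pow2 (w d : R) : 0 < d -> exists n, forall m, (n <= m)%N -> w < d * 2 ^+ m.
Proof.
move=> d0; have := archi_boundP (normr_ge0 (w / d)); set n := Num.bound _ => nP.
exists n => m nm.
rewrite mulrC -ltr_pdivrMr // (le_lt_trans (ler_norm _)) // (lt_le_trans nP) //.
rewrite -natrX ler_nat (leq_trans nm) // ltnW //; exact: ltn_expl.
Qed.

Variable P : R -> R -> R -> R -> Prop.
Variables x0 x1 y0 y1 : R.
Hypothesis x01 : x0 <= x1.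
Hypothesis y01 : y0 <= y1.
Hypothesis Psplit : forall a b c d, a <= b -> c <= d ->
  x0 <= a -> b <= x1 -> y0 <= c -> d <= y1 ->
  let m := (a + b) / 2 in let n := (c + d) / 2 in
  P a m c n -> P m b c n -> P a m n d -> P m b n d -> P a b c d.
Hypothesis Plocal : forall x y, x0 <= x <= x1 -> y0 <= y <= y1 ->
  exists2 r : R, 0 < r & forall a b c d, a <= x <= b -> c <= y <= d ->
    x0 <= a -> b <= x1 -> y0 <= c -> d <= y1 ->
    b - a < r -> d - c < r -> P a b c d.

Let quad := (R * R * R * R)%type.
Let PQ (q : quad) := let: (a, b, c, d) := q in P a b c d.
(** Keeps a quarter on which [P] fails. The fourth quarter is the default: if [P] held on all four,
    [Psplit] would give it on the whole. *)
Let step (q : quad) : quad := let: (a, b, c, d) := q in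
  let m := (a + b) / 2 in let n := (c + d) / 2 in
  if ~~ `[< P a m c n >] then (a, m, c, n) else
  if ~~ `[< P m b c n >] then (m, b, c, n) else
  if ~~ `[< P a m n d >] then (a, m, n, d) else (m, b, n, d).
Let Q n := iter n step (x0, x1, y0, y1).
Let qa n := (Q n).1.1.1.
Let qb n := (Q n).1.1.2.
Let qc n := (Q n).1.2.
Let qd n := (Q n).2.

Let QS n : (Q n.+1 = step (qa n, qb n, qc n, qd n)).
Proof.
rewrite /qa /qb /qc /qd [LHS]iterS -/(Q n).
by case: (Q n) => [[[a b] c] d].
Qed.

Let st n := step (qa n, qb n, qc n, qd n).
Let QSa n : qa n.+1 = (st n).1.1.1. Proof. by rewrite /st -QS. Qed.
Let QSb n : qb n.+1 = (st n).1.1.2. Proof. by rewrite /st -QS. Qed.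
Let QSc n : qc n.+1 = (st n).1.2. Proof. by rewrite /st -QS. Qed.
Let QSd n : qd n.+1 = (st n).2. Proof. by rewrite /st -QS. Qed.

Let Qinv n : [/\ qa n <= qb n, qc n <= qd n, x0 <= qa n /\ qb n <= x1
  & y0 <= qc n /\ qd n <= y1].
Proof.
elim: n => [|n [h1 h2 [h3 h4] [h5 h6]]]; first by [].
rewrite QSa QSb QSc QSd /st /step.
by do 3?case: ifP => _ /=; split; try split; lra.
Qed.

Let Qwidth n : (qb n - qa n) * 2 ^+ n = x1 - x0 /\ (qd n - qc n) * 2 ^+ n = y1 - y0.
Proof.
elim: n => [|n [h1 h2]]; first by rewrite expr0 !mulr1.
rewrite -h1 -h2 exprS QSa QSb QSc QSd /st /step.
by do 3?case: ifP => _ /=; split; field.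
Qed.

Let Qmono n : [/\ qa n <= qa n.+1, qb n.+1 <= qb n, qc n <= qc n.+1 & qd n.+1 <= qd n].
Proof.
have [h1 h2 _ _] := Qinv n.
rewrite QSa QSb QSc QSd /st /step.
by do 3?case: ifP => _ /=; split; lra.
Qed.

Let QnP n : ~ P x0 x1 y0 y1 -> ~ PQ (Q n).
Proof.
move=> nP; elim: n => [|n IH] //.
have [h1 h2 [h3 h4] [h5 h6]] := Qinv n.
have IH' : ~ P (qa n) (qb n) (qc n) (qd n).
  by move: IH; rewrite /qa /qb /qc /qd; case: (Q n) => [[[a b] c] d].
rewrite QS /step; case: ifP => [/asboolP //|/negbFE/asboolP p1].
case: ifP => [/asboolP //|/negbFE/asboolP p2].
case: ifP => [/asboolP //|/negbFE/asboolP p3] p4.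
exact/IH'/Psplit.
Qed.

Let mono_le (u : nat -> R) : (forall n, u n <= u n.+1) -> forall m n, (m <= n)%N -> u m <= u n.
Proof.
move=> H m n /subnK <-; elim: (n - m)%N => [|k IH]; first by rewrite add0n.
by rewrite addSn (le_trans IH).
Qed.

Let nested (u v : nat -> R) : (forall n, u n <= u n.+1) -> (forall n, v n.+1 <= v n) ->
  (forall n, u n <= v n) -> exists x, forall n, u n <= x <= v n.
Proof.
move=> hu hv huv; exists (sup (range u)).
have ub n : ubound (range u) (v n).
  move=> _ [m _ <-]; have [mn|/ltnW nm] := leqP m n.
    by apply: le_trans (mono_le hu mn) _.
  apply: le_trans (huv m) _.
  rewrite -lerN2; apply: (@mono_le (fun k => - v k)) nm => k; by rewrite lerN2.
move=> n; apply/andP; split.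
  by apply: ub_le_sup; [exists (v 0%N) | exists n].
by apply: ge_sup; [exists (u 0%N), 0%N | ].
Qed.

(** If [P] fails, it fails on a nested sequence of quarters. These shrink to a point, and [Plocal]
    at that point contradicts the failure as soon as the sides, divided by [2 ^+ m], are below its
    radius. *)
Lemma cousin2 : P x0 x1 y0 y1.
Proof.
case: (pselect (P x0 x1 y0 y1)) => // nP; exfalso.
have [x xP] : exists x, forall n, qa n <= x <= qb n.
  by apply: nested => n; have [] := Qmono n; have [] := Qinv n.
have [y yP] : exists x, forall n, qc n <= x <= qd n.
  by apply: nested => n; have [] := Qmono n; have [] := Qinv n.
have [||r r0 H] := @Plocal x y; [exact: (xP 0%N) | exact: (yP 0%N) | ].
have [n n1] := exists_pow2 (x1 - x0) r0.
have [k k1] := exists_pow2 (y1 - y0) r0.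
have := n1 _ (leq_maxl n k); have := k1 _ (leq_maxr n k).
set m := maxn n k; have [<- <-] := Qwidth m.
have p0 : 0 < 2 ^+ m :> R by rewrite exprn_gt0.
rewrite !ltr_pM2r // => c1 c2.
have [_ _ [h3 h4] [h5 h6]] := Qinv m.
have := @QnP m nP; have := H (qa m) (qb m) (qc m) (qd m) (xP m) (yP m) h3 h4 h5 h6 c2 c1.
by rewrite /qa /qb /qc /qd; case: (Q m) => [[[a b] c] d].
Qed.

End Cousin.

Section Cousin1.
Variable R : realType.

(** The interval is treated as a rectangle of height 0. *)
Lemma cousin1 (P : R -> R -> Prop) (x0 x1 : R) : x0 <= x1 ->
  (forall a b, a <= b -> x0 <= a -> b <= x1 ->
    P a ((a + b) / 2) -> P ((a + b) / 2) b -> P a b) ->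
  (forall x, x0 <= x <= x1 -> exists2 r : R, 0 < r & forall a b,
    a <= x <= b -> x0 <= a -> b <= x1 -> b - a < r -> P a b) ->
  P x0 x1.
Proof.
move=> x01 Ps Pl; apply: (@cousin2 _ (fun a b _ _ => P a b) x0 x1 0 0) => //.
  by move=> a b c d ab cd ax bx _ _ /= p1 p2 _ _; apply: Ps.
move=> x y hx hy; have [r r0 H] := Pl _ hx; exists r => // a b c d h1 _ h2 h3 _ _ h4 _.
exact: H.
Qed.

End Cousin1.

(** * Averages over segments *)

Section Average.
Variable R : realType.
Local Notation C := R[i].
Implicit Types (f g : C -> C) (a h z c d l : C).

(* Averages over dyadic subdivisions play the role of line integrals:
   [h * Av f a h] is the integral of [f] over the segment [a, a + h]. *)
Fixpoint dyad f (n : nat) a h : C :=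
  if n is m.+1 then (dyad f m a (h / 2) + dyad f m (a + h / 2) (h / 2)) / 2
  else f a.

Definition is_av f a h l := forall e : R, 0 < e ->
  exists n, forall m, (n <= m)%N -> cnorm (dyad f m a h - l) <= e.

Definition seg a h (t : R) := a + real_complex R t * h.

(** The default 0 serves only when the dyadic averages have no limit; [AvP] excludes this for [f]
    continuous along the segment. *)
Definition Av f a h := xget 0 [set l | is_av f a h l]%classic.

Lemma seg_half1 a h t : seg a (h / 2) t = seg a h (t / 2).
Proof. by rewrite /seg rmorphM fmorphV rmorph_nat; field. Qed.

Lemma seg_half2 a h t : seg (a + h / 2) (h / 2) t = seg a h ((1 + t) / 2).
Proof. by rewrite /seg rmorphM fmorphV rmorphD rmorph_nat rmorph1; field. Qed.

Lemma dyad_ext f g n a h : (forall t, 0 <= t <= 1 -> f (seg a h t) = g (seg a h t)) ->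
  dyad f n a h = dyad g n a h.
Proof.
elim: n a h => [|n IH] a h H /=.
  by have := H 0; rewrite /seg mul0r addr0 lexx ler01; apply.
rewrite !IH // => t t01; rewrite ?(seg_half2, seg_half1); apply: H; lra.
Qed.

Lemma dyad_le f n a h (M : R) : (forall t, 0 <= t <= 1 -> cnorm (f (seg a h t)) <= M) ->
  cnorm (dyad f n a h) <= M.
Proof.
elim: n a h => [|n IH] a h H /=.
  by have := H 0; rewrite /seg mul0r addr0 lexx ler01; apply.
have h1 : cnorm (dyad f n a (h / 2)) <= M.
  by apply: IH => t t01; rewrite seg_half1; apply: H; lra.
have h2 : cnorm (dyad f n (a + h / 2) (h / 2)) <= M.
  by apply: IH => t t01; rewrite seg_half2; apply: H; lra.
rewrite NM NV Nnat ler_pdivrMr // (le_trans (ND _ _)) //; lra.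
Qed.

Lemma dyadD f g n a h : dyad (fun z => f z + g z) n a h = dyad f n a h + dyad g n a h.
Proof. by elim: n a h => [|n IH] a h //=; rewrite !IH; ring. Qed.

Lemma dyadZ c f n a h : dyad (fun z => c * f z) n a h = c * dyad f n a h.
Proof. by elim: n a h => [|n IH] a h //=; rewrite !IH; ring. Qed.

Lemma dyad_cst c n a h : dyad (fun=> c) n a h = c.
Proof. by elim: n a h => [|n IH] a h //=; rewrite !IH; field. Qed.

Lemma dyad_shift f n a h c : dyad f n (a + c) h = dyad (fun z => f (z + c)) n a h.
Proof. by elim: n a h => [|n IH] a h //=; rewrite -!IH addrAC. Qed.

(** Sampling at left endpoints misses the midpoint by half a step, the step being [h / 2 ^+ n]. *)
Lemma dyad_id n a h : dyad (fun z => z) n a h = a + h / 2 - h / 2 ^+ n.+1.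
Proof.
elim: n a h => [|n IH] a h /=; first by rewrite expr1; field.
rewrite !IH !exprS; field; by rewrite expf_neq0 ?pnatr_eq0.
Qed.

Lemma is_av_unique f a h l l' : is_av f a h l -> is_av f a h l' -> l = l'.
Proof.
move=> H H'; apply: Neq_small => e e0; have e2 : 0 < e / 2 by lra.
have [n {}H] := H _ e2; have [n' {}H'] := H' _ e2.
have := H _ (leq_maxl n n'); have := H' _ (leq_maxr n n').
set D := dyad _ _ _ _; have := NBD D l l'; rewrite (NBC l D); lra.
Qed.

Lemma is_avE f a h l : is_av f a h l -> Av f a h = l.
Proof. by move=> H; apply: (is_av_unique _ H); rewrite /Av; case: xgetP => [x _ Hx|/(_ l)]. Qed.

Lemma is_avD f g a h l l' : is_av f a h l -> is_av g a h l' ->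
  is_av (fun z => f z + g z) a h (l + l').
Proof.
move=> H H' e e0; have e2 : 0 < e / 2 by lra.
have [n {}H] := H _ e2; have [n' {}H'] := H' _ e2.
exists (maxn n n') => m; rewrite geq_max => /andP[/H h1 /H' h2].
by rewrite dyadD opprD addrACA (le_trans (ND _ _)) //; lra.
Qed.

Lemma is_avZ c f a h l : is_av f a h l -> is_av (fun z => c * f z) a h (c * l).
Proof.
move=> H e e0; have Nc := N_ge0 c.
have [|n {}H] := H (e / (cnorm c + 1)); first by rewrite divr_gt0 //; lra.
exists n => m /H; rewrite dyadZ -mulrBr NM ler_pdivlMr; last by lra.
have := N_ge0 (dyad f m a h - l); nra.
Qed.

Lemma is_av_cst c a h : is_av (fun=> c) a h c.
Proof. by move=> e e0; exists 0%N => m _; rewrite dyad_cst subrr N0 ltW. Qed.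

Lemma is_av_id a h : is_av (fun z => z) a h (a + h / 2).
Proof.
move=> e e0; have [n H] := exists_pow2 (cnorm h) e0; exists n => m /H nm.
rewrite dyad_id (_ : _ - _ = - (h / 2 ^+ m.+1)); last by ring.
rewrite NN NM NV NX Nnat ler_pdivrMr ?exprn_gt0 // exprS.
have p0 : 0 < 2 ^+ m :> R by rewrite exprn_gt0.
nra.
Qed.

Lemma is_av_le f a h l (M : R) : is_av f a h l ->
  (forall t, 0 <= t <= 1 -> cnorm (f (seg a h t)) <= M) -> cnorm l <= M.
Proof.
move=> H fM; apply/ler_addgt0Pl => e e0; have [n {}H] := H _ e0.
have := H n (leqnn n); have := dyad_le n fM.
have := NBD (dyad f n a h) l 0; rewrite !subr0 NBC; lra.
Qed.

Lemma is_av_ext f g a h l : (forall t, 0 <= t <= 1 -> f (seg a h t) = g (seg a h t)) ->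
  is_av f a h l -> is_av g a h l.
Proof.
move=> fg H e /H[n {}H]; exists n => m /H; by rewrite (dyad_ext _ fg).
Qed.

Lemma is_av_shift f a h c l : is_av (fun z => f (z + c)) a h l -> is_av f (a + c) h l.
Proof.
by move=> H e /H[n {}H]; exists n => m /H; rewrite dyad_shift.
Qed.

Lemma is_av_split f a h l l' : is_av f a (h / 2) l -> is_av f (a + h / 2) (h / 2) l' ->
  is_av f a h ((l + l') / 2).
Proof.
move=> H H' e e0.
have [n {}H] := H _ e0; have [n' {}H'] := H' _ e0.
exists (maxn n n').+1 => -[//|m]; rewrite ltnS geq_max => /andP[/H h1 /H' h2] /=.
rewrite -mulrBl opprD addrACA NM NV Nnat ler_pdivrMr //.
by rewrite (le_trans (ND _ _)) //; lra.
Qed.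

Definition seg_cont f a h := forall t, 0 <= t <= 1 -> ccont f (seg a h t).

(** Uniform continuity by bisection. In [P] only [s] is confined to the subinterval while [t] runs
    over all of [0, 1], so two halves can be glued without a separate treatment of pairs on both
    sides of the midpoint. *)
Lemma seg_unif f a h (e : R) : seg_cont f a h -> 0 < e -> exists2 r : R, 0 < r &
  forall s t, 0 <= s <= 1 -> 0 <= t <= 1 -> `|s - t| < r ->
    cnorm (f (seg a h s) - f (seg a h t)) <= e.
Proof.
move=> fc e0.
pose P (x y : R) := exists2 r : R, 0 < r &
  forall s t, x <= s <= y -> 0 <= t <= 1 -> `|s - t| < r ->
    cnorm (f (seg a h s) - f (seg a h t)) <= e.
suff : P 0 1 by [].
apply: cousin1 => //.
  move=> x y xy x0 y1 [r r0 Hr] [s s0 Hs]; exists (Num.min r s); first exact: min2_gt0.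
  move=> u t hu ht; rewrite lt_min => /andP[h1 h2].
  have [um|um] := lerP u ((x + y) / 2); [apply: Hr | apply: Hs] => //; lra.
move=> x x01; have e2 : 0 < e / 2 by lra.
have [r r0 H] := fc _ x01 _ e2; have Nh := N_ge0 h.
have k0 : 0 < r / (cnorm h + 1) / 2 by rewrite !divr_gt0 //; lra.
have key t : `|t - x| < r / (cnorm h + 1) -> cnorm (f (seg a h t) - f (seg a h x)) <= e / 2.
  move=> tx; have -> : seg a h t = seg a h x + real_complex R (t - x) * h.
    by rewrite /seg rmorphB /=; ring.
  apply: H; rewrite NM Nreal; move: tx; rewrite ltr_pdivlMr; last by lra.
  have := normr_ge0 (t - x); nra.
exists (r / (cnorm h + 1) / 2) => // u v hx u0 v1 uv.
exists (r / (cnorm h + 1) / 2) => // s t hs ht st.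
have sx : `|s - x| < r / (cnorm h + 1) / 2 by rewrite ltr_norml; lra.
have tx : `|t - x| < r / (cnorm h + 1).
  have := ler_distD s t x; rewrite (distrC t s); lra.
have := key s; have := key t tx; have := NBD (f (seg a h x)) (f (seg a h s)) (f (seg a h t)).
rewrite (NBC (f (seg a h x))); lra.
Qed.

(** The sample points of level [n] lie within [2 ^- m] of the left endpoints of level [m]. The
    induction peels off one halving of both; at [m = 0] an average is compared with the single value
    [f a]. *)
Lemma dyad_cauchy f m n a h (e : R) : (m <= n)%N ->
  (forall s t, 0 <= s <= 1 -> 0 <= t <= 1 -> `|s - t| <= 2 ^- m ->
     cnorm (f (seg a h s) - f (seg a h t)) <= e) ->
  cnorm (dyad f n a h - dyad f m a h) <= e.
Proof.
elim: m n a h => [|m IH] n a h mn H /=.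
  have -> : dyad f n a h - f a = dyad (fun z => f z + (- f a)) n a h.
    by rewrite dyadD dyad_cst.
  apply: dyad_le => t t01; have -> : a = seg a h 0 by rewrite /seg mul0r addr0.
  rewrite {2}/seg -/(seg _ _ _) [in seg _ h t]/seg mul0r addr0.
  apply: H => //; first by rewrite lexx ler01.
  by rewrite expr0 invr1 subr0 ger0_norm; lra.
case: n mn => [//|n] mn /=.
rewrite -mulrBl opprD addrACA NM NV Nnat ler_pdivrMr // (le_trans (ND _ _)) //.
have p0 : 0 < 2 ^- m :> R by rewrite invr_gt0 exprn_gt0.
have hm : 2 ^- m.+1 = 2 ^- m / 2 :> R by rewrite exprS invfM mulrC.
have h1 : cnorm (dyad f n a (h / 2) - dyad f m a (h / 2)) <= e.
  apply: IH => // s t hs ht st; rewrite !seg_half1; apply: H; try lra.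
  by rewrite hm -mulrBl normrM (ger0_norm (x := 2^-1)) //; lra.
have h2 : cnorm (dyad f n (a + h / 2) (h / 2) - dyad f m (a + h / 2) (h / 2)) <= e.
  apply: IH => // s t hs ht st; rewrite !seg_half2; apply: H; try lra.
  have -> : (1 + s) / 2 - (1 + t) / 2 = (s - t) / 2 by field.
  by rewrite hm normrM (ger0_norm (x := 2^-1)) //; lra.
lra.
Qed.

End Average.

(** * Completeness of [R[i]]; Goursat's theorem on rectangles *)

Section Complete.
Variable R : realType.
Local Notation C := R[i].

Lemma cauchy_R (u : nat -> R) :
  (forall e, 0 < e -> exists n, forall m, (n <= m)%N -> `|u m - u n| <= e) ->
  exists l, forall e, 0 < e -> exists n, forall m, (n <= m)%N -> `|u m - l| <= e.
Proof.
move=> H.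
have /cauchy_cvg cv : cauchy (u @ \oo)%classic.
  apply/cauchy_exP => e e0; have [|n {}H] := H (e / 2); first by lra.
  exists (u n); exists n => // m /= nm; rewrite /ball /= distrC.
  by apply: le_lt_trans (H _ nm) _; lra.
exists (lim (u @ \oo)%classic) => e e0.
have /cvgrPdist_le /(_ e e0) [n _ Hn] := cv.
by exists n => m nm; rewrite distrC; apply: Hn.
Qed.

Lemma cauchy_C (u : nat -> C) :
  (forall e, 0 < e -> exists n, forall m, (n <= m)%N -> cnorm (u m - u n) <= e) ->
  exists l, forall e, 0 < e -> exists n, forall m, (n <= m)%N -> cnorm (u m - l) <= e.
Proof.
move=> H.
have [|a Ha] := @cauchy_R (fun n => complex.Re (u n)).
  move=> e /H[n {}H]; exists n => m /H; apply: le_trans.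
  by rewrite -ReN -ReD N_ge_Re.
have [|b Hb] := @cauchy_R (fun n => complex.Im (u n)).
  move=> e /H[n {}H]; exists n => m /H; apply: le_trans.
  by rewrite -ImN -ImD N_ge_Im.
exists (Complex a b) => e e0; have e2 : 0 < e / 2 by lra.
have [n {}Ha] := Ha _ e2; have [k {}Hb] := Hb _ e2; exists (maxn n k) => m.
rewrite geq_max => /andP[/Ha h1 /Hb h2]; apply: le_trans (N_le_ReIm _) _.
by rewrite ReD ReN ImD ImN /=; lra.
Qed.

End Complete.

Section Goursat.
Variable R : realType.
Local Notation C := R[i].
Local Notation "x %:C" := (real_complex R x).
Implicit Types (f g : C -> C).

Lemma is_av_exists f a h : seg_cont f a h -> exists l, is_av f a h l.
Proof.
move=> fc; apply: cauchy_C => e e0; have [r r0 H] := seg_unif fc e0.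
have [n /(_ n (leqnn n)) n1] := exists_pow2 1 r0.
exists n => m nm; apply: dyad_cauchy => // s t hs ht st; apply: H => //.
by apply: le_lt_trans st _; rewrite -[_ ^- _]mul1r ltr_pdivrMr // exprn_gt0.
Qed.

Lemma AvP f a h : seg_cont f a h -> is_av f a h (Av f a h).
Proof. by move=> /is_av_exists[l H]; rewrite (is_avE H). Qed.

Lemma Av_split f a h : seg_cont f a h ->
  Av f a h = (Av f a (h / 2) + Av f (a + h / 2) (h / 2)) / 2.
Proof.
move=> fc; apply: is_avE; apply: is_av_split; apply: AvP => t t01.
  by rewrite seg_half1; apply: fc; lra.
by rewrite seg_half2; apply: fc; lra.
Qed.

Lemma seg_h (a y w t : R) : seg (Complex a y) (w%:C) t = Complex (a + t * w) y.
Proof. by rewrite /seg -rmorphM; apply: Cext; rewrite ?ReD ?ImD /= ?addr0. Qed.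

Lemma seg_v (x c w t : R) : seg (Complex x c) (Complex 0 w) t = Complex x (c + t * w).
Proof. by rewrite /seg; apply: Cext; rewrite /= ?ReD ?ImD /= ?mul0r ?mulr0 ?subr0 ?addr0. Qed.

(* The integral over the boundary of [a, b] x [c, d]. *)
Definition rect_int f (a b c d : R) : C :=
  (b - a)%:C * (Av f (Complex a c) (b - a)%:C - Av f (Complex a d) (b - a)%:C)
  + Complex 0 (d - c) *
    (Av f (Complex b c) (Complex 0 (d - c)) - Av f (Complex a c) (Complex 0 (d - c))).

Lemma Av_split_h f (a b y : R) : seg_cont f (Complex a y) (b - a)%:C ->
  let m := (a + b) / 2 in
  Av f (Complex a y) (b - a)%:C =
  (Av f (Complex a y) (m - a)%:C + Av f (Complex m y) (b - m)%:C) / 2.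
Proof.
move=> /Av_split -> m.
have -> : (b - a)%:C / 2 = (m - a)%:C.
  by rewrite -(rmorph_nat (real_complex R) 2) -fmorphV -rmorphM /m; congr (_%:C); field.
have -> : (b - m) = m - a by rewrite /m; field.
suff -> : Complex a y + (m - a)%:C = Complex m y by [].
by apply: Cext; rewrite /= ?addr0; ring.
Qed.

Lemma Av_split_v f (x c d : R) : seg_cont f (Complex x c) (Complex 0 (d - c)) ->
  let m := (c + d) / 2 in
  Av f (Complex x c) (Complex 0 (d - c)) =
  (Av f (Complex x c) (Complex 0 (m - c)) + Av f (Complex x m) (Complex 0 (d - m))) / 2.
Proof.
move=> /Av_split -> m.
have -> : Complex 0 (d - c) / 2 = Complex 0 (m - c).
  rewrite -(rmorph_nat (real_complex R) 2) -fmorphV; apply: Cext => /=; first by ring.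
  by rewrite /m; field.
have -> : (d - m) = m - c by rewrite /m; field.
suff -> : Complex x c + Complex 0 (m - c) = Complex x m by [].
by apply: Cext => /=; ring.
Qed.

Section Rect.
Variables (f : C -> C) (x0 x1 y0 y1 : R).
Hypothesis fh : forall x y, x0 <= x <= x1 -> y0 <= y <= y1 -> hol f (Complex x y).

Let cont_h a b y : x0 <= a -> a <= b -> b <= x1 -> y0 <= y <= y1 ->
  seg_cont f (Complex a y) (b - a)%:C.
Proof. by move=> h1 h2 h3 h4 t t01; rewrite seg_h; apply/hol_cont/fh => //; nra. Qed.

Let cont_v x c d : y0 <= c -> c <= d -> d <= y1 -> x0 <= x <= x1 ->
  seg_cont f (Complex x c) (Complex 0 (d - c)).
Proof. by move=> h1 h2 h3 h4 t t01; rewrite seg_v; apply/hol_cont/fh => //; nra. Qed.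

Lemma bI_split (a b c d : R) : x0 <= a -> a <= b -> b <= x1 ->
  y0 <= c -> c <= d -> d <= y1 ->
  let m := (a + b) / 2 in let n := (c + d) / 2 in
  rect_int f a b c d = rect_int f a m c n + rect_int f m b c n + rect_int f a m n d + rect_int f m b n d.
Proof.
move=> a0 ab b1 c0 cd d1 m n; rewrite /rect_int.
rewrite (@Av_split_h f a b c) -/m; last by apply: cont_h => //; lra.
rewrite (@Av_split_h f a b d) -/m; last by apply: cont_h => //; lra.
rewrite (@Av_split_v f b c d) -/n; last by apply: cont_v => //; lra.
rewrite (@Av_split_v f a c d) -/n; last by apply: cont_v => //; lra.
have -> : (b - m) = m - a by rewrite /m; field.
have -> : (d - n) = n - c by rewrite /n; field.
have -> : (b - a)%:C = 2 * (m - a)%:C.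
  by rewrite -(rmorph_nat (real_complex R) 2) -rmorphM /m; congr (_%:C); field.
have -> : Complex 0 (d - c) = 2 * Complex 0 (n - c).
  by rewrite -(rmorph_nat (real_complex R) 2); apply: Cext => /=; rewrite /n; field.
by field.
Qed.

(** The affine part of [f] at the point integrates to 0 around the rectangle. The remainder is at
    most [e / 4 * (W + V)] on each edge, so the integral is at most [e / 2 * (W + V) ^+ 2], which is
    below [e * (W ^+ 2 + V ^+ 2)]. *)
Lemma bI_local (e x y : R) : 0 < e -> x0 <= x <= x1 -> y0 <= y <= y1 ->
  exists2 r : R, 0 < r & forall a b c d, a <= x <= b -> c <= y <= d ->
    x0 <= a -> b <= x1 -> y0 <= c -> d <= y1 -> b - a < r -> d - c < r ->
    cnorm (rect_int f a b c d) <= e * ((b - a) ^+ 2 + (d - c) ^+ 2).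
Proof.
move=> e0 hx hy; set p := Complex x y.
have [D HD] := fh hx hy; have e4 : 0 < e / 4 by lra.
have [r r0 {}HD] := HD _ e4; exists (r / 2) => [|a b c d ax cy a0 b1 c0 d1 ba dc]; first by lra.
set W := b - a; set V := d - c.
have W0 : 0 <= W by rewrite /W; lra.
have V0 : 0 <= V by rewrite /V; lra.
(* On an edge the average of the affine part is its value at the midpoint [s + h / 2]. *)
have edge s h : seg_cont f s h -> (forall t, 0 <= t <= 1 -> cnorm (seg s h t - p) <= W + V) ->
    exists l, Av f s h = f p - D * p + D * (s + h / 2) + l /\ cnorm l <= e / 4 * (W + V).
  move=> sc sp; exists (Av f s h - (f p - D * p + D * (s + h / 2))); split; first by ring.
  have := is_avD (AvP sc) (is_avD (is_av_cst (- (f p - D * p)) s h)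
    (is_avZ (- D) (is_av_id s h))).
  move=> /is_av_le; have -> : Av f s h + (- (f p - D * p) + - D * (s + h / 2)) =
    Av f s h - (f p - D * p + D * (s + h / 2)) by ring.
  apply=> t t01; have := HD (seg s h t - p); rewrite subrKC.
  have -> : f (seg s h t) - f p - D * (seg s h t - p) =
    f (seg s h t) + (- (f p - D * p) + - D * seg s h t) by ring.
  have tp := sp t t01; move=> /(_ _)/le_trans; apply; last by rewrite ler_wpM2l // ltW.
  by apply: le_lt_trans tp _; rewrite /W /V; lra.
have dist u v : a <= u <= b -> c <= v <= d -> cnorm (Complex u v - p) <= W + V.
  move=> hu hv; apply: le_trans (N_le_ReIm _) _; rewrite ReD ReN ImD ImN /=.
  by apply: lerD; rewrite ler_norml /W /V; lra.
have [||lb [Eb Hb]] := @edge (Complex a c) W%:C.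
- by apply: cont_h => //; lra.
- by move=> t t01; rewrite seg_h; apply: dist; rewrite /W; [nra | lra].
have [||lt [Et Ht]] := @edge (Complex a d) W%:C.
- by apply: cont_h => //; lra.
- by move=> t t01; rewrite seg_h; apply: dist; rewrite /W; [nra | lra].
have [||lr [Er Hr]] := @edge (Complex b c) (Complex 0 V).
- by apply: cont_v => //; lra.
- by move=> t t01; rewrite seg_v; apply: dist; rewrite /V; [lra | nra].
have [||ll [El Hl]] := @edge (Complex a c) (Complex 0 V).
- by apply: cont_v => //; lra.
- by move=> t t01; rewrite seg_v; apply: dist; rewrite /V; [lra | nra].
rewrite /rect_int -/W -/V Eb Et Er El.
have cd : Complex a d = Complex a c + Complex 0 V.
  by apply: Cext => /=; rewrite /V; ring.
have cb : Complex b c = Complex a c + W%:C.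
  by apply: Cext => /=; rewrite /W; ring.
rewrite cd cb (_ : _ + _ = W%:C * (lb - lt) + Complex 0 V * (lr - ll)); last by ring.
apply: le_trans (ND _ _) _; rewrite !NM Nreal (ger0_norm W0).
have -> : cnorm (Complex 0 V) = V by rewrite /= expr0n /= add0r sqrtr_sqr ger0_norm.
have h1 := NB lb lt; have h2 := NB lr ll.
have k1 : W * cnorm (lb - lt) <= W * (e / 2 * (W + V)) by apply: ler_wpM2l => //; lra.
have k2 : V * cnorm (lr - ll) <= V * (e / 2 * (W + V)) by apply: ler_wpM2l => //; lra.
have : 0 <= e * (W - V) ^+ 2 by rewrite mulr_ge0 ?sqr_ge0 // ltW.
rewrite -/W -/V; nra.
Qed.

(** The sum of the squares of the sides is additive under quartering, as is the integral. The local
    bound of [bI_local] therefore spreads to the whole rectangle by [cousin2]. *)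
Lemma goursat : x0 <= x1 -> y0 <= y1 -> rect_int f x0 x1 y0 y1 = 0.
Proof.
move=> x01 y01; apply: Neq_small => e e0; rewrite subr0.
set K := (x1 - x0) ^+ 2 + (y1 - y0) ^+ 2 + 1.
have K0 : 0 < K by rewrite /K; have := sqr_ge0 (x1 - x0); have := sqr_ge0 (y1 - y0); lra.
have eK : 0 < e / K by rewrite divr_gt0.
apply: (@le_trans _ _ (e / K * ((x1 - x0) ^+ 2 + (y1 - y0) ^+ 2))).
  apply: (@cousin2 _ (fun a b c d => cnorm (rect_int f a b c d) <= e / K * ((b - a) ^+ 2 + (d - c) ^+ 2))) => //.
    move=> a b c d ab cd a0 b1 c0 d1 m n h1 h2 h3 h4.
    rewrite (bI_split a0 ab b1 c0 cd d1) -/m -/n.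
    do 3?apply: le_trans (ND _ _) _.
    have t1 := ND (rect_int f a m c n) (rect_int f m b c n).
    have t2 := ND (rect_int f a m c n + rect_int f m b c n) (rect_int f a m n d).
    apply: (@le_trans _ _ (e / K * ((m - a) ^+ 2 + (n - c) ^+ 2)
      + e / K * ((b - m) ^+ 2 + (n - c) ^+ 2) + e / K * ((m - a) ^+ 2 + (d - n) ^+ 2)
      + e / K * ((b - m) ^+ 2 + (d - n) ^+ 2))); first by lra.
    by rewrite -!mulrDr (ler_wpM2l (ltW eK)) // /m /n le_eqVlt; apply/orP; left; apply/eqP; field.
  by move=> x y hx hy; apply: bI_local.
rewrite mulrAC ler_pdivrMr // ler_wpM2l ?ltW // /K; lra.
Qed.

End Rect.
End Goursat.

(** * Derivability and continuity in epsilon form *)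

Section Derivable.

Lemma derivableP_eps (K : numFieldType) (f : K^o -> K^o) (z : K^o) :
  derivable f z 1 -> forall e : K, 0 < e -> exists2 r : K, 0 < r &
    forall h, `|h| < r -> `|f (z + h) - f z - 'D_1 f z * h| <= e * `|h|.
Proof.
move=> df e e0.
have := df; rewrite /derivable -/('D_1 f z) => /cvgrPdist_le /(_ e e0).
rewrite near_withinE /= => /nbhs_ballP[r /= r0 H].
exists r => // h hr; have [->|h0] := eqVneq h 0.
  by rewrite addr0 subrr mulr0 subr0 normr0 mulr0.
have := H h; rewrite /ball /= sub0r normrN => /(_ hr h0).
rewrite -/('D_1 f z) => H1.
have nh : 0 < `|h| by rewrite normr_gt0.
rewrite -ler_pdivrMr // -normfV -normrM; rewrite distrC in H1.
apply: le_trans H1; rewrite le_eqVlt; apply/orP; left; apply/eqP; congr `| _ |.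
rewrite /shift /= /GRing.scale /= mulr1 (addrC h z); by field.
Qed.

Lemma derivable_eps (K : numFieldType) (f : K^o -> K^o) (z d : K^o) :
  (forall e : K, 0 < e -> exists2 r : K, 0 < r &
    forall h, `|h| < r -> `|f (z + h) - f z - d * h| <= e * `|h|) ->
  derivable f z 1.
Proof.
move=> H; apply/cvg_ex; exists d; apply/cvgrPdist_le => e e0.
have [r r0 {}H] := H _ e0; rewrite near_withinE; apply/nbhs_ballP; exists r => //= h.
rewrite /ball /= sub0r normrN => hr h0.
have nh : 0 < `|h| by rewrite normr_gt0.
have := H h hr; rewrite -ler_pdivrMr // -normfV -normrM distrC.
apply: le_trans; rewrite le_eqVlt; apply/orP; left; apply/eqP; congr `| _ |.
rewrite /shift /= /GRing.scale /= mulr1 (addrC h z); by field.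
Qed.

Variable R : realType.
Implicit Types (f : R -> R).

Lemma is_derive_eps f (x d : R) : is_derive x 1 f d ->
  forall e, 0 < e -> exists2 r, 0 < r &
    forall h, `|h| < r -> `|f (x + h) - f x - d * h| <= e * `|h|.
Proof.
by move=> [df <-] e e0; have := @derivableP_eps _ f x df e e0.
Qed.

Lemma continuous_eps f (x : R) : {for x, continuous f} ->
  forall e, 0 < e -> exists2 r, 0 < r & forall h, `|h| < r -> `|f (x + h) - f x| <= e.
Proof.
move=> /cvgrPdist_le H e e0; have /nbhs_ballP[r /= r0 {}H] := H e e0.
exists r => // h hr; rewrite distrC; apply: H.
by rewrite /ball /= opprD addrA subrr sub0r normrN.
Qed.

Lemma derivable_holP (f : R[i] -> R[i]) z :
  derivable (f : R[i]^o -> R[i]^o) z 1 <-> hol f z.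
Proof.
split=> [df|[d H]].
  exists ('D_1 (f : R[i]^o -> R[i]^o) z) => e e0.
  have e0' : 0 < real_complex R e by rewrite ltcR.
  have [r r0 H] := derivableP_eps df e0'.
  (* In the order of [R[i]] a positive element is real, so radii and tolerances can be moved to
     [R]. *)
  have rE : r = real_complex R (complex.Re r).
    by apply: Cext => //=; case: r r0 {H} => a b; rewrite ltcE /= => /andP[/eqP].
  exists (complex.Re r); first by rewrite -ltcR -rE.
  move=> h hr; have := H h; rewrite !NE rE ltcR -rmorphM /= lecR; exact.
apply: (@derivable_eps _ (f : R[i]^o -> R[i]^o) z d) => e e0.
have eE : e = real_complex R (complex.Re e).
  by apply: Cext => //=; case: e e0 => a b; rewrite ltcE /= => /andP[/eqP].
have [|r r0 {}H] := H (complex.Re e); first by rewrite -ltcR -eE.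
exists (real_complex R r); first by rewrite ltcR.
by move=> h; rewrite !NE eE ltcR -rmorphM /= lecR; exact: H.
Qed.

End Derivable.

(** * The complex exponential and logarithm *)

Section Exp.
Variable R : realType.
Local Notation C := R[i].
Local Notation "x %:C" := (real_complex R x).
Implicit Types (z w : C).

Definition cexp z : C :=
  (expR (complex.Re z))%:C * Complex (cos (complex.Im z)) (sin (complex.Im z)).

Lemma cexp0 : cexp 0 = 1.
Proof. by rewrite /cexp /= expR0 cos0 sin0 mul1r. Qed.

Lemma cexpD z w : cexp (z + w) = cexp z * cexp w.
Proof.
rewrite /cexp ReD ImD expRD cosD sinD rmorphM /=.
by apply: Cext => /=; ring.
Qed.

Lemma N_cexp z : cnorm (cexp z) = expR (complex.Re z).
Proof.
by rewrite NM Nreal ger0_norm ?expR_ge0 //= cos2Dsin2 sqrtr1 mulr1.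
Qed.

Lemma cexp_neq0 z : cexp z != 0.
Proof. by rewrite -N_gt0 N_cexp expR_gt0. Qed.

Lemma cexpN z : cexp (- z) = (cexp z)^-1.
Proof. by apply: (mulfI (cexp_neq0 z)); rewrite -cexpD subrr cexp0 mulfV ?cexp_neq0. Qed.

Lemma cexpB z w : cexp (z - w) = cexp z / cexp w.
Proof. by rewrite cexpD cexpN. Qed.

Lemma cexpMn z n : cexp (z *+ n) = cexp z ^+ n.
Proof. by elim: n => [|n IH]; rewrite ?mulr0n ?cexp0 // mulrS cexpD IH exprS. Qed.

Lemma cexpMz z (k : int) : cexp (z *~ k) = cexp z ^ k.
Proof.
case: k => n; first by rewrite -pmulrn cexpMn.
by rewrite NegzE mulrNz cexpN -pmulrn cexpMn.
Qed.

(** At 0 it follows from the real derivatives of [expR], [cos] and [sin], taken with one tolerance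
    [m]; elsewhere from the functional equation. *)
Lemma cdiff_cexp z : cdiff cexp z (cexp z).
Proof.
have at0 : cdiff cexp 0 1.
  move=> e e0; set m := Num.min (e / 8) (1 / 2).
  have m0 : 0 < m by rewrite lt_min; lra.
  have [me mh] : m <= e / 8 /\ m <= 1 / 2.
    by rewrite /m !ge_min !lexx orbT.
  clearbody m.
  have [r1 r10 H1] := is_derive_eps (is_derive_expR 0) m0.
  have [r2 r20 H2] := is_derive_eps (is_derive_cos 0) m0.
  have [r3 r30 H3] := is_derive_eps (is_derive_sin 0) m0.
  exists (Num.min (Num.min m r1) (Num.min r2 r3)); first by apply: min2_gt0; apply: min2_gt0.
  move=> h; rewrite !lt_min => /andP[/andP[hm h1] /andP[h2 h3]].
  have hx := N_ge_Re h; have hy := N_ge_Im h.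
  set x := complex.Re h in hx *; set y := complex.Im h in hy *.
  set s := sin y - y; set b := cos y - 1; set a := expR x - 1 - x.
  have Ha : `|a| <= m * `|x|.
    by have := H1 x (le_lt_trans hx h1); rewrite !add0r expR0 mul1r.
  have Hb : `|b| <= m * `|y|.
    by have := H2 y (le_lt_trans hy h2); rewrite !add0r cos0 sin0 oppr0 mul0r subr0.
  have Hs : `|s| <= m * `|y|.
    by have := H3 y (le_lt_trans hy h3); rewrite !add0r cos0 sin0 mul1r subr0.
  rewrite add0r cexp0 mul1r.
  have Nh := N_ge0 h.
  have b1 : `|1 + x + a| <= 2.
    apply: le_trans (ler_normD _ _) _; have := ler_normD 1 x; rewrite normr1.
    have : m * `|x| <= m * 1 by rewrite ler_wpM2l //; lra.
    lra.
  apply: le_trans (N_le_ReIm _) _; rewrite !(ReD, ImD, ReN, ImN) /= -/x -/y !mul0r.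
  have -> : expR x * cos y - 0 - 1 - x = a + b * (1 + x + a) by rewrite /a /b; ring.
  have -> : expR x * sin y + 0 - 0 - y = (x + a) * y + (1 + x + a) * s by rewrite /a /s; ring.
  have t1 : `|a| <= m * cnorm h by apply: le_trans Ha _; rewrite ler_wpM2l // ltW.
  have t2 : `|b| <= m * cnorm h by apply: le_trans Hb _; rewrite ler_wpM2l // ltW.
  have t3 : `|s| <= m * cnorm h by apply: le_trans Hs _; rewrite ler_wpM2l // ltW.
  have u1 : `|b * (1 + x + a)| <= m * cnorm h * 2 by rewrite normrM ler_pM.
  have u2 : `|(1 + x + a) * s| <= 2 * (m * cnorm h) by rewrite normrM ler_pM.
  have u3 : `|(x + a) * y| <= (2 * m) * cnorm h.
    rewrite normrM ler_pM //; apply: le_trans (ler_normD _ _) _.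
    have mm : m * cnorm h <= m * 1 by rewrite ler_wpM2l //; lra.
    clear -mm t1 hx hm; clearbody x a; lra.
  have := ler_normD a (b * (1 + x + a)); have := ler_normD ((x + a) * y) ((1 + x + a) * s).
  have : m * cnorm h <= e / 8 * cnorm h by rewrite ler_wpM2r.
  have : 0 <= e * cnorm h by rewrite mulr_ge0 // ltW.
  lra.
move=> e e0; have Nz : 0 < cnorm (cexp z) by rewrite N_gt0 cexp_neq0.
have [|r r0 H] := at0 (e / cnorm (cexp z)); first by rewrite divr_gt0.
exists r => // h /H; rewrite add0r cexp0 mul1r => hh.
rewrite cexpD (_ : _ - _ - _ = cexp z * (cexp h - 1 - h)); last by ring.
by rewrite NM mulrC -ler_pdivlMr // mulrAC.
Qed.

Lemma hol_cexp z : hol cexp z. Proof. by exists (cexp z); apply: cdiff_cexp. Qed.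

Lemma cexp_2pi : cexp (Complex 0 (2 * pi)) = 1.
Proof. by rewrite /cexp /= expR0 mulr_natl cos2pi sin2pi mul1r. Qed.

Lemma cexp_pi : cexp (Complex 0 pi) = - 1.
Proof. by rewrite /cexp /= expR0 cospi sinpi mul1r; apply: Cext => /=; rewrite ?oppr0. Qed.

Lemma cexp_pihalf : cexp (Complex 0 (pi / 2)) = 'i%C.
Proof. by rewrite /cexp /= expR0 cos_pihalf sin_pihalf mul1r. Qed.

(** The modulus kills the real part. After reduction of the imaginary part to [0, 2 pi), its cosine
    is 1, so the sine of its half vanishes, and that sine is positive on the open interval (0,
    pi). *)
Lemma cexp_eq1 z : cexp z = 1 -> exists k : int, z = Complex 0 (2 * pi) *~ k.
Proof.
move=> z1; have p0 := pi_gt0 R.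
have rez : complex.Re z = 0.
  by have := N_cexp z; rewrite z1 N1 -expR0 => /expR_inj.
set k := Num.floor (complex.Im z / (2 * pi)); exists k.
set w := z - Complex 0 (2 * pi) *~ k.
have w1 : cexp w = 1 by rewrite cexpB z1 cexpMz cexp_2pi exp1rz divr1.
have kR : Complex 0 (2 * pi) *~ k = Complex 0 (2 * pi * k%:~R) :> C.
  rewrite -mulrzr -(rmorph_int (real_complex R)); apply: Cext => /=; ring.
have rew : complex.Re w = 0 by rewrite /w kR ReD ReN rez /= subr0.
have imw : 0 <= complex.Im w < 2 * pi.
  have := Num.Theory.floor_itv (complex.Im z / (2 * pi)); rewrite mathcomp_extra.intrD1 -/k => /andP[h1 h2].
  rewrite /w kR ImD ImN /= subr_ge0 ltrBlDr.
  move: h1 h2; rewrite ler_pdivlMr ?ltr_pdivrMr; try lra.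
have cw : cos (complex.Im w) = 1.
  by have := congr1 (@complex.Re R) w1; rewrite /cexp rew /= expR0 mul0r subr0 mul1r.
have sw : sin (complex.Im w / 2) = 0.
  apply/eqP; rewrite -sqrf_eq0 sin2cos2; apply/eqP.
  have := cos_mulr2n (complex.Im w / 2); rewrite -[_ / 2 *+ 2]mulr_natr divfK ?pnatr_eq0 //.
  by rewrite cw -mulr_natr; lra.
have w0 : complex.Im w = 0.
  apply/eqP; rewrite eq_le (andP imw).1 andbT leNgt; apply/negP => wp.
  have : 0 < sin (complex.Im w / 2) by apply: sin_gt0_pi; lra.
  by rewrite sw ltxx.
by apply/eqP; rewrite -subr_eq0 -/w; apply/eqP/Cext; rewrite ?rew ?w0.
Qed.

(** The principal logarithm on the right half-plane, where [atan] of the slope is the argument; it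
    is applied only there. *)
Definition clog z : C := Complex (ln (cnorm z)) (atan (complex.Im z / complex.Re z)).

Lemma clogK z : 0 < complex.Re z -> cexp (clog z) = z.
Proof.
move=> z0; have Nz : 0 < cnorm z by rewrite N_gt0; apply: contraTneq z0 => ->; rewrite ltxx.
rewrite /cexp /= lnK ?posrE //; set t := complex.Im z / complex.Re z.
have ct : cos (atan t) = complex.Re z / cnorm z.
  rewrite cos_atan; have -> : 1 + t ^+ 2 = (cnorm z / complex.Re z) ^+ 2.
    by rewrite /t !expr_div_n sqrN; field; lra.
  by rewrite sqrtr_sqr ger0_norm ?divr_ge0 ?N_ge0 ?ltW // invf_div.
have c0 : cos (atan t) != 0 by rewrite ct mulf_neq0 ?invr_eq0 ?gt_eqF.
have st : sin (atan t) = complex.Im z / cnorm z.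
  have := atanK t; rewrite /tan => /(congr1 (fun u => u * cos (atan t))).
  by rewrite divfK // ct /t => ->; field; lra.
rewrite ct st; apply: Cext => /=; field; lra.
Qed.

Lemma clog1 : clog 1 = 0.
Proof. by rewrite /clog N1 ln1 /= mul0r atan0. Qed.

Lemma clogV z : 0 < complex.Re z -> clog z^-1 = - clog z.
Proof.
move=> z0; have Nz : 0 < cnorm z by rewrite N_gt0; apply: contraTneq z0 => ->; rewrite ltxx.
rewrite /clog NV lnV ?posrE //; apply: Cext => //=.
rewrite -atanN; congr atan; case: z z0 Nz => a b /= a0 _.
by field; rewrite gt_eqF //= gt_eqF // ltr_pwDl ?sqr_ge0 ?exprn_gt0.
Qed.

(** The logarithm of the modulus and the argument each contribute at most [cnorm z / (1 - r)]. *)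
Lemma clog_bound z (r : R) : cnorm z <= r -> r < 1 -> cnorm (clog (1 - z)) <= 2 * cnorm z / (1 - r).
Proof.
move=> zr r1; have Nz := N_ge0 z; have h := N_ge_Re z; have h' := N_ge_Im z.
have hr := ler_norm (complex.Re z).
apply: le_trans (N_le_ReIm _) _; rewrite /clog /= ReD ImD ReN ImN /= sub0r.
have r0 : 0 < 1 - r by lra.
have n1 : 1 - cnorm z <= cnorm (1 - z) by have := N_lerB 1 z; rewrite N1.
have n2 : cnorm (1 - z) <= 1 + cnorm z by have := NB 1 z; rewrite N1.
have Np : 0 < cnorm (1 - z) by lra.
have l1 : `|ln (cnorm (1 - z))| <= cnorm z / (1 - r).
  have zz : cnorm z <= cnorm z / (1 - r).
    by rewrite ler_pdivlMr //; nra.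
  rewrite ler_norml; apply/andP; split; last first.
    apply: le_trans zz; have -> : cnorm (1 - z) = 1 + (cnorm (1 - z) - 1) by ring.
    by apply: le_trans (le_ln1Dx _) _; lra.
  have -> : ln (cnorm (1 - z)) = - ln (cnorm (1 - z))^-1 by rewrite lnV ?posrE // opprK.
  rewrite lerN2; have -> : (cnorm (1 - z))^-1 = 1 + ((cnorm (1 - z))^-1 - 1) by ring.
  have iv : (cnorm (1 - z))^-1 <= 1 + cnorm z / (1 - r).
    rewrite -[leLHS]mul1r ler_pdivrMr //.
    have : (1 + cnorm z / (1 - r)) * (1 - cnorm z) <= (1 + cnorm z / (1 - r)) * cnorm (1 - z).
      by apply: ler_wpM2l => //; have : 0 <= cnorm z / (1 - r) by [rewrite divr_ge0 // ltW]; lra.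
    have : cnorm z <= cnorm z / (1 - r) * (1 - cnorm z).
      rewrite mulrAC ler_pdivlMr // ler_wpM2l //; lra.
    lra.
  have : 0 < (cnorm (1 - z))^-1 by rewrite invr_gt0.
  by move=> ?; apply: le_trans (le_ln1Dx _) _; lra.
have l2 : `|atan (- complex.Im z / (1 - complex.Re z))| <= cnorm z / (1 - r).
  have at_le (t : R) : 0 <= t -> atan t <= t.
    move=> t0; have [->|tn] := eqVneq t 0; first by rewrite atan0.
    have tp : 0 < t by rewrite lt_def tn.
    have [|c _] := @MVT R (@atan R) (fun x => (1 + x ^+ 2)^-1) 0 t tp.
      by apply: continuous_subspaceT => x; apply: continuous_atan.
    rewrite atan0 !subr0 => ->; rewrite -[leRHS]mul1r ler_wpM2r // invf_le1.
      by rewrite lerDl sqr_ge0.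
    by rewrite ltr_pwDl // sqr_ge0.
  have at_abs (t : R) : `|atan t| <= `|t|.
    have [t0|t0] := leP 0 t.
      rewrite (ger0_norm t0) ger0_norm ?at_le //.
      by rewrite -atan0; apply: le_atan.
    have tN : 0 <= - t by rewrite oppr_ge0 ltW.
    have aN : 0 <= atan (- t) by rewrite -[X in X <= _]atan0; apply: le_atan.
    by rewrite (ltr0_norm t0) -normrN -atanN (ger0_norm aN) at_le.

  apply: le_trans (at_abs _) _; rewrite normrM normrN normfV (ger0_norm (x := 1 - complex.Re z)); last by lra.
  apply: ler_pM => //; first by rewrite invr_ge0; lra.
  by rewrite lef_pV2 ?posrE; lra.
lra.
Qed.

Lemma ccont_clog z : 0 < complex.Re z -> ccont clog z.
Proof.
move=> z0 e e0; have Nz : 0 < cnorm z by rewrite N_gt0; apply: contraTneq z0 => ->; rewrite ltxx.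
have e2 : 0 < e / 2 by lra.
have [r r0 H] := continuous_eps (continuous_ln Nz) e2.
set a := complex.Re z in z0 *; set b := complex.Im z.
have [s s0 K] := continuous_eps (@continuous_atan R (b / a)) e2.
set M := (a + `|b|) / (a * (a / 2)).
have M0 : 0 < M by rewrite divr_gt0 ?mulr_gt0 //; have := normr_ge0 b; lra.
exists (Num.min r (Num.min (a / 2) (s / M))).
  by apply: min2_gt0 => //; apply: min2_gt0; apply: divr_gt0.
move=> h; rewrite !lt_min => /andP[h1 /andP[h2 h3]].
apply: le_trans (N_le_ReIm _) _; rewrite ReD ReN ImD ImN /= ReD ImD -/a -/b.
have hx := N_ge_Re h; have hy := N_ge_Im h.
set x := complex.Re h in hx *; set y := complex.Im h in hy *.
have t1 : `|ln (cnorm (z + h)) - ln (cnorm z)| <= e / 2.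
  have -> : cnorm (z + h) = cnorm z + (cnorm (z + h) - cnorm z) by ring.
  apply: H; apply: le_lt_trans h1; rewrite ler_norml.
  by have := N_lerB (z + h) z; have := N_lerB z (z + h); rewrite (NBC z) (_ : z + h - z = h); [lra | ring].
have t2 : `|atan ((b + y) / (a + x)) - atan (b / a)| <= e / 2.
  have xa : a / 2 <= a + x by move: hx; rewrite ler_norml; lra.
  have -> : (b + y) / (a + x) = b / a + (a * y - b * x) / (a * (a + x)).
    by field; rewrite !gt_eqF //; lra.
  apply: K; move: h3; rewrite ltr_pdivlMr // => h3; apply: le_lt_trans h3.
  rewrite normrM normfV (ger0_norm (x := a * (a + x))); last by apply: mulr_ge0; lra.
  rewrite /M [cnorm h * _]mulrA; apply: ler_pM => //; first by rewrite invr_ge0 mulr_ge0; lra.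
    apply: le_trans (ler_normB _ _) _; rewrite !normrM (ger0_norm (ltW z0)).
    clear -z0 hx hy; clearbody a b x y.
    by have := ler_wpM2l (ltW z0) hy; have := ler_wpM2l (normr_ge0 b) hx; lra.
  rewrite lef_pV2 ?posrE ?mulr_gt0 //; try lra.
  by rewrite ler_wpM2l // ltW.
lra.
Qed.

(** Derivative of an inverse function. With [k] the increment of [clog], the derivative of [cexp]
    gives [cnorm (h - z * k) <= eta * cnorm k]. The first bound on [eta] yields
    [cnorm k <= 2 * cnorm h / cnorm z], the second then gives the error [e * cnorm h] after division
    by [z]. *)
Lemma hol_clog z : 0 < complex.Re z -> hol clog z.
Proof.
move=> z0; have Nz : 0 < cnorm z by rewrite N_gt0; apply: contraTneq z0 => ->; rewrite ltxx.
have zn0 : z != 0 by rewrite -N_gt0.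
exists z^-1 => e e0.
set eta := Num.min (cnorm z / 2) (e * cnorm z ^+ 2 / 2).
have eta0 : 0 < eta by rewrite lt_min !divr_gt0 // mulr_gt0 ?exprn_gt0.
have [eta1 eta2] : eta <= cnorm z / 2 /\ eta <= e * cnorm z ^+ 2 / 2 by rewrite !ge_min !lexx orbT.
have [d d0 H] := @cdiff_cexp (clog z) _ eta0.
have d2 : 0 < d / 2 by lra.
have [r r0 K] := ccont_clog z0 d2.
exists (Num.min r (complex.Re z)); first by rewrite lt_min r0.
move=> h; rewrite lt_min => /andP[h1 h2].
have kd := K _ h1; set k := clog (z + h) - clog z in kd *.
have zh : 0 < complex.Re (z + h).
  rewrite ReD; have := N_ge_Re h; rewrite ler_norml; lra.
have := H k (le_lt_trans kd _); rewrite /k subrKC !clogK // -/k (addrC z) addrK.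
move=> /(_ _)E; have {}E := E ltac:(lra).
have k2 : cnorm k <= 2 * cnorm h / cnorm z.
  rewrite ler_pdivlMr //; have := NBD h (z * k) 0; rewrite !subr0 NM (NBC (z * k)).
  have : eta * cnorm k <= cnorm z / 2 * cnorm k by rewrite ler_wpM2r // N_ge0.
  lra.
rewrite -(@ler_pM2l _ (cnorm z)) // -NM.
have -> : z * (k - z^-1 * h) = - (h - z * k) by field.
rewrite NN (le_trans E) // (@le_trans _ _ (e * cnorm z ^+ 2 / 2 * (2 * cnorm h / cnorm z))) //.
  by rewrite ler_pM ?N_ge0 // ltW.
by rewrite le_eqVlt; apply/orP; left; apply/eqP; field; rewrite gt_eqF.
Qed.

(** A rotation by 0, pi or a right angle moves any nonzero [z] into the right half-plane, where
    [clog] inverts [cexp]. *)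
Lemma cexp_surj z : z != 0 -> exists w, cexp w = z.
Proof.
move=> z0.
have go v : 0 < complex.Re (z * cexp v) -> exists w, cexp w = z.
  move=> /clogK E; exists (clog (z * cexp v) - v).
  by rewrite cexpB E mulfK // cexp_neq0.
have [h|h|h] := ltgtP 0 (complex.Re z).
- by apply: (go 0); rewrite cexp0 mulr1.
- by apply: (go (Complex 0 pi)); rewrite cexp_pi mulrN1 ReN oppr_gt0.
have [k|k|k] := ltgtP 0 (complex.Im z).
- apply: (go (Complex 0 (- (pi / 2)))).
  by rewrite /cexp /= expR0 cosN sinN cos_pihalf sin_pihalf mul1r ReM -h /=; lra.
- by apply: (go (Complex 0 (pi / 2))); rewrite cexp_pihalf ReM -h /=; lra.
by case/eqP: z0; apply: Cext.
Qed.

End Exp.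

(** * Periodic holomorphic functions on the upper half-plane *)

Section Periodic.
Variable R : realType.
Local Notation C := R[i].
Local Notation "x %:C" := (real_complex R x).
Implicit Types (f g k F : C -> C) (z w : C).

(** The coordinate q = e^(2 pi i w) at the cusp at infinity. *)
Definition ce w : C := cexp (Complex 0 (2 * pi) * w).

Lemma twopi_gt0 : 0 < 2 * pi :> R. Proof. by rewrite mulr_gt0 ?pi_gt0. Qed.

Lemma twopii_neq0 : Complex 0 (2 * pi) != 0 :> C.
Proof. by rewrite eq_complex /= eqxx gt_eqF // twopi_gt0. Qed.

Lemma N_ce w : cnorm (ce w) = expR (- (2 * pi * complex.Im w)).
Proof. by rewrite N_cexp ReM /= mul0r sub0r. Qed.

Lemma ce_neq0 w : ce w != 0. Proof. exact: cexp_neq0. Qed.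

Lemma ceD z w : ce (z + w) = ce z * ce w.
Proof. by rewrite /ce mulrDr cexpD. Qed.

Lemma ceN z : ce (- z) = (ce z)^-1.
Proof. by rewrite /ce mulrN cexpN. Qed.

Lemma ce0 : ce 0 = 1. Proof. by rewrite /ce mulr0 cexp0. Qed.

Lemma ce1 : ce 1 = 1. Proof. by rewrite /ce mulr1 cexp_2pi. Qed.

Lemma ce_per w : ce (w + 1) = ce w. Proof. by rewrite ceD ce1 mulr1. Qed.

Lemma cdiff_ce w : cdiff ce w (ce w * Complex 0 (2 * pi)).
Proof.
have h := cdiffM (cdiff_cst (Complex 0 (2 * pi)) w) (cdiff_id w).
by have := cdiff_comp h (cdiff_cexp _); rewrite mul0r add0r mulr1.
Qed.

Lemma hol_ce w : hol ce w. Proof. by eexists; apply: cdiff_ce. Qed.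

Lemma N_ce_lt (z w : C) : (cnorm (ce z) < cnorm (ce w)) = (complex.Im w < complex.Im z).
Proof. by rewrite !N_ce ltr_expR ltrN2 ltr_pM2l // twopi_gt0. Qed.

Lemma ce_eq w w0 : ce w = ce w0 -> exists m : int, w = w0 + m%:~R.
Proof.
move=> E; have : cexp (Complex 0 (2 * pi) * (w - w0)) = 1.
  by rewrite -/(ce _) ceD ceN E mulfV // ce_neq0.
case/cexp_eq1=> m Em; exists m; rewrite -mulrzr in Em.
by have := mulfI twopii_neq0 Em => /eqP; rewrite subr_eq addrC => /eqP.
Qed.

Lemma ce_surj z : z != 0 -> exists w, ce w = z.
Proof.
move=> /cexp_surj[v <-]; exists (v / Complex 0 (2 * pi)).
by rewrite /ce mulrC divfK // twopii_neq0.
Qed.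

Definition tends g (c : C) := forall e : R, 0 < e ->
  exists Y : R, forall w, Y < complex.Im w -> cnorm (g w - c) <= e.

Lemma tends_ce : tends ce 0.
Proof.
move=> e e0; have t0 := twopi_gt0.
exists (- ln e / (2 * pi)) => w; rewrite ltr_pdivrMr // => h.
rewrite subr0 N_ce -[leRHS]lnK ?posrE // ler_expR; lra.
Qed.

Lemma seg1 (y t : R) : seg (Complex 0 y) 1 t = Complex t y :> C.
Proof. by rewrite -[1]/(1%:C) seg_h add0r mulr1. Qed.

Lemma line_seg_cont F (y : R) : (forall x, ccont F (Complex x y)) -> seg_cont F (Complex 0 y) 1.
Proof. by move=> H t _; rewrite seg1. Qed.

(** Goursat's theorem on a rectangle of width one period: the two vertical sides cancel. *)
Lemma line_eq F (y1 y2 : R) : y1 <= y2 ->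
  (forall z, y1 <= complex.Im z <= y2 -> hol F z) ->
  (forall z, y1 <= complex.Im z <= y2 -> F (z + 1) = F z) ->
  Av F (Complex 0 y1) 1 = Av F (Complex 0 y2) 1.
Proof.
move=> y12 Fh Fp.
have := @goursat R F 0 1 y1 y2 _ ler01 y12.
rewrite /rect_int subr0 rmorph1 mul1r => /(_ _)E.
have {}E := E (fun x y _ hy => Fh (Complex x y) hy).
have V : Av F (Complex 1 y1) (Complex 0 (y2 - y1)) = Av F (Complex 0 y1) (Complex 0 (y2 - y1)).
  apply: is_avE; have -> : Complex 1 y1 = Complex 0 y1 + 1 :> C.
    by apply: Cext => /=; ring.
  apply: is_av_shift; apply: (@is_av_ext _ F).
    by move=> t t01; rewrite seg_v Fp //=; nra.
  by apply: AvP => t t01; rewrite seg_v; apply/hol_cont/Fh => /=; nra.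
by move: E; rewrite V subrr mulr0 addr0 => /eqP; rewrite subr_eq0 => /eqP.
Qed.

Lemma line_cont F (y : R) (e : R) : 0 < e -> (forall x, ccont F (Complex x y)) ->
  exists2 r : R, 0 < r & forall y', `|y' - y| < r ->
    forall l l', is_av F (Complex 0 y') 1 l' -> is_av F (Complex 0 y) 1 l -> cnorm (l' - l) <= e.
Proof.
move=> e0 Fc.
pose P (a b : R) := exists2 r : R, 0 < r & forall x y', a <= x <= b -> `|y' - y| < r ->
  cnorm (F (Complex x y') - F (Complex x y)) <= e.
have [r r0 H] : P 0 1.
  apply: cousin1 => //.
    move=> a b ab a0 b1 [r r0 Hr] [s s0 Hs]; exists (Num.min r s); first exact: min2_gt0.
    move=> x y' hx; rewrite lt_min => /andP[h1 h2].
    have [xm|xm] := lerP x ((a + b) / 2); [apply: Hr | apply: Hs] => //; lra.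
  move=> x _; have e2 : 0 < e / 2 by lra.
  have [r r0 H] := Fc x _ e2; have r2 : 0 < r / 2 by lra.
  exists (r / 2) => // a b ax _ _ ab; exists (r / 2) => // u y' hu hy.
  have key v : `|v - y| < r / 2 -> cnorm (F (Complex u v) - F (Complex x y)) <= e / 2.
    move=> hv; have -> : Complex u v = Complex x y + Complex (u - x) (v - y).
      by apply: Cext => /=; ring.
    apply: H; apply: le_lt_trans (N_le_ReIm _) _ => /=.
    have : `|u - x| < r / 2 by rewrite ltr_norml; lra.
    lra.
  have := key _ hy; have := key y; rewrite subrr normr0 => /(_ r2).
  have := NBD (F (Complex x y)) (F (Complex u y')) (F (Complex u y)).
  rewrite (NBC (F (Complex x y))); lra.
exists r => // y' hy l l' Hl' Hl.
have Hs : is_av (fun z => F (z + Complex 0 (y' - y))) (Complex 0 y) 1 l'.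
  move=> e1 /Hl'[n {}Hl']; exists n => m /Hl'.
  have -> : Complex 0 y' = Complex 0 y + Complex 0 (y' - y) by apply: Cext => /=; ring.
  by rewrite dyad_shift.
have := is_avD Hs (is_avZ (- 1) Hl); rewrite mulN1r => /is_av_le; apply=> t t01.
rewrite mulN1r seg1 (_ : Complex t y + _ = Complex t y'); first exact: H.
by apply: Cext => /=; ring.
Qed.

Section Line.
Variable F : C -> C.
Hypothesis Fp : forall z, 0 < complex.Im z -> F (z + 1) = F z.

(** The average is constant in [y] on either side of the line at height [t], and continuous in [y]
    across it by [line_cont]. *)
Lemma line_eq_except (t y1 y2 : R) : 0 < y1 -> y1 < t -> t < y2 ->
  (forall z, 0 < complex.Im z -> ccont F z) ->
  (forall z, 0 < complex.Im z -> complex.Im z != t -> hol F z) ->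
  Av F (Complex 0 y1) 1 = Av F (Complex 0 y2) 1.
Proof.
move=> y10 y1t ty2 Fc Fh.
have avp y : 0 < y -> is_av F (Complex 0 y) 1 (Av F (Complex 0 y) 1).
  by move=> y0; apply/AvP/line_seg_cont => x; apply: Fc.
apply: Neq_small => e e0; have e2 : 0 < e / 2 by lra.
have [|r r0 H] := @line_cont F t _ e2; first by move=> x; apply: Fc => /=; lra.
set d := Num.min (r / 2) (Num.min (t - y1) (y2 - t)).
have d0 : 0 < d by rewrite !lt_min; lra.
have [[d1 d2] d3] : (d <= r / 2 /\ d <= t - y1) /\ d <= y2 - t.
  by rewrite !ge_min !lexx !orbT.
clearbody d.
have t0 : 0 < t by lra.
rewrite (@line_eq F y1 (t - d)); [ | lra | | ].
- rewrite -(@line_eq F (t + d) y2); [ | lra | | ].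
  + have h1 : `|t - d - t| < r by rewrite ltr_norml; lra.
    have h2 : `|t + d - t| < r by rewrite ltr_norml; lra.
    have := H _ h1 _ _ (avp (t - d) ltac:(lra)) (avp t t0).
    have := H _ h2 _ _ (avp (t + d) ltac:(lra)) (avp t t0).
    set A := Av F (Complex 0 t) 1; set B := Av F (Complex 0 (t + d)) 1.
    set D := Av F (Complex 0 (t - d)) 1.
    by have := NBD A D B; rewrite (NBC B); lra.
  + by move=> z hz; apply: Fh; [ | rewrite gt_eqF]; lra.
  + by move=> z hz; apply: Fp; lra.
- by move=> z hz; apply: Fh; [ | rewrite lt_eqF]; lra.
- by move=> z hz; apply: Fp; lra.
Qed.

Lemma mean_const (c : C) (y : R) : (forall z, 0 < complex.Im z -> hol F z) ->
  tends F c -> 0 < y -> is_av F (Complex 0 y) 1 c.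
Proof.
move=> Fh Ft y0.
have avp v : 0 < v -> is_av F (Complex 0 v) 1 (Av F (Complex 0 v) 1).
  by move=> v0; apply/AvP/line_seg_cont => x; apply/hol_cont/Fh.
suff <- : Av F (Complex 0 y) 1 = c by exact: avp.
apply: Neq_small => e e0; have [Y HY] := Ft _ e0.
set v := Num.max y Y + 1.
have [yv Yv] : y <= v /\ Y < v.
  by split; rewrite /v ?ler_wpDr ?ltr_pwDr // le_max lexx ?orbT.
rewrite (@line_eq F y v) //; first last.
- by move=> z hz; apply: Fp; lra.
- by move=> z hz; apply: Fh; lra.
have := is_avD (avp v ltac:(lra)) (is_av_cst (- c) (Complex 0 v) 1).
by move=> /is_av_le; apply=> t t01; rewrite seg1; apply: HY.
Qed.

End Line.

Lemma perz g (m : int) z : (forall z, 0 < complex.Im z -> g (z + 1) = g z) ->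
  0 < complex.Im z -> g (z + m%:~R) = g z.
Proof.
move=> gp z0.
have nat_case n u : 0 < complex.Im u -> g (u + n%:R) = g u.
  move=> u0; elim: n => [|n IH]; first by rewrite addr0.
  by rewrite -natr1 addrA gp ?IH // ImD Im_nat addr0.
case: m => n; first exact: nat_case.
rewrite NegzE mulrNz -(nat_case n.+1 (z - n.+1%:R)) ?subrK //.
by rewrite ImD ImN Im_nat oppr0 addr0.
Qed.

(* Cauchy's formula in the coordinate [ce w]: the average of the quotient over
   the line [Im = y] does not depend on [y] (even across [Im w0], by continuity),
   and it tends to [k w0 / ce w0] as [y] goes to infinity. *)
Lemma cauchy_cusp k w0 (y1 : R) : (forall z, 0 < complex.Im z -> k (z + 1) = k z) ->
  (forall z, 0 < complex.Im z -> hol k z) -> tends k 0 ->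
  0 < y1 -> y1 < complex.Im w0 ->
  is_av (fun w => (k w - k w0) / (ce w - ce w0)) (Complex 0 y1) 1 (k w0 / ce w0).
Proof.
move=> kp kh kt y10 y1w; have w00 : 0 < complex.Im w0 by lra.
have [d kd] := kh _ w00; set q0 := ce w0; set k0 := k w0.
have q00 : q0 != 0 by exact: ce_neq0.
set c := q0 * Complex 0 (2 * pi); have qd : cdiff ce w0 c := cdiff_ce w0.
have c0 : c != 0 by rewrite mulf_neq0 // twopii_neq0.
clearbody c.
(* The exceptional value is the derivative of [k] with respect to [ce] at [w0], which makes [F]
   continuous. *)
pose F w := if ce w == q0 then d / c else (k w - k0) / (ce w - q0).
have Fp z : 0 < complex.Im z -> F (z + 1) = F z.
  by move=> z0; rewrite /F ce_per kp.
have Fh z : 0 < complex.Im z -> ce z != q0 -> hol F z.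
  move=> z0 zq; have Nz : 0 < cnorm (ce z - q0) / 2 by rewrite divr_gt0 // N_gt0 subr_eq0.
  have [r r0 H] := hol_cont (hol_ce z) Nz.
  apply: (@hol_local _ (fun w => (k w - k0) / (ce w - q0)) _ _ r) => //.
    move=> h hr; rewrite /F ifF //; apply/negP => /eqP E.
    by have := H _ hr; rewrite E NBC; lra.
  apply: holM; first by apply: holB; [exact: kh | exact: hol_cst].
  by apply: holV; [apply: holB; [exact: hol_ce | exact: hol_cst] | rewrite subr_eq0].
have Fc0 : ccont F w0.
  move=> e e0; have Nc : 0 < cnorm c by rewrite N_gt0.
  have Nd := N_ge0 d.
  set eta := Num.min (cnorm c / 2) (e * cnorm c ^+ 2 / (2 * (cnorm c + cnorm d))).
  have eta0 : 0 < eta by rewrite lt_min !divr_gt0 ?mulr_gt0 ?exprn_gt0 //; lra.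
  have [eta1 eta2] : eta <= cnorm c / 2 /\ eta <= e * cnorm c ^+ 2 / (2 * (cnorm c + cnorm d)).
    by rewrite !ge_min !lexx orbT.
  clearbody eta; move: eta2; rewrite ler_pdivlMr; last by lra.
  move=> eta2.
  have [r r0 Hk] := kd _ eta0; have [s s0 Hq] := qd _ eta0.
  exists (Num.min r s); first exact: min2_gt0.
  move=> h; rewrite lt_min => /andP[/Hk h1 /Hq h2].
  rewrite {2}/F eqxx /F; case: eqP => [_|/eqP hq]; first by rewrite subrr N0 ltW.
  rewrite -/k0 -/q0 in h1 h2 *; set a := k (w0 + h) - k0 in h1 *.
  rewrite -subr_eq0 in hq; set b := ce (w0 + h) - q0 in h2 hq *.
  have b0 : 0 < cnorm b by rewrite N_gt0.
  have hb : cnorm c / 2 * cnorm h <= cnorm b.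
    have := NBD b (c * h) 0; rewrite !subr0 NM (NBC _ b).
    have := ler_wpM2r (N_ge0 h) eta1; lra.
  have -> : a / b - d / c = (c * (a - d * h) - d * (b - c * h)) / (b * c) by field; rewrite c0 hq.
  rewrite NM NV NM ler_pdivrMr ?mulr_gt0 //.
  apply: le_trans (NB _ _) _; rewrite !NM.
  have t1 : cnorm c * cnorm (a - d * h) <= cnorm c * (eta * cnorm h) by rewrite ler_wpM2l // ltW.
  have t2 : cnorm d * cnorm (b - c * h) <= cnorm d * (eta * cnorm h) by rewrite ler_wpM2l.
  have t3 := ler_wpM2r (N_ge0 h) eta2.
  have t4 : e * cnorm c * (cnorm c / 2 * cnorm h) <= e * cnorm c * cnorm b by rewrite ler_wpM2l // mulr_ge0 // ltW.
  lra.
(* The exceptional points are the translates of [w0] by integers, so periodicity reduces continuity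
   to [w0]. *)
have Fc z : 0 < complex.Im z -> ccont F z.
  move=> z0; have [/eqP/ce_eq[m E]|] := boolP (ce z == q0); last by move=> ?; apply/hol_cont/Fh.
  rewrite E; apply: (@ccont_local _ (fun w => F (w - m%:~R)) _ _ (complex.Im w0)) => //; last first.
    have -> : (fun w => F (w - m%:~R)) = (fun w => F ((fun u => u - m%:~R) w)) by [].
    apply: ccont_comp; first by apply: hol_cont; apply: holB; [exact: hol_id | exact: hol_cst].
    by rewrite addrK.
  move=> h hw; rewrite -[RHS](@perz F (- m)) ?mulrNz //.
  rewrite !ImD; have -> : complex.Im (m%:~R : C) = 0.
    by rewrite -(rmorph_int (real_complex R)).
  by have := N_ge_Im h; rewrite ler_norml; lra.
have Fh' z : 0 < complex.Im z -> complex.Im z != complex.Im w0 -> hol F z.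
  move=> z0 zw; apply: Fh => //; apply: contra_neq zw => E.
  have : cnorm (ce z) = cnorm (ce w0) by rewrite E.
  rewrite !N_ce => /expR_inj/oppr_inj/mulfI; apply; by rewrite gt_eqF // twopi_gt0.
have avp y : 0 < y -> is_av F (Complex 0 y) 1 (Av F (Complex 0 y) 1).
  by move=> y0; apply/AvP/line_seg_cont => x; apply: Fc.
have main : Av F (Complex 0 y1) 1 = k0 / q0.
  apply: Neq_small => e e0; have Nq : 0 < cnorm q0 by rewrite N_gt0.
  have Nk := N_ge0 k0.
  have e1 : 0 < e * cnorm q0 / 4 by rewrite divr_gt0 ?mulr_gt0.
  have [Y1 H1] := kt _ e1.
  have e2 : 0 < Num.min (cnorm q0 / 2) (e * cnorm q0 ^+ 2 / (4 * (cnorm k0 + 1))).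
    by rewrite lt_min !divr_gt0 ?mulr_gt0 ?exprn_gt0 //; lra.
  have [Y2 H2] := tends_ce e2.
  set y := Num.max (complex.Im w0) (Num.max Y1 Y2) + 1.
  have [[h1 h2] h3] : (complex.Im w0 < y /\ Y1 < y) /\ Y2 < y.
    by rewrite /y !ltr_pwDr // !le_max lexx ?orbT.
  rewrite (line_eq_except Fp y10 y1w h1 Fc Fh').
  have := is_avD (avp y ltac:(lra)) (is_av_cst (- (k0 / q0)) (Complex 0 y) 1).
  move=> /is_av_le; apply=> t t01; rewrite seg1; set w := Complex t y.
  have := H1 w h2; have := H2 w h3; rewrite !subr0 le_min => /andP[b1 b2] b3.
  have qq : cnorm q0 / 2 <= cnorm (ce w - q0).
    by have := N_lerB q0 (ce w); rewrite NBC; lra.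
  have qn : ce w - q0 != 0 by rewrite -N_gt0; lra.
  rewrite /F ifF; last by apply/negP; rewrite -subr_eq0; apply/negP.
  have -> : (k w - k0) / (ce w - q0) - k0 / q0 = (k w * q0 - k0 * ce w) / (q0 * (ce w - q0)).
    by field; rewrite qn q00.
  rewrite NM NV NM ler_pdivrMr; last by rewrite mulr_gt0 //; lra.
  apply: le_trans (NB _ _) _; rewrite (NM (k w) q0) (NM k0 (ce w)).
  have u1 : cnorm (k w) * cnorm q0 <= e * cnorm q0 / 4 * cnorm q0 by rewrite ler_wpM2r // ltW.
  have u2 : cnorm k0 * cnorm (ce w) <= e * cnorm q0 ^+ 2 / 4.
    move: b2; rewrite ler_pdivlMr; last by lra.
    have := mulr_ge0 Nk (N_ge0 (ce w)); have := N_ge0 (ce w); lra.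
  have u3 : e * (cnorm q0 * (cnorm q0 / 2)) <= e * (cnorm q0 * cnorm (ce w - q0)).
    by rewrite !ler_wpM2l // ltW.
  lra.
(* On the line at height [y1] the modulus of [ce] exceeds that at [w0], so [F] is the plain
   quotient. *)
rewrite -main; apply: (@is_av_ext _ F); last exact: avp.
move=> t t01; rewrite seg1 /F ifF //; apply/negP => /eqP E.
have : cnorm (ce w0) < cnorm (ce (Complex t y1)) by rewrite N_ce_lt.
by rewrite E ltxx.
Qed.

Lemma seg_bounded f a h : seg_cont f a h -> exists M : R, forall t, 0 <= t <= 1 ->
  cnorm (f (seg a h t)) <= M.
Proof.
move=> fc; have [r r0 H] := seg_unif fc ltr01.
pose P (x y : R) := exists M : R, forall t, x <= t <= y -> cnorm (f (seg a h t)) <= M.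
suff : P 0 1 by [].
apply: cousin1 => //.
  move=> x y xy x0 y1 [M HM] [L HL]; exists (Num.max M L) => t ht.
  have [tm|tm] := lerP t ((x + y) / 2); rewrite le_max; apply/orP.
    by left; apply: HM; lra.
  by right; apply: HL; lra.
move=> x x01; exists r => // u v hu u0 v1 uv; exists (cnorm (f (seg a h x)) + 1) => t ht.
have := ND (f (seg a h t) - f (seg a h x)) (f (seg a h x)); rewrite subrK.
have : cnorm (f (seg a h t) - f (seg a h x)) <= 1.
  by apply: H => //; [lra | rewrite ltr_norml; lra].
lra.
Qed.

(* Riemann's removable singularity theorem in the coordinate [ce w] at the cusp. *)
Lemma cusp_limit g : (forall z, 0 < complex.Im z -> g (z + 1) = g z) ->
  (forall z, 0 < complex.Im z -> hol g z) -> tends (fun w => ce w * g w) 0 ->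
  exists c, tends g c.
Proof.
move=> gp gh gt; pose k w := ce w * g w.
have kp z : 0 < complex.Im z -> k (z + 1) = k z by move=> z0; rewrite /k ce_per gp.
have kh z : 0 < complex.Im z -> hol k z by move=> z0; apply: holM; [exact: hol_ce | exact: gh].
have i1 : 0 < 1 :> R by [].
have gc : seg_cont g (Complex 0 1) 1 by apply: line_seg_cont => x; apply/hol_cont/gh.
have [M HM] := seg_bounded gc.
have M0 : 0 <= M by have := HM 0; rewrite lexx ler01 => /(_ isT); apply: le_trans (N_ge0 _).
exists (Av g (Complex 0 1) 1) => e e0.
set q1 := cnorm (ce (Complex 0 1)).
have q10 : 0 < q1 by rewrite N_gt0 ce_neq0.
have e1 : 0 < e * q1 / 4 by rewrite divr_gt0 ?mulr_gt0.
have [Y1 H1] := gt _ e1.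
have e2 : 0 < Num.min (q1 / 2) (e * q1 / (4 * (M + 1))).
  by rewrite lt_min !divr_gt0 ?mulr_gt0 //; lra.
have [Y2 H2] := tends_ce e2.
exists (Num.max 1 (Num.max Y1 Y2)) => w0; rewrite !gt_max => /andP[w1 /andP[h1 h2]].
(* Cauchy's formula on the line at height 1 writes [g w0] as an average. Its integrand differs from
   [g] by a term that tends to 0 as [w0] goes up, so the limit is the average of [g] on that
   line. *)
have ma := cauchy_cusp kp kh gt i1 w1.
have q00 := ce_neq0 w0.
have kq : k w0 / ce w0 = g w0 by rewrite /k mulrAC mulfV // mul1r.
rewrite kq in ma.
have := is_avD ma (is_avZ (- 1) (AvP gc)); rewrite mulN1r => /is_av_le; apply=> t t01.
rewrite seg1 mulN1r; set w := Complex t 1.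
have := H1 _ h1; have := H2 _ h2; rewrite !subr0 le_min => /andP[b1 b2] b3.
have qw : cnorm (ce w) = q1 by rewrite /q1 !N_ce.
have gw : cnorm (g w) <= M by have := HM t t01; rewrite seg1.
have qq : q1 / 2 <= cnorm (ce w - ce w0) by have := N_lerB (ce w) (ce w0); rewrite qw; lra.
have qn : ce w - ce w0 != 0 by rewrite -N_gt0; lra.
have -> : (k w - k w0) / (ce w - ce w0) - g w = (ce w0 * g w - k w0) / (ce w - ce w0).
  by rewrite {1}/k; field.
rewrite NM NV ler_pdivrMr; last by lra.
apply: le_trans (NB _ _) _; rewrite NM.
have u2 : cnorm (ce w0) * cnorm (g w) <= e * q1 / 4.
  move: b2; rewrite ler_pdivlMr; last by lra.
  have := ler_wpM2l (N_ge0 (ce w0)) gw; have := N_ge0 (ce w0); lra.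
have u3 : e * (q1 / 2) <= e * cnorm (ce w - ce w0) by rewrite ler_wpM2l // ltW.
by rewrite /k; lra.
Qed.

Lemma Re_half z : complex.Re (z / 2) = complex.Re z / 2.
Proof.
by rewrite -(rmorph_nat (real_complex R)) -fmorphV ReM /= mulr0 subr0.
Qed.

Lemma is_av_Re_le f a h l (M : R) : is_av f a h l ->
  (forall t, 0 <= t <= 1 -> complex.Re (f (seg a h t)) <= M) -> complex.Re l <= M.
Proof.
move=> H fM.
have d n b h' : (forall t, 0 <= t <= 1 -> complex.Re (f (seg b h' t)) <= M) ->
    complex.Re (dyad f n b h') <= M.
  elim: n b h' => [|n IH] b h' Hb /=.
    by have := Hb 0; rewrite /seg mul0r addr0 lexx ler01; apply.
  have h1 : complex.Re (dyad f n b (h' / 2)) <= M.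
    by apply: IH => t t01; rewrite seg_half1; apply: Hb; lra.
  have h2 : complex.Re (dyad f n (b + h' / 2) (h' / 2)) <= M.
    by apply: IH => t t01; rewrite seg_half2; apply: Hb; lra.
  by rewrite Re_half ReD; lra.
apply/ler_addgt0Pl => e e0; have [n {}H] := H _ e0.
have := H n (leqnn n); have := d n _ _ fM; have := N_ge_Re (dyad f n a h - l).
rewrite ReD ReN ler_norml; lra.
Qed.

(** After division by [c], all real parts are at most 1 and the average is 1. If the starting point
    had real part below 1, a dyadic initial piece would stay away from 1 by continuity, and so would
    the average. A real part 1 within the unit disc forces the value 1. *)
Lemma mean_eq f a h c : seg_cont f a h -> is_av f a h c ->
  (forall t, 0 <= t <= 1 -> cnorm (f (seg a h t)) <= cnorm c) -> f a = c.
Proof.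
move=> fc fa fM; have fa0 : seg a h 0 = a by rewrite /seg mul0r addr0.
have [c0|c0] := eqVneq c 0.
  have := fM 0; rewrite lexx ler01 => /(_ isT); rewrite c0 N0 fa0 => h0.
  by apply/eqP; rewrite -N_eq0 eq_le h0 N_ge0.
have Nc : 0 < cnorm c by rewrite N_gt0.
pose p z := c^-1 * f z.
have pM t : 0 <= t <= 1 -> cnorm (p (seg a h t)) <= 1.
  by move=> /fM; rewrite NM NV mulrC ler_pdivrMr // mul1r.
have pc : seg_cont p a h by move=> t /fc; apply: ccontZ.
have pa : is_av p a h 1 by rewrite -[1](mulVf c0); apply: is_avZ.
have [|re1] := leP 1 (complex.Re (p a)).
  move=> re1; have pa1 : cnorm (p a) <= 1 by rewrite -fa0; apply: pM; rewrite lexx ler01.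
  have := sqrN (p a) => s.
  have r1 : complex.Re (p a) = 1.
    by apply/le_anti; rewrite re1 andbT (le_trans (le_trans (ler_norm _) (N_ge_Re _))).
  have im0 : complex.Im (p a) = 0.
    apply/eqP; rewrite -sqrf_eq0 eq_le sqr_ge0 andbT.
    have : cnorm (p a) ^+ 2 <= 1 by rewrite expr_le1 // N_ge0.
    by rewrite s r1 expr1n; lra.
  have : p a = 1 by apply: Cext; rewrite ?r1 ?im0.
  by rewrite /p => /(congr1 ( *%R c)); rewrite mulrA mulfV // mul1r mulr1.
exfalso.
have e0 : 0 < (1 - complex.Re (p a)) / 2 by lra.
have [r r0 H] := seg_unif pc e0.
have [n /(_ n (leqnn n)) n1] := exists_pow2 1 r0.
have small m : (forall t, 0 <= t <= 2 ^- m -> complex.Re (p (seg a h t)) <= (1 + complex.Re (p a)) / 2) ->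
  exists2 l, is_av p a h l & complex.Re l < 1.
  elim: m (h) pc pM => [|m IH] h' pc' pM' Hm.
    exists (Av p a h'); first exact: AvP.
    apply: le_lt_trans (is_av_Re_le (AvP pc') _) _; last first.
      - by instantiate (1 := (1 + complex.Re (p a)) / 2); lra.
    by move=> t t01; apply: Hm; rewrite expr0 invr1.
  have c1 : seg_cont p a (h' / 2) by move=> t t01; rewrite seg_half1; apply: pc'; lra.
  have c2 : seg_cont p (a + h' / 2) (h' / 2) by move=> t t01; rewrite seg_half2; apply: pc'; lra.
  have p0 : 0 < 2 ^- m :> R by rewrite invr_gt0 exprn_gt0.
  have hm : 2 ^- m.+1 = 2 ^- m / 2 :> R by rewrite exprS invfM mulrC.
  have [||l Hl l1] := IH (h' / 2) c1.
  - by move=> t t01; rewrite seg_half1; apply: pM'; lra.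
  - by move=> t t01; rewrite seg_half1; apply: Hm; rewrite hm; lra.
  exists ((l + Av p (a + h' / 2) (h' / 2)) / 2); first exact: is_av_split (AvP _).
  have l2 : complex.Re (Av p (a + h' / 2) (h' / 2)) <= 1.
    apply: (is_av_Re_le (AvP c2)) => t t01; rewrite seg_half2.
    by apply: le_trans (le_trans (ler_norm _) (N_ge_Re _)) _; apply: pM'; lra.
  by rewrite Re_half ReD; lra.
have [|l Hl] := small n.
  move=> t t0; have p1 : 2 ^- n <= 1 :> R by rewrite invf_le1 ?exprn_gt0 // exprn_ege1 // ler1n.
  have := H t 0; rewrite subr0 lexx ler01 fa0 => Ht.
  have : cnorm (p (seg a h t) - p a) <= (1 - complex.Re (p a)) / 2.
    apply: Ht => //; first by lra.
    rewrite ger0_norm; last by lra.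
    apply: le_lt_trans (proj2 (andP t0)) _.
    by rewrite -[_ ^- _]mul1r ltr_pdivrMr // exprn_gt0.
  have := N_ge_Re (p (seg a h t) - p a); rewrite ReD ReN ler_norml; lra.
by rewrite (is_av_unique Hl pa) /= ltxx.
Qed.

(** The maximum principle with the maximum at the cusp: [c] is the average of [g] over every
    horizontal period. The period is made to start at the given point because [mean_eq] speaks of
    the starting point. *)
Lemma cusp_max g c : (forall z, 0 < complex.Im z -> g (z + 1) = g z) ->
  (forall z, 0 < complex.Im z -> hol g z) -> tends g c ->
  (forall z, 0 < complex.Im z -> cnorm (g z) <= cnorm c) ->
  forall z, 0 < complex.Im z -> g z = c.
Proof.
move=> gp gh gt gM [x y] /= y0.
pose f z := g (z + x%:C).
have im z : complex.Im (z + x%:C) = complex.Im z by rewrite ImD addr0.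
have fh z : 0 < complex.Im z -> hol f z.
  move=> z0; have -> : f = (fun z => g ((fun u => u + x%:C) z)) by [].
  apply: hol_comp; first by apply: holD; [exact: hol_id | exact: hol_cst].
  by apply: gh; rewrite im.
have -> : Complex x y = Complex 0 y + x%:C by apply: Cext => /=; ring.
rewrite -/(f _); apply: (@mean_eq f _ 1).
- by apply: line_seg_cont => u; apply/hol_cont/fh.
- apply: mean_const => //.
    by move=> z z0; rewrite /f addrAC gp ?im.
  by move=> e /gt[Y HY]; exists Y => w hw; apply: HY; rewrite im.
- by move=> t t01; rewrite seg1; apply: gM; rewrite im.
Qed.

(** * Local consequences *)

(** A punctured disc is the image of the upper half-plane, with its centre as the cusp. This
    transfers statements at a cusp to interior points. *)
Lemma disc_ce (r : R) h : 0 < r -> 0 < cnorm h -> cnorm h < r ->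
  exists2 w, 0 < complex.Im w & h = r%:C * ce w.
Proof.
move=> r0 h0 hr; have rC : r%:C != 0 by rewrite -N_gt0 Nreal normr_gt0 gt_eqF.
have [|w E] := @ce_surj (h / r%:C); first by rewrite mulf_neq0 ?invr_eq0 // -N_gt0.
exists w; last by rewrite E mulrC divfK.
have := N_ce w; rewrite E NM NV Nreal (ger0_norm (ltW r0)) => E2.
have : expR (- (2 * pi * complex.Im w)) < 1 by rewrite -E2 ltr_pdivrMr // mul1r.
by rewrite expR_lt1 oppr_lt0 pmulr_rgt0 // twopi_gt0.
Qed.

Lemma N_disc_ce (r : R) w : 0 < r -> 0 < complex.Im w -> 0 < cnorm (r%:C * ce w) < r.
Proof.
move=> r0 w0; rewrite NM Nreal (ger0_norm (ltW r0)); apply/andP; split.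
  by rewrite mulr_gt0 // N_gt0 ce_neq0.
by rewrite gtr_pMr // N_ce expR_lt1 oppr_lt0 pmulr_rgt0 // twopi_gt0.
Qed.

Lemma hol_disc F p (r : R) w : hol F (p + r%:C * ce w) -> hol (fun w => F (p + r%:C * ce w)) w.
Proof.
move=> H; apply: (hol_comp (f := fun w => p + r%:C * ce w)) H.
by apply: holD; [exact: hol_cst | apply/holZ/hol_ce].
Qed.

(** At the centre mere continuity is enough, since there it only supplies the limit required by
    [cusp_max]; this serves functions with removable singularities. *)
Lemma max_principle F p (r : R) : 0 < r -> ccont F p ->
  (forall h, 0 < cnorm h -> cnorm h < r -> hol F (p + h)) ->
  (forall h, cnorm h < r -> cnorm (F (p + h)) <= cnorm (F p)) ->
  forall h, cnorm h < r -> F (p + h) = F p.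
Proof.
move=> r0 Fc Fh FM h hr; have [->|h0] := eqVneq h 0; first by rewrite addr0.
rewrite -N_gt0 in h0; have [w w0 ->] := disc_ce r0 h0 hr.
apply: (@cusp_max (fun w => F (p + r%:C * ce w))) w0.
- by move=> z _; rewrite ce_per.
- by move=> z z0; apply: hol_disc; have /andP[] := N_disc_ce r0 z0; apply: Fh.
- move=> e e0; have [s s0 Hs] := Fc _ e0.
  have [|Y HY] := @tends_ce (s / (2 * r)); first by rewrite divr_gt0 // mulr_gt0.
  exists Y => u hu; apply: Hs; have := HY _ hu; rewrite subr0 NM Nreal (ger0_norm (ltW r0)).
  rewrite ler_pdivlMr ?mulr_gt0 //; lra.
- by move=> z z0; apply: FM; have /andP[] := N_disc_ce r0 z0.
Qed.

Lemma cauchy_estimate g p (r M : R) : 0 < r ->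
  (forall h, cnorm h < r -> hol g (p + h)) -> (forall h, cnorm h < r -> cnorm (g (p + h)) <= M) ->
  forall h, cnorm h < r / 2 -> cnorm (g (p + h) - g p) <= 8 * M / r * cnorm h.
Proof.
move=> r0 gh gM h hr; have [->|h0] := eqVneq h 0.
  by rewrite addr0 subrr N0 mulr0.
rewrite -N_gt0 in h0; have hr' : cnorm h < r by lra.
have [w0 w00 E] := disc_ce r0 h0 hr'.
pose k w := g (p + r%:C * ce w) - g p.
have t0 := twopi_gt0.
have l34 : ln (3 / 4) < 0 :> R by rewrite ln_lt0 //; lra.
(* This height is the circle of radius [3 / 4 * r]. It stays at distance 1/4 from [ce w0], of
   modulus below 1/2, so an integrand of size [2 * M] over 1/4 gives the constant 8. *)
pose y1 : R := - ln (3 / 4) / (2 * pi).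
have y10 : 0 < y1 by rewrite divr_gt0 // oppr_gt0.
have qy t : cnorm (ce (Complex t y1)) = 3 / 4.
  rewrite N_ce /= /y1 mulrCA mulfV ?gt_eqF // mulr1 opprK lnK // posrE; lra.
clearbody y1.
have q0 : cnorm (ce w0) < 1 / 2.
  move: hr; rewrite E NM Nreal (ger0_norm (ltW r0)); nra.
have yw : y1 < complex.Im w0.
  have := N_ce_lt w0 (Complex 0 y1); rewrite (qy 0); have -> : cnorm (ce w0) < 3 / 4 by lra.
  by move=> <-.
have ma : is_av (fun w => (k w - k w0) / (ce w - ce w0)) (Complex 0 y1) 1 (k w0 / ce w0).
  apply: cauchy_cusp => //.
  - by move=> z _; rewrite /k ce_per.
  - move=> z z0; apply: holB; last exact: hol_cst.
    by apply: hol_disc; apply: gh; have /andP[] := N_disc_ce r0 z0.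
  - have gc : ccont g p by have := gh 0; rewrite addr0 N0 => /(_ r0)/hol_cont.
    move=> e e0; have [s s0 Hs] := gc _ e0.
    have [|Y HY] := @tends_ce (s / (2 * r)); first by rewrite divr_gt0 // mulr_gt0.
    exists Y => w hw; rewrite /k subr0; apply: Hs; have := HY _ hw.
    rewrite subr0 NM Nreal (ger0_norm (ltW r0)) ler_pdivlMr ?mulr_gt0 //; lra.
have M0 : 0 <= M by have := gM 0; rewrite N0 => /(_ r0); apply: le_trans (N_ge0 _).
have : cnorm (k w0 / ce w0) <= 8 * M.
  apply: (is_av_le ma) => t t01; rewrite seg1; set w := Complex t y1.
  have w1 : 0 < complex.Im w by [].
  have qq : 1 / 4 <= cnorm (ce w - ce w0) by have := N_lerB (ce w) (ce w0); rewrite qy; lra.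
  have kk : cnorm (k w - k w0) <= 2 * M.
    rewrite /k (_ : _ - _ = g (p + r%:C * ce w) - g (p + r%:C * ce w0)); last by ring.
    have := NB (g (p + r%:C * ce w)) (g (p + r%:C * ce w0)).
    have := gM _ (proj2 (andP (N_disc_ce r0 w1))); have := gM _ (proj2 (andP (N_disc_ce r0 w00))).
    lra.
  rewrite NM NV ler_pdivrMr; last by lra.
  have := ler_wpM2l M0 qq; lra.
have qn : 0 < cnorm (ce w0) by rewrite N_gt0 ce_neq0.
rewrite NM NV ler_pdivrMr // /k -E => H; apply: le_trans H _.
rewrite E NM Nreal (ger0_norm (ltW r0)) le_eqVlt; apply/orP; left; apply/eqP; field; lra.
Qed.

Lemma derivative_bound g p d (K r : R) : 0 < r -> cdiff g p d ->
  (forall h, cnorm h < r -> cnorm (g (p + h) - g p) <= K * cnorm h) -> cnorm d <= K.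
Proof.
move=> r0 gd gK; apply/ler_addgt0Pl => e e0; have [s s0 H] := gd _ e0.
set t := Num.min r s / 2.
have t0 : 0 < t by rewrite divr_gt0 // min2_gt0.
have [tr ts] : t < r /\ t < s.
  have : Num.min r s <= r /\ Num.min r s <= s by rewrite !ge_min !lexx orbT.
  rewrite /t; move: t0; rewrite /t; lra.
have Nt : cnorm t%:C = t by rewrite Nreal ger0_norm // ltW.
have := H t%:C; have := gK t%:C; rewrite Nt => /(_ tr) h1 /(_ ts) h2.
have : cnorm (d * t%:C) <= (e + K) * t.
  have := NBD (g (p + t%:C) - g p) 0 (d * t%:C); rewrite !sub0r !NN; lra.
by rewrite NM Nt ler_pM2r.
Qed.

(** [cauchy_estimate] applied to differences [F m - F m'] bounds their increments by [e * cnorm h].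
    Hence the derivatives at [p] form a Cauchy sequence, and the linear approximation of a late
    [F n] passes to the limit. *)
Theorem weierstrass (F : nat -> C -> C) f p (r : R) : 0 < r ->
  (forall n h, cnorm h < r -> hol (F n) (p + h)) ->
  (forall e, 0 < e -> exists n, forall m h, (n <= m)%N -> cnorm h < r ->
     cnorm (F m (p + h) - f (p + h)) <= e) ->
  hol f p.
Proof.
move=> r0 Fh Ff.
have Fd n : hol (F n) p by have := Fh n 0; rewrite addr0 N0; apply.
pose D n := projT1 (cid (Fd n)).
have DP n : cdiff (F n) p (D n) := projT2 (cid (Fd n)).
have r2 : 0 < r / 2 by lra.
have cauchy e : 0 < e -> exists n, forall m m', (n <= m)%N -> (n <= m')%N ->
    (forall h, cnorm h < r / 2 -> cnorm ((F m (p + h) - F m' (p + h)) - (F m p - F m' p)) <= e * cnorm h)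
    /\ cnorm (D m - D m') <= e.
  move=> e0; have [|n H] := Ff (e * r / 16); first by rewrite divr_gt0 ?mulr_gt0.
  exists n => m m' nm nm'.
  have L h : cnorm h < r / 2 -> cnorm ((F m (p + h) - F m' (p + h)) - (F m p - F m' p)) <= e * cnorm h.
    move=> hr.
    have := @cauchy_estimate (fun z => F m z - F m' z) p r (e * r / 8) r0 _ _ h hr.
    have -> : 8 * (e * r / 8) / r = e by field; lra.
    apply.
      by move=> h' hr'; apply: holB; apply: Fh.
    move=> h' hr'; have := H _ _ nm hr'; have := H _ _ nm' hr'.
    have := NBD (f (p + h')) (F m (p + h')) (F m' (p + h')).
    rewrite (NBC (f (p + h'))); lra.
  split=> //; apply: (derivative_bound (g := fun z => F m z - F m' z) r2) L.
  by have := cdiffD (DP m) (cdiffM (cdiff_cst (- 1) p) (DP m'));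
    rewrite mul0r add0r mulN1r; apply: cdiff_local ltr01 _ => h _; rewrite mulN1r.
have [|d Hd] := @cauchy_C R D.
  by move=> e /cauchy[n Hn]; exists n => m nm; have [] := Hn m n nm (leqnn n).
exists d => e e0; have e4 : 0 < e / 4 by lra.
have [n Hn] := cauchy _ e4.
have Dn : cnorm (d - D n) <= e / 4.
  apply/ler_addgt0Pl => e1 e10; have [k Hk] := Hd _ e10.
  have := Hk _ (leq_maxr n k); have [_] := Hn _ _ (leq_maxl n k) (leqnn n).
  have := NBD (D (maxn n k)) d (D n); rewrite (NBC d (D (maxn n k))); lra.
have [s s0 Hs] := DP n _ e4.
exists (Num.min s (r / 2)); first exact: min2_gt0.
move=> h; rewrite lt_min => /andP[hs hr].
have L : cnorm ((f (p + h) - F n (p + h)) - (f p - F n p)) <= e / 4 * cnorm h.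
  apply/ler_addgt0Pl => e1 e10; have e12 : 0 < e1 / 2 by lra.
  have [k Hk] := Ff _ e12; set m := maxn n k.
  have [L _] := Hn _ _ (leq_maxl n k) (leqnn n).
  have := L _ hr; rewrite -/m; have := Hk m h (leq_maxr _ _) ltac:(lra).
  have := Hk m 0 (leq_maxr _ _); rewrite addr0 N0 => /(_ r0).
  set x := F m (p + h); set y := F m p => a1 a2 a3.
  have -> : f (p + h) - F n (p + h) - (f p - F n p) =
    (x - F n (p + h) - (y - F n p)) + ((y - f p) - (x - f (p + h))) by ring.
  have := NB (y - f p) (x - f (p + h)).
  have := ND (x - F n (p + h) - (y - F n p)) ((y - f p) - (x - f (p + h))); lra.
have := Hs _ hs.
have -> : f (p + h) - f p - d * h = (f (p + h) - F n (p + h) - (f p - F n p))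
  + (F n (p + h) - F n p - D n * h) - (d - D n) * h by ring.
have := ler_wpM2r (N_ge0 h) Dn; rewrite -NM.
have := NB (f (p + h) - F n (p + h) - (f p - F n p) + (F n (p + h) - F n p - D n * h)) ((d - D n) * h).
have := ND (f (p + h) - F n (p + h) - (f p - F n p)) (F n (p + h) - F n p - D n * h).
have := mulr_ge0 (ltW e0) (N_ge0 h); lra.
Qed.

(** Connectedness of a segment by bisection. The predicate [P] is conditional on the value at the
    left end: near a point with value [c] it holds by openness, and near any other point its premise
    fails by continuity. *)
Lemma seg_const F a h c : seg_cont F a h ->
  (forall t, 0 <= t <= 1 -> F (seg a h t) = c ->
    exists2 r : R, 0 < r & forall h', cnorm h' < r -> F (seg a h t + h') = c) ->
  F a = c -> F (a + h) = c.
Proof.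
move=> Fc Fo Fa.
pose P (x y : R) := F (seg a h x) = c -> forall t, x <= t <= y -> F (seg a h t) = c.
have : P 0 1.
  apply: cousin1 => //.
    move=> x y xy x0 y1 p1 p2 Fx t ht.
    have [tm|tm] := lerP t ((x + y) / 2); first by apply: p1 => //; lra.
    by apply: p2; [apply: p1 => // | ]; lra.
  move=> x x01; have Nh := N_ge0 h.
  have near (r : R) : 0 < r -> forall t, `|t - x| < r / (cnorm h + 1) -> cnorm (seg a h t - seg a h x) < r.
    move=> r0 t; rewrite ltr_pdivlMr; last by lra.
    have -> : seg a h t - seg a h x = (t - x)%:C * h by rewrite /seg rmorphB /=; ring.
    by rewrite NM Nreal; have := normr_ge0 (t - x); nra.
  have [E|/eqP E] := pselect (F (seg a h x) = c).
    have [r r0 H] := Fo _ x01 E; exists (r / (cnorm h + 1)); first by rewrite divr_gt0 //; lra.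
    move=> u v ux u0 v1 uv _ t ht; rewrite -(subrKC (seg a h x) (seg a h t)).
    by apply: H; apply: near => //; rewrite ltr_norml; lra.
  have e0 : 0 < cnorm (F (seg a h x) - c) / 2 by rewrite divr_gt0 // N_gt0 subr_eq0.
  have [r r0 H] := Fc _ x01 _ e0; exists (r / (cnorm h + 1)); first by rewrite divr_gt0 //; lra.
  move=> u v ux u0 v1 uv Fu; exfalso.
  have : cnorm (seg a h u - seg a h x) < r by apply: near => //; rewrite ltr_norml; lra.
  move=> /H; rewrite subrKC Fu NBC; lra.
move=> /(_ _ 1); rewrite /seg mul0r addr0 mul1r; apply=> //; by rewrite ler01 lexx.
Qed.

End Periodic.

(** * Infinite products *)

Section Limits.
Variable R : realType.
Local Notation C := R[i].
Local Notation "x %:C" := (real_complex R x).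
Implicit Types (u v : nat -> C).

Definition cvC u (l : C) := forall e : R, 0 < e ->
  exists n, forall m, (n <= m)%N -> cnorm (u m - l) <= e.

Definition limC u : C := xget 0 [set l | cvC u l]%classic.

Lemma cvC_unique u l l' : cvC u l -> cvC u l' -> l = l'.
Proof.
move=> H H'; apply: Neq_small => e e0; have e2 : 0 < e / 2 by lra.
have [n {}H] := H _ e2; have [n' {}H'] := H' _ e2.
have := H _ (leq_maxl n n'); have := H' _ (leq_maxr n n').
have := NBD (u (maxn n n')) l l'; rewrite (NBC l (u _)); lra.
Qed.

Lemma limCE u l : cvC u l -> limC u = l.
Proof.
move=> H; apply: (cvC_unique (u := u)) => //.
by rewrite /limC; case: xgetP => [x _ Hx|/(_ l)].
Qed.

Lemma cvCM u v l l' : cvC u l -> cvC v l' -> cvC (fun n => u n * v n) (l * l').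
Proof.
move=> H H' e e0; have Nl := N_ge0 l; have Nl' := N_ge0 l'.
have e1 : 0 < Num.min 1 (e / 2 / (cnorm l' + 1)) by rewrite min2_gt0 ?divr_gt0 //; lra.
have e2 : 0 < e / 2 / (cnorm l + 1) by rewrite !divr_gt0 //; lra.
have [n {}H] := H _ e1; have [n' {}H'] := H' _ e2.
exists (maxn n n') => m; rewrite geq_max => /andP[/H + /H'].
rewrite le_min !ler_pdivlMr; try lra; move=> /andP[h1 h2] h3.
have -> : u m * v m - l * l' = (u m - l) * l' + u m * (v m - l') by ring.
apply: le_trans (ND _ _) _; rewrite !NM.
have um : cnorm (u m) <= cnorm l + 1 by have := ND (u m - l) l; rewrite subrK; lra.
have := N_ge0 (u m - l); have := ler_wpM2r (N_ge0 (v m - l')) um; lra.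
Qed.

Lemma cvC_sub u l (f : nat -> nat) : (forall n, (n <= f n)%N) -> cvC u l -> cvC (fun n => u (f n)) l.
Proof. by move=> fn H e /H[n {}H]; exists n => m nm; apply/H/(leq_trans nm). Qed.

Lemma cvC_ext u v l : (forall n, u n = v n) -> cvC u l -> cvC v l.
Proof. by move=> uv H e /H[n {}H]; exists n => m /H; rewrite uv. Qed.

Lemma cvC_cont (f : C -> C) u l : ccont f l -> cvC u l -> cvC (fun n => f (u n)) (f l).
Proof.
move=> fc H e /fc[r r0 {}fc]; have [|n {}H] := H (r / 2); first by lra.
exists n => m /H h; rewrite -(subrKC l (u m)); apply: fc; lra.
Qed.

(** Bernoulli's inequality bounds [m * r ^+ m] by [(1 - r)^-1]. *)
Lemma geom_small (r c e : R) : 0 <= r -> r < 1 -> 0 < e ->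
  exists n, forall m, (n <= m)%N -> c * r ^+ m <= e.
Proof.
move=> r0 r1 e0.
have bern m : (1 - r) * m%:R * r ^+ m <= 1.
  suff H : r ^+ m * (1 + (1 - r) * m%:R) <= 1.
    by have := exprn_ge0 m r0; nra.
  elim: m => [|m IH]; first by rewrite expr0 mulr0 addr0 mulr1.
  rewrite exprS -natr1; have h := exprn_ge0 m r0.
  have m0 : 0 <= m%:R :> R by [].
  apply: le_trans IH; rewrite mulrAC [leLHS]mulrC; apply: ler_wpM2l => //.
  have := mulr_ge0 (sqr_ge0 (1 - r)) (addr_ge0 m0 ler01); lra.
have [n Hn] : exists n, forall m, (n <= m)%N -> `|c| <= e * (1 - r) * m%:R.
  have d0 : 0 < e * (1 - r) by rewrite mulr_gt0 //; lra.
  exists (Num.bound (`|c| / (e * (1 - r)))) => m nm.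
  rewrite mulrC -ler_pdivrMr // ltW // (lt_le_trans (archi_boundP _)) ?ler_nat //.
  by rewrite divr_ge0 // ltW.
exists n => m /Hn h; have p := exprn_ge0 m r0.
apply: le_trans (_ : `|c| * r ^+ m <= _); first by rewrite ler_wpM2r // ler_norm.
apply: le_trans (ler_wpM2r p h) _.
have := ler_wpM2l (ltW e0) (bern m); lra.
Qed.

(** The explicit tail bound depends on [c] and [r] alone; this is what later makes convergence
    uniform in parameters. *)
Lemma cvC_geom u (c r : R) : 0 <= c -> 0 <= r -> r < 1 ->
  (forall n, cnorm (u n.+1 - u n) <= c * r ^+ n) ->
  exists l, forall n, cnorm (l - u n) <= c * r ^+ n / (1 - r) /\ cvC u l.
Proof.
move=> c0 r0 r1 H; have d0 : 0 < 1 - r by lra.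
have step n k : cnorm (u (n + k)%N - u n) <= c * r ^+ n * (1 - r ^+ k) / (1 - r).
  elim: k => [|k IH]; first by rewrite addn0 subrr N0 expr0 subrr mulr0 mul0r.
  rewrite addnS; have := NBD (u (n + k)%N) (u (n + k).+1) (u n).
  move=> /le_trans; apply; apply: le_trans (lerD (H _) IH) _.
  by rewrite exprD exprS le_eqVlt; apply/orP; left; apply/eqP; field; rewrite gt_eqF.
have bound n k : (n <= k)%N -> cnorm (u k - u n) <= c * r ^+ n / (1 - r).
  move=> /subnKC <-; apply: le_trans (step _ _) _.
  rewrite ler_wpM2r ?invr_ge0 ?(ltW d0) // ler_piMr ?mulr_ge0 ?exprn_ge0 //.
  by rewrite gerBl exprn_ge0.
have [|l Hl] := @cauchy_C R u.
  move=> e e0; have [n Hn] := geom_small (c / (1 - r)) r0 r1 e0.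
  exists n => m /bound h; apply: le_trans h _.
  by have := Hn n (leqnn n); rewrite mulrAC.
exists l => n; split=> //; apply/ler_addgt0Pl => e e0; have [k Hk] := Hl _ e0.
have := Hk _ (leq_maxr n k); have := bound _ _ (leq_maxl n k).
have := NBD (u (maxn n k)) l (u n); rewrite (NBC l (u (maxn n k))); lra.
Qed.

End Limits.

(** * The products [E q x] and their logarithms *)

Section Pochhammer.
Variable R : realType.
Local Notation C := R[i].
Local Notation "x %:C" := (real_complex R x).
Implicit Types (q x z : C).

Definition poch q x n : C := \prod_(k < n) (1 - q ^+ k * x).

(* The infinite product of the [1 - q ^+ k * x], [k >= 0]. *)
Definition E q x : C := limC (poch q x).

Lemma pochS q x n : poch q x n.+1 = poch q x n * (1 - q ^+ n * x).
Proof. by rewrite /poch big_ord_recr. Qed.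

Lemma poch_recl q x n : poch q x n.+1 = (1 - x) * poch q (q * x) n.
Proof.
rewrite /poch big_ord_recl /= expr0 mul1r; congr (_ * _).
by apply: eq_bigr => i _; rewrite /bump /= exprS; congr (1 - _); ring.
Qed.

(** Since 1 + x <= exp x, this bounds every partial product of the factors 1 + r^k p. *)
Definition pbound (r p : R) := expR (p / (1 - r)).

Lemma poch_bound q x (r p : R) n : cnorm q <= r -> r < 1 -> cnorm x <= p ->
  cnorm (poch q x n) <= pbound r p.
Proof.
move=> qr r1 xp; have r0 := le_trans (N_ge0 q) qr; have p0 := le_trans (N_ge0 x) xp.
have d0 : 0 < 1 - r by lra.
suff H : cnorm (poch q x n) <= expR (p * (1 - r ^+ n) / (1 - r)).
  apply: le_trans H _; rewrite ler_expR ler_wpM2r ?invr_ge0 ?(ltW d0) //.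
  by rewrite ler_piMr // gerBl exprn_ge0.
elim: n => [|n IH]; first by rewrite /poch big_ord0 N1 expr0 subrr mulr0 mul0r expR0.
rewrite pochS NM.
have -> : p * (1 - r ^+ n.+1) / (1 - r) = p * (1 - r ^+ n) / (1 - r) + r ^+ n * p.
  by rewrite exprS; field; rewrite gt_eqF.
rewrite expRD; apply: ler_pM => //; try exact: N_ge0.
apply: le_trans (NB _ _) _; rewrite N1 NM NX.
apply: le_trans (expR_ge1Dx _); rewrite lerD2l; apply: ler_pM => //; rewrite ?exprn_ge0 ?N_ge0 //.
by rewrite lerXn2r ?nnegrE ?N_ge0.
Qed.

Lemma poch_cv q x (r p : R) : cnorm q <= r -> r < 1 -> cnorm x <= p ->
  cvC (poch q x) (E q x) /\
  forall n, cnorm (E q x - poch q x n) <= pbound r p * p * r ^+ n / (1 - r).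
Proof.
move=> qr r1 xp; have r0 := le_trans (N_ge0 q) qr; have p0 := le_trans (N_ge0 x) xp.
have [|n|l Hl] := @cvC_geom R (poch q x) (pbound r p * p) r _ r0 r1.
- by rewrite mulr_ge0 // expR_ge0.
- rewrite pochS (_ : _ - _ = - (poch q x n * (q ^+ n * x))); last by ring.
  rewrite NN !NM NX -mulrA; apply: ler_pM => //; rewrite ?mulr_ge0 ?exprn_ge0 ?N_ge0 //.
    exact: (poch_bound n qr r1 xp).
  rewrite mulrC; apply: ler_pM => //; rewrite ?exprn_ge0 ?N_ge0 //.
  by rewrite lerXn2r ?nnegrE ?N_ge0.
have -> : E q x = l by apply: limCE; have [] := Hl 0%N.
by split=> [|n]; [have [] := Hl 0%N | have [] := Hl n].
Qed.

Lemma E_cv q x : cnorm q < 1 -> cvC (poch q x) (E q x).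
Proof. by move=> q1; have [] := poch_cv (lexx (cnorm q)) q1 (lexx (cnorm x)). Qed.

Lemma E_rec q x : cnorm q < 1 -> E q x = (1 - x) * E q (q * x).
Proof.
move=> q1; apply: limCE => e e0.
have c1 : cvC (fun=> 1 - x) (1 - x).
  by move=> e1 e10; exists 0%N => m _; rewrite subrr N0 ltW.
have [n H] := cvCM c1 (E_cv (q * x) q1) e0.
by exists n.+1 => -[//|m] /H; rewrite poch_recl.
Qed.

Lemma E_recn q x n : cnorm q < 1 -> E q x = poch q x n * E q (q ^+ n * x).
Proof.
move=> q1; elim: n => [|n IH]; first by rewrite /poch big_ord0 expr0 !mul1r.
by rewrite IH (E_rec (q ^+ n * x)) // pochS mulrA exprS -!mulrA.
Qed.

(** For [n] large the tail product [E q (q ^+ n * x)] is within 1/2 of 1, hence nonzero, so one of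
    the first [n] factors vanishes. *)
Lemma E_eq0 q x : cnorm q < 1 -> E q x = 0 -> exists k : nat, q ^+ k * x = 1.
Proof.
move=> q1; have q0 := N_ge0 q; set r := cnorm q in q0 q1.
have d0 : 0 < 1 - r by lra.
have k0 : 0 < (1 - r) / (2 * pbound r 1).
  by rewrite divr_gt0 // mulr_gt0 // expR_gt0.
have [n Hn] := geom_small (cnorm x) q0 q1 (min2_gt0 ltr01 k0).
have := Hn n (leqnn n); rewrite le_min => /andP[h1 h2].
have Ny : cnorm (q ^+ n * x) = cnorm x * r ^+ n by rewrite NM NX mulrC.
have Ey : E q (q ^+ n * x) != 0.
  have [_ /(_ 0%N)] := poch_cv (lexx (cnorm q)) q1 (lexx (cnorm (q ^+ n * x))).
  rewrite /poch big_ord0 expr0 mulr1 -/(poch _ _ _) Ny -/r => h.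
  apply/negP => /eqP E0; move: h; rewrite E0 sub0r NN N1.
  have pb : pbound r (cnorm x * r ^+ n) <= pbound r 1.
    by rewrite ler_expR ler_wpM2r // invr_ge0 ltW.
  have : pbound r (cnorm x * r ^+ n) * (cnorm x * r ^+ n) <= pbound r 1 * ((1 - r) / (2 * pbound r 1)).
    by apply: ler_pM => //; rewrite ?expR_ge0 // mulr_ge0 ?N_ge0 ?exprn_ge0.
  have -> : pbound r 1 * ((1 - r) / (2 * pbound r 1)) = (1 - r) / 2.
    by field; rewrite gt_eqF ?expR_gt0.
  rewrite [1 <= _]ler_pdivlMr //; lra.
rewrite (E_recn x n q1) => /eqP; rewrite mulf_eq0 (negbTE Ey) orbF /poch.
move=> /prodf_eq0[k _]; rewrite subr_eq0 => /eqP h; by exists k.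
Qed.

Lemma E_neq0 q x : cnorm q < 1 -> cnorm x < 1 -> E q x != 0.
Proof.
move=> q1 x1; apply/eqP => /(E_eq0 q1)[k].
move=> /(congr1 (@ComplexField.Normc.normc R)); rewrite NM NX N1.
have := exprn_ile1 k (N_ge0 q) (ltW q1); have := N_ge0 x; have := exprn_ge0 k (N_ge0 q); nra.
Qed.

Lemma hol_poch q n z : hol (fun x => poch q x n) z.
Proof.
elim: n => [|n IH].
  by apply: (@hol_local _ (fun=> 1) _ _ 1) (hol_cst _ _) => // h _; rewrite /poch big_ord0.
apply: (@hol_local _ (fun x => poch q x n * (1 - q ^+ n * x)) _ _ 1) => //.
  by move=> h _; rewrite pochS.
by apply: holM => //; apply: holB; [exact: hol_cst | apply/holZ/hol_id].
Qed.

Lemma hol_E q z : cnorm q < 1 -> hol (E q) z.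
Proof.
move=> q1; apply: (@weierstrass R (fun n x => poch q x n) _ _ 1) => //.
  by move=> n h _; apply: hol_poch.
move=> e e0; have xp h : cnorm h < 1 -> cnorm (z + h) <= cnorm z + 1.
  by move=> h1; have := ND z h; lra.
have d0 : 0 < 1 - cnorm q by lra.
have [n Hn] := geom_small (pbound (cnorm q) (cnorm z + 1) * (cnorm z + 1) / (1 - cnorm q)) (N_ge0 q) q1 e0.
exists n => m h nm h1; have [_ /(_ m)] := poch_cv (lexx (cnorm q)) q1 (xp h h1).
rewrite NBC => /le_trans; apply; by have := Hn m nm; rewrite mulrAC.
Qed.

Lemma E_sq q x : cnorm q < 1 -> E q x * E q (- x) = E (q ^+ 2) (x ^+ 2).
Proof.
move=> q1; have q21 : cnorm (q ^+ 2) < 1 by rewrite NX exprn_ilt1 ?N_ge0.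
apply: (cvC_unique (cvCM (E_cv x q1) (E_cv (- x) q1))).
apply: cvC_ext (E_cv _ q21) => n; rewrite /poch -big_split /=; apply: eq_bigr => k _.
by rewrite -exprM mulnC exprM; ring.
Qed.

Lemma E_even_odd q x : cnorm q < 1 -> E q x = E (q ^+ 2) x * E (q ^+ 2) (q * x).
Proof.
move=> q1; have q21 : cnorm (q ^+ 2) < 1 by rewrite NX exprn_ilt1 ?N_ge0.
have H := cvCM (E_cv x q21) (E_cv (q * x) q21).
apply: (cvC_unique (u := fun n => poch q x n.*2)).
  by apply: cvC_sub (E_cv x q1) => n; rewrite -addnn leq_addr.
apply: cvC_ext H => n; elim: n => [|n IH]; first by rewrite /poch !big_ord0 mulr1.
rewrite doubleS !pochS -IH -!exprM mulnC muln2 [q ^+ n.*2.+1]exprS; ring.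
Qed.

(** Euler's identity. The last two factors multiply to [E (q ^+ 2) q], while [E q q] times
    [E q (- q)] is [E (q ^+ 2) (q ^+ 2)]; splitting [E q q] into even and odd exponents leaves 1. *)
Lemma euler_BCD q x : cnorm q < 1 -> x ^+ 2 = q -> E q (- q) * E q x * E q (- x) = 1.
Proof.
move=> q1 xq; have q21 : cnorm (q ^+ 2) < 1 by rewrite NX exprn_ilt1 ?N_ge0.
have h1 := E_sq x q1; have h2 := E_sq q q1; have h3 := E_even_odd q q1.
have h4 : E (q ^+ 2) (q ^+ 2) != 0 by apply: E_neq0.
rewrite -expr2 in h3.
rewrite -mulrA h1 xq; apply: (mulIf h4); rewrite mul1r -[RHS]h2 h3; ring.
Qed.

Definition plog q x n : C := \sum_(k < n) clog (1 - q ^+ k * x).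

Definition lE q x : C := limC (plog q x).

Lemma plogS q x n : plog q x n.+1 = plog q x n + clog (1 - q ^+ n * x).
Proof. by rewrite /plog big_ord_recr. Qed.

Lemma N_qx q x (r p : R) n : cnorm q <= r -> r < 1 -> cnorm x <= p -> cnorm (q ^+ n * x) <= r ^+ n * p.
Proof.
move=> qr r1 xp; have r0 := le_trans (N_ge0 q) qr; have p0 := le_trans (N_ge0 x) xp.
rewrite NM NX; apply: ler_pM => //; rewrite ?exprn_ge0 ?N_ge0 //.
by rewrite lerXn2r ?nnegrE ?N_ge0.
Qed.

Lemma N_qx_le q x (r p : R) n : cnorm q <= r -> r < 1 -> cnorm x <= p -> cnorm (q ^+ n * x) <= p.
Proof.
move=> qr r1 xp; apply: le_trans (N_qx n qr r1 xp) _.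
have r0 := le_trans (N_ge0 q) qr; have p0 := le_trans (N_ge0 x) xp.
by rewrite ler_piMl // exprn_ile1 // ltW.
Qed.

Lemma plog_cv q x (r p : R) : cnorm q <= r -> r < 1 -> cnorm x <= p -> p < 1 ->
  cvC (plog q x) (lE q x) /\
  forall n, cnorm (lE q x - plog q x n) <= 2 * p / (1 - p) * r ^+ n / (1 - r).
Proof.
move=> qr r1 xp p1; have r0 := le_trans (N_ge0 q) qr; have p0 := le_trans (N_ge0 x) xp.
have d0 : 0 < 1 - p by lra.
have [|n|l Hl] := @cvC_geom R (plog q x) (2 * p / (1 - p)) r _ r0 r1.
- by rewrite divr_ge0 ?mulr_ge0 // ltW.
- rewrite plogS addrC addKr.
  apply: le_trans (clog_bound (N_qx_le n qr r1 xp) p1) _.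
  rewrite [leRHS]mulrAC ler_wpM2r ?invr_ge0 ?(ltW d0) // -mulrA ler_wpM2l //.
  by rewrite [leRHS]mulrC; apply: N_qx.
have -> : lE q x = l by apply: limCE; have [] := Hl 0%N.
by split=> [|n]; [have [] := Hl 0%N | have [] := Hl n].
Qed.

Lemma Re_1B (x : C) : cnorm x < 1 -> 0 < complex.Re (1 - x).
Proof. by move=> x1; rewrite ReD ReN /=; have := N_ge_Re x; rewrite ler_norml; lra. Qed.

Lemma cexp_lE q x : cnorm q < 1 -> cnorm x < 1 -> cexp (lE q x) = E q x.
Proof.
move=> q1 x1; have [H _] := plog_cv (lexx (cnorm q)) q1 (lexx (cnorm x)) x1.
have := cvC_cont (hol_cont (hol_cexp (lE q x))) H => H'.
apply: (cvC_unique H'); apply: cvC_ext (E_cv x q1) => n.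
elim: n => [|n IH]; first by rewrite /poch /plog !big_ord0 cexp0.
rewrite pochS plogS cexpD -IH clogK // Re_1B //.
by apply: le_lt_trans x1; apply: (N_qx_le n (lexx (cnorm q)) q1).
Qed.

(** The bounds of [plog_cv] involve only [r] and [p], so the partial sums converge uniformly on the
    disc even though both parameters vary, and [weierstrass] applies. *)
Lemma hol_lE (fq fx : C -> C) z (s r p : R) : 0 < s -> r < 1 -> p < 1 ->
  (forall h, cnorm h < s -> [/\ hol fq (z + h), hol fx (z + h), cnorm (fq (z + h)) <= r & cnorm (fx (z + h)) <= p]) ->
  hol (fun t => lE (fq t) (fx t)) z.
Proof.
move=> s0 r1 p1 H.
have [_ _ q0 x0] := H 0 ltac:(by rewrite N0).
have r0 := le_trans (N_ge0 _) q0; have p0 := le_trans (N_ge0 _) x0.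
apply: (@weierstrass R (fun n t => plog (fq t) (fx t) n) _ _ s) => //.
  move=> n h hs; have [h1 h2 h3 h4] := H h hs; elim: n => [|n IH].
    by apply: (@hol_local _ (fun=> 0) _ _ 1) (hol_cst _ _) => // h' _; rewrite /plog big_ord0.
  apply: (@hol_local _ (fun t => plog (fq t) (fx t) n + clog (1 - fq t ^+ n * fx t)) _ _ 1) => //.
    by move=> h' _; rewrite plogS.
  apply: holD => //; apply: (hol_comp (g := @clog R)).
    by apply: holB; [exact: hol_cst | apply: holM => //; apply: holX].
  apply: hol_clog; apply: Re_1B; apply: le_lt_trans p1; exact: (N_qx_le n h3 r1 h4).
move=> e e0; have [n Hn] := geom_small (2 * p / (1 - p) / (1 - r)) r0 r1 e0.
exists n => m h nm /H[_ _ h3 h4]; have [_ /(_ m)] := plog_cv h3 r1 h4 p1.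
rewrite NBC => /le_trans; apply; by have := Hn m nm; rewrite mulrAC.
Qed.

Lemma N_lE q x (r p : R) : cnorm q <= r -> r < 1 -> cnorm x <= p -> p < 1 ->
  cnorm (lE q x) <= 2 * p / (1 - p) / (1 - r).
Proof.
move=> qr r1 xp p1; have [_ /(_ 0%N)] := plog_cv qr r1 xp p1.
by rewrite /plog big_ord0 subr0 expr0 mulr1.
Qed.

End Pochhammer.

(** * The theta function and its modular transformation *)

Section Theta.
Variable R : realType.
Local Notation C := R[i].
Local Notation "x %:C" := (real_complex R x).
Implicit Types (f g F : C -> C) (z w t : C).

Lemma ccontM f g z : ccont f z -> ccont g z -> ccont (fun w => f w * g w) z.
Proof.
move=> Hf Hg e e0; have Nf := N_ge0 (f z); have Ng := N_ge0 (g z).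
have e1 : 0 < Num.min 1 (e / 2 / (cnorm (g z) + 1)) by rewrite min2_gt0 ?divr_gt0 //; lra.
have e2 : 0 < e / 2 / (cnorm (f z) + 1) by rewrite !divr_gt0 //; lra.
have [r r0 {}Hf] := Hf _ e1; have [s s0 {}Hg] := Hg _ e2.
exists (Num.min r s); first exact: min2_gt0.
move=> h; rewrite lt_min => /andP[/Hf + /Hg].
rewrite le_min !ler_pdivlMr; try lra; move=> /andP[h1 h2] h3.
have -> : f (z + h) * g (z + h) - f z * g z =
  (f (z + h) - f z) * g z + f (z + h) * (g (z + h) - g z) by ring.
apply: le_trans (ND _ _) _; rewrite !NM.
have um : cnorm (f (z + h)) <= cnorm (f z) + 1 by have := ND (f (z + h) - f z) (f z); rewrite subrK; lra.
have := N_ge0 (f (z + h) - f z); have := ler_wpM2r (N_ge0 (g (z + h) - g z)) um; lra.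
Qed.

Lemma ccontV f z : ccont f z -> f z != 0 -> ccont (fun w => (f w)^-1) z.
Proof.
by move=> Hf f0; apply: (ccont_comp (g := fun w => w^-1)) Hf _; apply/hol_cont/holV => //; apply: hol_id.
Qed.

Lemma ccont_neq0 f z : ccont f z -> f z != 0 ->
  exists2 r : R, 0 < r & forall h, cnorm h < r -> f (z + h) != 0.
Proof.
move=> Hf; rewrite -N_gt0 => f0; have [|r r0 H] := Hf (cnorm (f z) / 2); first by lra.
exists r => // h /H h1; rewrite -N_gt0; have := N_lerB (f z) (f (z + h)); rewrite NBC; lra.
Qed.

Lemma ce_half : ce (1 / 2 : C) = - 1.
Proof.
rewrite /ce -cexp_pi; congr cexp; rewrite -(rmorph_nat (real_complex R)).
by apply: Cext => /=; field.
Qed.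

Lemma ce_quarter : ce (1 / 4 : C) = 'i%C.
Proof.
rewrite /ce -cexp_pihalf; congr cexp; rewrite -(rmorph_nat (real_complex R)).
by apply: Cext => /=; field.
Qed.

Lemma i_sq : 'i%C * 'i%C = - 1 :> C. Proof. by rewrite -expr2 sqr_i. Qed.

Lemma i_neq0 : 'i%C != 0 :> C. Proof. by rewrite -N_eq0 Ni oner_eq0. Qed.

Lemma iV : ('i%C)^-1 = - 'i%C :> C.
Proof. by apply: (mulfI i_neq0); rewrite mulfV ?i_neq0 // mulrN i_sq opprK. Qed.

(* Jacobi's odd theta function up to a factor independent of [z], and what is
   left of it after removing its factor [1 - ce z]. *)
Definition Th t z : C := 'i%C * ce (- (z / 2)) * E (ce t) (ce z) * E (ce t) (ce t * ce (- z)).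

Definition T1 t z : C := 'i%C * ce (- (z / 2)) * E (ce t) (ce t * ce z) * E (ce t) (ce t * ce (- z)).

Section FixedTau.
Variable t : C.
Hypothesis t0 : 0 < complex.Im t.

Lemma N_ce_lt1 : cnorm (ce t) < 1.
Proof. by rewrite N_ce expR_lt1 oppr_lt0 pmulr_rgt0 // twopi_gt0. Qed.

Let q1 := N_ce_lt1.

Lemma Th_T1 z : Th t z = (1 - ce z) * T1 t z.
Proof. by rewrite /Th /T1 (E_rec (ce z) q1); ring. Qed.

Lemma Th_add1 z : Th t (z + 1) = - Th t z.
Proof.
rewrite /Th ce_per (_ : - ((z + 1) / 2) = - (z / 2) - 1 / 2); last by field.
rewrite ceD (ceN (1 / 2)) ce_half (_ : ce (- (z + 1)) = ce (- z)); last first.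
  by rewrite !ceN ce_per.
by rewrite invrN1; ring.
Qed.

Lemma Th_addt z : Th t (z + t) = - (ce (- (t / 2)) * ce (- z)) * Th t z.
Proof.
rewrite (Th_T1 z) /Th /T1 (_ : - ((z + t) / 2) = - (z / 2) + - (t / 2)); last by field.
rewrite !ceD (mulrC (ce z)) (_ : ce t * ce (- (z + t)) = ce (- z)); last first.
  by rewrite -ceD; congr ce; ring.
rewrite (E_rec (ce (- z)) q1) !ceN.
by field; rewrite !ce_neq0.
Qed.

Lemma Th_opp z : Th t (- z) = - Th t z.
Proof.
rewrite !Th_T1 /T1 opprK mulNr opprK (_ : ce (- z) = ce (- (z / 2)) * ce (- (z / 2))); last first.
  by rewrite -ceD; congr ce; field.
rewrite (_ : ce z = ce (z / 2) * ce (z / 2)); last first.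
  by rewrite -ceD; congr ce; field.
by rewrite ceN; field; rewrite ce_neq0.
Qed.

Lemma Th_eq0 z : Th t z = 0 -> exists m n : int, z = m%:~R + n%:~R * t.
Proof.
have ces (n : nat) : ce t ^+ n = ce (n%:R * t).
  by rewrite /ce -cexpMn -mulr_natl; congr cexp; ring.
have fin (n : int) : ce (z + n%:~R * t) = 1 -> exists m k : int, z = m%:~R + k%:~R * t.
  move=> H0; have /ce_eq[m] : ce (z + n%:~R * t) = ce 0 by rewrite H0 ce0.
  rewrite add0r => H; exists m, (- n).
  by apply: (addIr (n%:~R * t)); rewrite H mulrNz mulNr subrK.
have ic : 'i%C * ce (- (z / 2)) != 0 by rewrite mulf_neq0 ?i_neq0 ?ce_neq0.
move=> /eqP; rewrite /Th mulf_eq0 (mulf_eq0 ('i%C * ce _)) (negbTE ic) /=.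
case/orP => /eqP/(E_eq0 q1)[k].
  by rewrite ces -ceD addrC => /(fin k).
rewrite mulrA -exprSr ces -ceD => H; apply: (fin (- k.+1%:Z)).
have -> : z + (- k.+1%:Z)%:~R * t = - (k.+1%:R * t - z) by rewrite mulrNz; ring.
by rewrite ceN H invr1.
Qed.

Lemma T1_0 : T1 t 0 = 'i%C * E (ce t) (ce t) ^+ 2.
Proof. by rewrite /T1 mul0r oppr0 ce0 !mulr1 -mulrA. Qed.

Lemma hol_ceM (c : C) z : hol (fun z => ce (c * z)) z.
Proof. by apply: (hol_comp (g := @ce R)); [apply/holZ/hol_id | exact: hol_ce]. Qed.

Lemma hol_ext f g z : f =1 g -> hol f z -> hol g z.
Proof. by move=> fg; apply: (@hol_local _ _ _ _ 1). Qed.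

Lemma hol_Th z : hol (Th t) z.
Proof.
apply: holM; [apply: holM; [apply: holM|]|].
- exact: hol_cst.
- by apply: (@hol_ext (fun z => ce (- (1 / 2) * z))) (hol_ceM _ _) => w; congr ce; field.
- by apply: (hol_comp (g := E (ce t))); [exact: hol_ce | exact: hol_E].
- apply: (hol_comp (g := E (ce t))); last exact: hol_E.
  apply: holZ; apply: (@hol_ext (fun z => ce (- 1 * z))) (hol_ceM _ _) => w; by congr ce; ring.
Qed.

Lemma hol_T1 z : hol (T1 t) z.
Proof.
apply: holM; [apply: holM; [apply: holM|]|].
- exact: hol_cst.
- by apply: (@hol_ext (fun z => ce (- (1 / 2) * z))) (hol_ceM _ _) => w; congr ce; field.
- by apply: (hol_comp (g := E (ce t))); [apply/holZ/hol_ce | exact: hol_E].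
- apply: (hol_comp (g := E (ce t))); last exact: hol_E.
  apply: holZ; apply: (@hol_ext (fun z => ce (- 1 * z))) (hol_ceM _ _) => w; by congr ce; ring.
Qed.

(** With q = e^(2 pi i t), [EA], [EB], [EC], [ED] are the products over n >= 1 of 1 - q^n, 1 + q^n,
    1 - q^(n-1/2), 1 + q^(n-1/2). Then theta_2 = 2 q^(1/8) EA EB^2, theta_4 = EA EC^2 and theta_3 =
    EA ED^2. *)
Definition EA := E (ce t) (ce t).
Definition EB := E (ce t) (- ce t).
Definition EC := E (ce t) (ce (t / 2)).
Definition ED := E (ce t) (- ce (t / 2)).

Lemma N_ce_half : cnorm (ce (t / 2)) < 1.
Proof.
have := q1; have : cnorm (ce t) = cnorm (ce (t / 2)) ^+ 2.
  by rewrite expr2 -NM -ceD; congr (cnorm (ce _)); field.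
by move=> ->; rewrite expr_lt1 // N_ge0.
Qed.

Lemma EB_neq0 : EB != 0. Proof. by apply: E_neq0; rewrite ?NN. Qed.
Lemma EC_neq0 : EC != 0. Proof. by apply: E_neq0; rewrite ?N_ce_half. Qed.
Lemma ED_neq0 : ED != 0. Proof. by apply: E_neq0; rewrite ?NN ?N_ce_half. Qed.

Lemma EBCD : EB * EC * ED = 1.
Proof. by apply: euler_BCD => //; rewrite expr2 -ceD; congr ce; field. Qed.

Lemma Th_half : Th t (1 / 2) = 2 * EB ^+ 2.
Proof.
rewrite /Th (ceN (1 / 2 / 2)) (_ : ce (1 / 2 / 2) = 'i%C); last first.
  by rewrite -ce_quarter; congr ce; field.
rewrite mulfV ?i_neq0 // [1 * E _ _]mul1r (ceN (1 / 2)) ce_half invrN1 mulrN1.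
rewrite (E_rec (- 1) q1) mulrN1 opprK -/EB; ring.
Qed.

Lemma Th_thalf : Th t (t / 2) = 'i%C * ce (- (t / 4)) * EC ^+ 2.
Proof.
rewrite /Th (_ : t / 2 / 2 = t / 4); last by field.
rewrite (_ : ce t * ce (- (t / 2)) = ce (t / 2)) -/EC; first by ring.
by rewrite -ceD; congr ce; field.
Qed.

Lemma Th_1thalf : Th t ((1 + t) / 2) = ce (- (t / 4)) * ED ^+ 2.
Proof.
rewrite /Th (_ : - ((1 + t) / 2 / 2) = - (1 / 4) + - (t / 4)); last by field.
rewrite ceD (ceN (1 / 4)) ce_quarter mulrA mulfV ?i_neq0 // mul1r.
rewrite (_ : ce ((1 + t) / 2) = - ce (t / 2)); last first.
  by rewrite (_ : (1 + t) / 2 = 1 / 2 + t / 2) ?ceD ?ce_half ?mulN1r //; field.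
rewrite (_ : ce t * ce (- ((1 + t) / 2)) = - ce (t / 2)) -/ED; first by ring.
rewrite -ceD (_ : _ + _ = - (1 / 2) + t / 2); last by field.
by rewrite ceD ceN ce_half invrN1 mulN1r.
Qed.

End FixedTau.

(** [compactness] turns local bounds with a property stable under [max] into a global one. Without
    further property it shows that [G] is bounded; if the supremum were not attained, the property
    of lying strictly below it would give a smaller upper bound. *)
Lemma usc_max (G : R -> R -> R) : (forall s u, 0 <= s <= 1 -> 0 <= u <= 1 ->
    forall e, 0 < e -> exists2 r : R, 0 < r & forall s' u', `|s' - s| < r -> `|u' - u| < r ->
      G s' u' <= G s u + e) ->
  exists s0 u0, [/\ 0 <= s0 <= 1, 0 <= u0 <= 1 &
    forall s u, 0 <= s <= 1 -> 0 <= u <= 1 -> G s u <= G s0 u0].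
Proof.
move=> Gc.
have compactness (Q : R -> Prop) : (forall x y, Q x -> Q y -> Q (Num.max x y)) ->
    (forall s u, 0 <= s <= 1 -> 0 <= u <= 1 -> exists2 m, G s u < m & Q m) ->
    exists2 m, Q m & forall s u, 0 <= s <= 1 -> 0 <= u <= 1 -> G s u <= m.
  move=> Qmax Qloc.
  apply: (@cousin2 R (fun a b c d => exists2 m, Q m & forall s u, a <= s <= b -> c <= u <= d -> G s u <= m)) => //.
    move=> a b c d ab cd a0 b1 c0 d1 m n [x1 q1 h1] [x2 q2 h2] [x3 q3 h3] [x4 q4 h4].
    exists (Num.max (Num.max x1 x2) (Num.max x3 x4)); first by apply: (Qmax); apply: (Qmax).
    move=> s u hs hu; rewrite !le_max.
    have [sm|sm] := lerP s m; have [un|un] := lerP u n.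
    - by rewrite h1 //; lra.
    - by rewrite h3 ?orbT //; lra.
    - by rewrite h2 ?orbT //; lra.
    - by rewrite h4 ?orbT //; lra.
  move=> x y hx hy; have [m Gm Qm] := Qloc _ _ hx hy.
  have e0 : 0 < m - G x y by lra.
  have [r r0 H] := Gc _ _ hx hy _ e0; exists r => // a b c d xa yc a0 b1 c0 d1 ba dc.
  exists m => // s u hs hu; have := H s u; rewrite !ltr_norml => H'.
  have : G s u <= G x y + (m - G x y) by apply: H'; lra.
  lra.
have [|s u _ _|M _ HM] := compactness (fun=> True); first by [].
  by exists (G s u + 1) => //; lra.
pose S := [set x | exists s u, [/\ 0 <= s <= 1, 0 <= u <= 1 & x = G s u]]%classic.
have i0 : ((0 : R) <= 0) && ((0 : R) <= 1) by apply/andP; split; [exact: lexx | exact: ler01].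
have S0 : (S !=set0)%classic by exists (G 0 0), 0, 0.
have Sub : has_ubound S by exists M => _ [s [u [hs hu ->]]]; apply: HM.
have [[s0 [u0 [hs hu E]]]|nE] := pselect (S (sup S)).
  exists s0, u0; split=> // s u hs' hu'; rewrite -E; apply: ub_le_sup => //; by exists s, u.
exfalso; have [x y x1 y1||m mS Hm] := compactness (fun m => m < sup S).
- by rewrite gt_max x1.
- move=> s u hs hu; have : G s u < sup S.
    rewrite lt_neqAle; apply/andP; split; last by apply: ub_le_sup => //; exists s, u.
    by apply/negP => /eqP E; apply: nE; rewrite -E; exists s, u.
  by move=> ?; exists ((G s u + sup S) / 2); lra.
have : sup S <= m by apply: ge_sup => // _ [s [u [hs hu ->]]]; apply: Hm.
lra.
Qed.

Lemma perz_all F w (m : int) z : (forall z, F (z + w) = F z) -> F (z + m%:~R * w) = F z.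
Proof.
move=> Fw; have nat_case n u : F (u + n%:R * w) = F u.
  elim: n => [|n IH]; first by rewrite mul0r addr0.
  by rewrite -natr1 mulrDl mul1r addrA Fw IH.
case: m => n; first exact: nat_case.
rewrite NegzE mulrNz -(nat_case n.+1 (z + - n.+1%:R * w)); congr F; ring.
Qed.

(* Liouville's theorem on a torus, allowing isolated points where only
   continuity is known. *)
Lemma elliptic_const F t : 0 < complex.Im t ->
  (forall z, F (z + 1) = F z) -> (forall z, F (z + t) = F z) ->
  (forall p, ccont F p) ->
  (forall p, exists2 r : R, 0 < r & forall h, 0 < cnorm h -> cnorm h < r -> hol F (p + h)) ->
  forall z w, F z = F w.
Proof.
move=> t0 F1 Ft Fc Fh.
have [|s0 [u0 [hs hu HM]]] := @usc_max (fun s u => cnorm (F (s%:C + u%:C * t))).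
  move=> s u _ _ e e0; have [r r0 H] := Fc (s%:C + u%:C * t) _ e0.
  have Nt := N_ge0 t.
  have [d d0 dE] : exists2 d : R, 0 < d & d * (cnorm t + 1) < r.
    by exists (r / (cnorm t + 1) / 2); [rewrite !divr_gt0 //; lra | rewrite mulrAC divfK; lra].
  exists d => // s' u' h1 h2.
  have -> : s'%:C + u'%:C * t = (s%:C + u%:C * t) + ((s' - s)%:C + (u' - u)%:C * t).
    by rewrite !rmorphB /=; ring.
  set h := (s' - s)%:C + (u' - u)%:C * t.
  have hr : cnorm h < r.
    apply: le_lt_trans (ND _ _) _; rewrite NM !Nreal.
    have := ler_wpM2r Nt (ltW h2); lra.
  by have := H h hr; have := N_lerB (F (s%:C + u%:C * t + h)) (F (s%:C + u%:C * t)); lra.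
set p := s0%:C + u0%:C * t in HM.
(* Writing [z] with real coordinates over 1 and [t], the periods bring it into the parallelogram
   over the unit square, where [p] is a maximum. *)
have FM z : cnorm (F z) <= cnorm (F p).
  pose u := complex.Im z / complex.Im t.
  pose s := complex.Re z - u * complex.Re t.
  have Ez : z = s%:C + u%:C * t.
    by apply: Cext; rewrite ?ReD ?ImD ?ReM ?ImM /= /s /u; field; rewrite gt_eqF.
  have fl (x : R) : 0 <= x - (Num.floor x)%:~R <= 1.
    have := Num.Theory.floor_itv x; rewrite mathcomp_extra.intrD1; lra.
  have := HM (s - (Num.floor s)%:~R) (u - (Num.floor u)%:~R) (fl s) (fl u).
  have -> : F ((s - (Num.floor s)%:~R)%:C + (u - (Num.floor u)%:~R)%:C * t) = F z; last by [].
  rewrite Ez !rmorphB /= !rmorph_int.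
  rewrite -(perz_all (Num.floor s) _ F1) -(perz_all (Num.floor u) _ Ft).
  by congr F; ring.
have all z : F z = F p.
  rewrite -(subrKC p z); apply: seg_const => // v _ E.
  have [r r0 H] := Fh (seg p (z - p) v); exists r => // h hr.
  rewrite -E; apply: (max_principle r0) => // h' _; by rewrite E.
by move=> z w; rewrite !all.
Qed.

End Theta.

(** * Theta at [-1/t], logarithms of the theta constants *)

Section ThetaS.
Variable R : realType.
Local Notation uhp := (@upper_half_plane R).
Local Notation C := R[i].
Local Notation "x %:C" := (real_complex R x).
Implicit Types (f g F : C -> C) (z w t : C).

(** The value at 0 is the limit, so that [z * phi0 z * T1 t z] exhibits the simple zero of [Th t] at
    0. *)
Definition phi0 z : C := if z == 0 then - Complex 0 (2 * pi) else (1 - ce z) / z.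

Lemma phi0E z : z * phi0 z = 1 - ce z.
Proof.
rewrite /phi0; case: eqP => [->|/eqP z0]; first by rewrite mul0r ce0 subrr.
by rewrite mulrC divfK.
Qed.

Lemma ccont_phi0 : ccont phi0 0.
Proof.
move=> e e0; have [r r0 H] := cdiff_ce 0 e0; exists r => // h hr.
rewrite add0r /phi0 eqxx; case: eqP => [_|/eqP h0]; first by rewrite subrr N0 ltW.
have := H h hr; rewrite add0r ce0 mul1r => H'.
have -> : (1 - ce h) / h - - Complex 0 (2 * pi) = - ((ce h - 1 - Complex 0 (2 * pi) * h) / h).
  by field.
by rewrite NN NM NV ler_pdivrMr // N_gt0.
Qed.

Lemma phi0_0 : phi0 0 != 0.
Proof. by rewrite /phi0 eqxx oppr_eq0 twopii_neq0. Qed.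

Section FixedTau.
Variable t : C.
Hypothesis t0 : 0 < complex.Im t.

Local Notation t' := (- t^-1).

Lemma tau_neq0 : t != 0.
Proof. by apply: contraTneq t0 => ->; rewrite ltxx. Qed.

Lemma Im_inv : 0 < complex.Im t'.
Proof.
have := tau_neq0; case: t t0 => x y /= y0 _; rewrite opprK divr_gt0 //.
by rewrite ltr_wpDl ?sqr_ge0 // exprn_gt0.
Qed.

Let tn := tau_neq0.
Let t'0 := Im_inv.

(** The Gaussian factor e^(- pi i z^2 / t) of Jacobi's formula. *)
Definition Gz z : C := ce (- (z ^+ 2 / (2 * t))).

Lemma hol_Gz z : hol Gz z.
Proof.
apply: (hol_comp (g := @ce R)); last exact: hol_ce.
apply: holN; apply: (hol_ext (f := fun z => (2 * t)^-1 * z ^+ 2)).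
  by move=> u; rewrite mulrC.
by apply/holZ/holX/hol_id.
Qed.

Definition KA : C := EA t' ^+ 2 / (t * EA t ^+ 2).

(* The quotient of the two sides of Jacobi's transformation formula. It is doubly
   periodic, and [KA] is its limit at the lattice points. *)
Definition Fz z : C := if Th t z == 0 then KA else Gz z * Th t' (t^-1 * z) / Th t z.

Lemma EA_neq0 (u : C) : 0 < complex.Im u -> EA u != 0.
Proof. by move=> u0; apply: E_neq0; apply: N_ce_lt1. Qed.

Lemma Fz_hol z : Th t z != 0 -> hol Fz z.
Proof.
move=> Tz; have [r r0 H] := ccont_neq0 (hol_cont (hol_Th t0 z)) Tz.
apply: (@hol_local _ (fun z => Gz z * Th t' (t^-1 * z) / Th t z) _ _ r) => //.
  by move=> h /H h0; rewrite /Fz (negbTE h0).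
apply: holM; last by apply: holV => //; apply: hol_Th.
apply: holM; first exact: hol_Gz.
by apply: (hol_comp (g := Th t')); [apply/holZ/hol_id | apply: hol_Th].
Qed.

(** Numerator and denominator both have a simple zero at 0; cancelling [z] leaves a continuous
    quotient [G] whose value at 0 is [KA]. The other lattice points follow by periodicity. *)
Lemma Fz_near0 : ccont Fz 0 /\ exists2 r : R, 0 < r & forall h, 0 < cnorm h -> cnorm h < r -> hol Fz h.
Proof.
pose D z := phi0 z * T1 t z.
have T10 u : 0 < complex.Im u -> T1 u 0 != 0.
  by move=> u0; rewrite T1_0 mulf_neq0 ?i_neq0 // expf_neq0 // E_neq0 // N_ce_lt1.
have Dc : ccont D 0 by apply: ccontM; [exact: ccont_phi0 | apply/hol_cont/hol_T1].
have D0 : D 0 != 0 by rewrite mulf_neq0 ?phi0_0 ?T10.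
have [r r0 H] := ccont_neq0 Dc D0.
have ThD z : Th t z = z * D z by rewrite Th_T1 // -phi0E /D mulrA.
have Tn h : 0 < cnorm h -> cnorm h < r -> Th t h != 0.
  by move=> h0 hr; rewrite ThD mulf_neq0 -?N_gt0 // N_gt0 -(add0r h) H.
split; last by exists r => // h h0 hr; apply/Fz_hol/Tn.
pose G z := Gz z * (t^-1 * (phi0 (t^-1 * z) * T1 t' (t^-1 * z))) / D z.
apply: (@ccont_local _ G _ _ r) => //.
  move=> h hr; rewrite add0r; have [->|h0] := eqVneq h 0.
    rewrite /Fz ThD mul0r eqxx /G /KA mulr0 /D !T1_0 -/(EA _) -/(EA _) /Gz expr0n /= mul0r oppr0 ce0 mul1r.
    by field; rewrite tn phi0_0 i_neq0 EA_neq0.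
  have hp : 0 < cnorm h by rewrite N_gt0.
  have Dh : D h != 0 by rewrite -(add0r h) H.
  rewrite /Fz (negbTE (Tn h hp hr)) ThD (Th_T1 t'0) -phi0E /G.
  by field; rewrite tn h0 Dh.
apply: ccontM; last exact: ccontV.
apply: ccontM; first exact/hol_cont/hol_Gz.
apply: ccontZ; apply: ccontM.
  by apply: ccont_comp; [apply: ccontZ; apply/hol_cont/hol_id | rewrite mulr0; apply: ccont_phi0].
apply/hol_cont/(hol_comp (g := T1 t')); first exact/holZ/hol_id.
exact: hol_T1.
Qed.

Lemma Gz_add1 z : Gz (z + 1) = Gz z * ce (- (z / t)) * ce (- (1 / (2 * t))).
Proof. by rewrite /Gz -!ceD; congr ce; field. Qed.

Lemma Gz_addt z : Gz (z + t) = Gz z * ce (- z) * ce (- (t / 2)).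
Proof. by rewrite /Gz -!ceD; congr ce; field. Qed.

Lemma Fz_addt z : Fz (z + t) = Fz z.
Proof.
rewrite /Fz Th_addt // mulf_eq0 oppr_eq0 mulf_eq0 !(negbTE (ce_neq0 _)) /=.
case: eqP => // /eqP Tz.
rewrite Gz_addt (_ : t^-1 * (z + t) = t^-1 * z + 1) ?Th_add1 //; last by field.
by field; rewrite Tz !ce_neq0.
Qed.

Lemma Fz_add1 z : Fz (z + 1) = Fz z.
Proof.
rewrite /Fz Th_add1 // oppr_eq0; case: eqP => // /eqP Tz.
have E : Th t' (t^-1 * z) = - (ce (- (t' / 2)) * ce (- (t^-1 * (z + 1)))) * Th t' (t^-1 * (z + 1)).
  by rewrite -Th_addt //; congr Th; field.
rewrite Gz_add1 -(mulrA (Gz z)) E.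
have -> : ce (- (z / t)) * ce (- (1 / (2 * t))) = ce (- (t' / 2)) * ce (- (t^-1 * (z + 1))).
  by rewrite -!ceD; congr ce; field.
by field; rewrite Tz.
Qed.

Lemma Fz_const z w : Fz z = Fz w.
Proof.
have F1 := Fz_add1; have Ft := Fz_addt.
have lat p (m n : int) u : p = m%:~R + n%:~R * t -> Fz (p + u) = Fz u.
  move=> ->; rewrite (_ : _ + u = u + m%:~R * 1 + n%:~R * t); last by ring.
  by rewrite !perz_all.
have [c0 [r r0 h0]] := Fz_near0.
apply: (elliptic_const t0 F1 Ft) => p.
  have [/eqP/(Th_eq0 t0)[m [n E]]|] := boolP (Th t p == 0); last by move=> /Fz_hol/hol_cont.
  move=> e /c0[s s0 Hs]; exists s => // h /Hs; rewrite (lat _ _ _ _ E) -(addr0 p) (lat _ _ _ _ E).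
  by rewrite add0r.
have [/eqP/(Th_eq0 t0)[m [n E]]|Tp] := boolP (Th t p == 0).
  exists r => // h h1 h2; have := h0 h h1 h2.
  move=> [d Hd]; exists d; move=> e /Hd[s s0 Hs]; exists s => // k /Hs.
  by rewrite -(addrA p h k) !(lat _ _ _ _ E).
have [s s0 H] := ccont_neq0 (hol_cont (hol_Th t0 p)) Tp.
by exists s => // h _ hs; apply/Fz_hol/H.
Qed.

Lemma Fz_KA z : Fz z = KA.
Proof. by rewrite (Fz_const z 0) /Fz Th_T1 // ce0 subrr mul0r eqxx. Qed.

Lemma Fz_eq z : Th t z != 0 -> Gz z * Th t' (t^-1 * z) = KA * Th t z.
Proof. by move=> Tz; rewrite -(Fz_KA z) /Fz (negbTE Tz) divfK. Qed.

Local Notation p := (ce (t / 8)).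
Local Notation p' := (ce (t' / 8)).

Lemma ce_4 (u : C) : ce (- (u / 4)) = ce (u / 8) ^- 2.
Proof. by rewrite ceN -[_ ^+ 2]/(_ * _) -ceD; congr (_^-1); congr ce; field. Qed.

(** Jacobi's formula at the half-period 1/2, which division by [t] turns into minus the half-period
    [t' / 2]. *)
Lemma EC_S : EC t' ^+ 2 = 2 * 'i%C * KA * p' * EB t ^+ 2.
Proof.
have T0 : Th t (1 / 2) != 0.
  by rewrite Th_half // mulf_neq0 ?pnatr_eq0 ?expf_neq0 // EB_neq0.
have := Fz_eq T0; rewrite Th_half //.
rewrite (_ : t^-1 * (1 / 2) = - (t' / 2)); last by field.
rewrite Th_opp // Th_thalf // ce_4 /Gz (_ : - _ = t' / 8); last by field.
move=> H; have : 'i%C * (p' * - ('i%C * p' ^- 2 * EC t' ^+ 2)) * p' = 'i%C * (KA * (2 * EB t ^+ 2)) * p'.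
  by rewrite H.
have -> : 'i%C * (p' * - ('i%C * p' ^- 2 * EC t' ^+ 2)) * p' = - ('i%C * 'i%C) * EC t' ^+ 2.
  by field; rewrite ce_neq0.
by rewrite i_sq opprK mul1r => ->; ring.
Qed.

(** Jacobi's formula at [t / 2], which division by [t] turns into 1/2. *)
Lemma EB_S : 2 * p * EB t' ^+ 2 = 'i%C * KA * EC t ^+ 2.
Proof.
have T0 : Th t (t / 2) != 0.
  rewrite Th_thalf //.
  exact: (mulf_neq0 (mulf_neq0 (i_neq0 R) (ce_neq0 _)) (expf_neq0 2 (EC_neq0 t0))).
have := Fz_eq T0; rewrite Th_thalf // ce_4.
rewrite (_ : t^-1 * (t / 2) = 1 / 2); last by field.
rewrite Th_half // /Gz (_ : - _ = - (t / 8)); last by field.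
rewrite ceN => H.
have : (p^-1 * (2 * EB t' ^+ 2)) * p ^+ 2 = KA * ('i%C * p ^- 2 * EC t ^+ 2) * p ^+ 2 by rewrite H.
have -> : (p^-1 * (2 * EB t' ^+ 2)) * p ^+ 2 = 2 * p * EB t' ^+ 2 by field; rewrite ce_neq0.
by move=> ->; field; rewrite ce_neq0.
Qed.

(** Jacobi's formula at [(1 + t) / 2], which division by [t] turns into [1 - (1 + t') / 2]. *)
Lemma ED_S : p * ED t' ^+ 2 = 'i%C * KA * p' * ED t ^+ 2.
Proof.
have T0 : Th t ((1 + t) / 2) != 0.
  rewrite Th_1thalf //.
  exact: (mulf_neq0 (ce_neq0 _) (expf_neq0 2 (ED_neq0 t0))).
have := Fz_eq T0; rewrite Th_1thalf // ce_4.
rewrite (_ : t^-1 * ((1 + t) / 2) = - ((1 + t') / 2) + 1); last by field.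
rewrite Th_add1 // Th_opp // opprK Th_1thalf // ce_4 /Gz.
rewrite (_ : - (_ / (2 * t)) = t' / 8 + (- (1 / 4) + - (t / 8))); last by field.
rewrite !ceD !ceN ce_quarter iV => H.
have : ('i%C * (p' * (- 'i%C / p) * (p' ^- 2 * ED t' ^+ 2))) * (p ^+ 2 * p') =
   ('i%C * (KA * (p ^- 2 * ED t ^+ 2))) * (p ^+ 2 * p') by rewrite H.
have -> : ('i%C * (p' * (- 'i%C / p) * (p' ^- 2 * ED t' ^+ 2))) * (p ^+ 2 * p') =
   - ('i%C * 'i%C) * p * ED t' ^+ 2 by field; rewrite !ce_neq0.
by rewrite i_sq opprK mul1r => ->; field; rewrite ce_neq0.
Qed.

Lemma EA_S : EA t' ^+ 2 = t * KA * EA t ^+ 2.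
Proof. by rewrite /KA; field; rewrite tn EA_neq0. Qed.

(** In the product of the three half-period identities all theta values disappear by Euler's
    identity [EBCD], at [t] and at [t']. The cube is enough: the fourth powers of the theta
    constants involve [KA] only through [KA ^+ 6]. *)
Lemma KA_cube : p' ^+ 2 * KA ^+ 3 = 'i%C * p ^+ 2.
Proof.
have h' := EBCD t'0; have h := EBCD t0.
have e1 := EC_S; have e2 := EB_S; have e3 := ED_S.
have : (2 * p * EB t' ^+ 2) * EC t' ^+ 2 * (p * ED t' ^+ 2) =
  ('i%C * KA * EC t ^+ 2) * (2 * 'i%C * KA * p' * EB t ^+ 2) * ('i%C * KA * p' * ED t ^+ 2).
  by rewrite e1 e2 e3.
have -> : (2 * p * EB t' ^+ 2) * EC t' ^+ 2 * (p * ED t' ^+ 2) =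
  2 * p ^+ 2 * (EB t' * EC t' * ED t') ^+ 2 by ring.
have -> : ('i%C * KA * EC t ^+ 2) * (2 * 'i%C * KA * p' * EB t ^+ 2) * ('i%C * KA * p' * ED t ^+ 2)
  = 2 * (('i%C * 'i%C) * 'i%C * p' ^+ 2 * KA ^+ 3 * (EB t * EC t * ED t) ^+ 2) by ring.
rewrite h h' !expr1n !mulr1 i_sq -mulrA => /(mulfI _)E.
have {}E := E (ltac:(by rewrite pnatr_eq0)).
rewrite E (_ : 'i%C * _ = - ('i%C * 'i%C) * (p' ^+ 2 * KA ^+ 3)); last by ring.
by rewrite i_sq opprK mul1r.
Qed.

Lemma KA_six : p' ^+ 4 * KA ^+ 6 = - p ^+ 4.
Proof.
have -> : p' ^+ 4 * KA ^+ 6 = (p' ^+ 2 * KA ^+ 3) ^+ 2 by ring.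
rewrite KA_cube (_ : _ ^+ 2 = ('i%C * 'i%C) * p ^+ 4); last by ring.
by rewrite i_sq mulN1r.
Qed.

(** In classical terms, theta_4(-1/t)^4 = - t^2 theta_2(t)^4. *)
Lemma theta4_S : EA t' ^+ 4 * EC t' ^+ 8 = - t ^+ 2 * (16 * p ^+ 4 * EA t ^+ 4 * EB t ^+ 8).
Proof.
have -> : EA t' ^+ 4 * EC t' ^+ 8 = (EA t' ^+ 2) ^+ 2 * (EC t' ^+ 2) ^+ 4 by ring.
rewrite EA_S EC_S.
have -> : (t * KA * EA t ^+ 2) ^+ 2 * (2 * 'i%C * KA * p' * EB t ^+ 2) ^+ 4 =
  16 * ('i%C * 'i%C) ^+ 2 * t ^+ 2 * (p' ^+ 4 * KA ^+ 6) * EA t ^+ 4 * EB t ^+ 8 by ring.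
by rewrite KA_six i_sq; ring.
Qed.

Lemma theta3_S : EA t' ^+ 4 * ED t' ^+ 8 = - t ^+ 2 * (EA t ^+ 4 * ED t ^+ 8).
Proof.
apply: (mulfI (expf_neq0 4 (ce_neq0 (t / 8)))).
have -> : p ^+ 4 * (EA t' ^+ 4 * ED t' ^+ 8) = (EA t' ^+ 2) ^+ 2 * (p * ED t' ^+ 2) ^+ 4 by ring.
rewrite EA_S ED_S.
have -> : (t * KA * EA t ^+ 2) ^+ 2 * ('i%C * KA * p' * ED t ^+ 2) ^+ 4 =
  ('i%C * 'i%C) ^+ 2 * t ^+ 2 * (p' ^+ 4 * KA ^+ 6) * EA t ^+ 4 * ED t ^+ 8 by ring.
by rewrite KA_six i_sq; ring.
Qed.

End FixedTau.

(** * Logarithms of the fourth powers of the theta constants *)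

Definition lA t : C := lE (ce t) (ce t).
Definition lB t : C := lE (ce t) (- ce t).
Definition lC t : C := lE (ce t) (ce (t / 2)).

(* [l2], [l3] and [l4] are holomorphic logarithms of the fourth powers of the
   theta constants theta_2, theta_3 and theta_4. *)
Definition l4 t : C := 4%:R * lA t + 8%:R * lC t.
Definition l3 t : C := l4 (t + 1).
(** On the upper half-plane [- 'i * t] has positive real part, so [2 * lam] is a logarithm of the
    automorphy factor [- t ^+ 2]; it vanishes at the fixed point ['i] of S. *)
Definition lam t : C := clog (- 'i%C * t).
Definition l2 t : C := l4 (- t^-1) - 2%:R * lam t.

Lemma uhp_S t : uhp t -> uhp (- t^-1). Proof. exact: Im_inv. Qed.
Lemma uhp_T t : uhp t -> uhp (t + 1). Proof. by rewrite /upper_half_plane ImD addr0. Qed.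

Lemma hol_l_gen (fx : C -> C) t : uhp t -> (forall z, uhp z -> hol fx z) ->
  (forall z, cnorm (fx z) <= expR (- (pi * complex.Im z))) -> hol (fun t => lE (ce t) (fx t)) t.
Proof.
move=> t0 fh fN; pose s := complex.Im t / 2.
have s0 : 0 < s by rewrite /s; move: t0; rewrite /upper_half_plane; lra.
have pi0 := pi_gt0 R.
have ex1 : expR (- (pi * s)) < 1 by rewrite expR_lt1 oppr_lt0 mulr_gt0.
apply: (hol_lE s0 ex1 ex1) => h hs.
have im : s < complex.Im (t + h).
  by rewrite ImD; have := N_ge_Im h; rewrite ler_norml /s; move: hs; rewrite /s; lra.
have up : uhp (t + h) by apply: lt_trans im.
split; [exact: hol_ce | exact: fh | | ].
  rewrite N_ce ler_expR lerN2; apply: le_trans (_ : 2 * pi * s <= _); first by nra.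
  by rewrite ler_wpM2l ?ltW ?twopi_gt0.
by apply: le_trans (fN _) _; rewrite ler_expR lerN2 ler_wpM2l // ltW.
Qed.

Lemma N_ce_half_le t : cnorm (ce (t / 2)) = expR (- (pi * complex.Im t)).
Proof.
have im : complex.Im (t / 2) = complex.Im t / 2.
  by rewrite -(rmorph_nat (real_complex R)) -fmorphV ImM /= mulr0 add0r.
by rewrite N_ce im; congr expR; field.
Qed.

Lemma N_ce_le t : uhp t -> cnorm (ce t) <= expR (- (pi * complex.Im t)).
Proof.
move=> t0; rewrite N_ce ler_expR lerN2 ler_wpM2r ?ltW //.
by have := pi_gt0 R; lra.
Qed.

Lemma N_ce_half_lt1 t : uhp t -> cnorm (ce (t / 2)) < 1.
Proof. by move=> t0; rewrite N_ce_half_le expR_lt1 oppr_lt0 mulr_gt0 ?pi_gt0. Qed.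

(** Replacing [fx] by 0 off the half-plane makes the bound global, as [hol_l_gen] wants it, without
    changing [fx] near [t]. *)
Lemma hol_l_gen' (fx : C -> C) t : uhp t -> (forall z, uhp z -> hol fx z) ->
  (forall z, uhp z -> cnorm (fx z) <= expR (- (pi * complex.Im z))) -> hol (fun t => lE (ce t) (fx t)) t.
Proof.
move=> t0 fh fN.
apply: (@hol_local _ (fun t => lE (ce t) (if 0 < complex.Im t then fx t else 0)) _ _ (complex.Im t)) => //.
  move=> h hr; rewrite ifT // ImD; have := N_ge_Im h; rewrite ler_norml; lra.
apply: hol_l_gen => // z => [z0|].
  apply: (@hol_local _ fx _ _ (complex.Im z)) (fh z z0) => // h hr.
  by rewrite ifT // ImD; have := N_ge_Im h; rewrite ler_norml; lra.
case: ifP => z0; first exact: fN.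
by rewrite N0 expR_ge0.
Qed.

Lemma hol_ce_half z : hol (fun t => ce (t / 2)) z.
Proof. by apply: (hol_ext (f := fun t => ce (2^-1 * t))) (hol_ceM _ _) => w; rewrite mulrC. Qed.

Lemma hol_lA t : uhp t -> hol lA t.
Proof. by move=> t0; apply: hol_l_gen' => // z z0; [exact: hol_ce | exact: N_ce_le]. Qed.

Lemma hol_lB t : uhp t -> hol lB t.
Proof.
move=> t0; apply: hol_l_gen' => // z z0; first exact/holN/hol_ce.
by rewrite NN; apply: N_ce_le.
Qed.

Lemma hol_lC t : uhp t -> hol lC t.
Proof.
move=> t0; apply: hol_l_gen' => // z z0; first exact: hol_ce_half.
by rewrite N_ce_half_le.
Qed.

Lemma hol_l4 t : uhp t -> hol l4 t.
Proof. by move=> t0; apply: holD; apply: holZ; [exact: hol_lA | exact: hol_lC]. Qed.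

Lemma hol_addc (c : C) z : hol (fun t => t + c) z.
Proof. by apply: holD; [exact: hol_id | exact: hol_cst]. Qed.

Lemma hol_l3 t : uhp t -> hol l3 t.
Proof.
move=> t0; apply: (hol_comp (g := l4)); first exact: hol_addc.
exact/hol_l4/uhp_T.
Qed.

Lemma Re_Ni t : complex.Re (- 'i%C * t) = complex.Im t.
Proof. by rewrite ReM /=; ring. Qed.

Lemma hol_lam t : uhp t -> hol lam t.
Proof.
move=> t0; apply: (hol_comp (g := @clog R)); first exact/holZ/hol_id.
by apply: hol_clog; rewrite Re_Ni.
Qed.

Lemma hol_S t : uhp t -> hol (fun t => - t^-1) t.
Proof. by move=> t0; apply/holN/holV; [exact: hol_id | exact: tau_neq0]. Qed.

Lemma hol_l2 t : uhp t -> hol l2 t.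
Proof.
move=> t0; apply: holB; last exact/holZ/hol_lam.
by apply: (hol_comp (g := l4)); [exact: hol_S | exact/hol_l4/uhp_S].
Qed.

Lemma cexp_lam t : uhp t -> cexp (lam t) = - 'i%C * t.
Proof. by move=> t0; apply: clogK; rewrite Re_Ni. Qed.

Lemma lam_S t : uhp t -> lam (- t^-1) = - lam t.
Proof.
move=> t0; rewrite /lam -clogV ?Re_Ni //; congr clog.
by rewrite invfM invrN iV opprK mulrNN.
Qed.

Lemma cexp_nat (n : nat) z : cexp (n%:R * z) = cexp z ^+ n.
Proof. by rewrite mulr_natl cexpMn. Qed.

Lemma cexp_l4 t : uhp t -> cexp (l4 t) = EA t ^+ 4 * EC t ^+ 8.
Proof.
move=> t0; rewrite /l4 cexpD !cexp_nat /lA /lC.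
by rewrite (cexp_lE (N_ce_lt1 t0) (N_ce_lt1 t0)) (cexp_lE (N_ce_lt1 t0) (N_ce_half_lt1 t0)).
Qed.

Lemma ce_add1_half t : ce ((t + 1) / 2) = - ce (t / 2).
Proof.
by rewrite (_ : (t + 1) / 2 = t / 2 + 1 / 2) ?ceD ?ce_half ?mulrN1 //; field.
Qed.

Lemma cexp_l3 t : uhp t -> cexp (l3 t) = EA t ^+ 4 * ED t ^+ 8.
Proof.
by move=> t0; rewrite /l3 (cexp_l4 (uhp_T t0)) /EA /EC ce_per ce_add1_half.
Qed.

Lemma cexp_2lam t : uhp t -> cexp (2%:R * lam t) = - t ^+ 2.
Proof. by move=> t0; rewrite cexp_nat cexp_lam // exprMn sqrrN sqr_i mulN1r. Qed.

Lemma cexp_l2 t : uhp t ->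
  cexp (l2 t) = 16 * ce (t / 8) ^+ 4 * EA t ^+ 4 * EB t ^+ 8.
Proof.
move=> t0; rewrite /l2 cexpB (cexp_l4 (uhp_S t0)) theta4_S // cexp_2lam //.
by field; rewrite tau_neq0.
Qed.

Lemma l4_T2 t : l4 (t + 1 + 1) = l4 t.
Proof. by rewrite /l4 /lA /lC !ce_per ce_add1_half ce_add1_half opprK. Qed.

Lemma l3_T t : l3 (t + 1) = l4 t. Proof. exact: l4_T2. Qed.
Lemma l4_T t : l4 (t + 1) = l3 t. Proof. by []. Qed.
Lemma l4_S t : uhp t -> l4 (- t^-1) = l2 t + 2%:R * lam t.
Proof. by move=> t0; rewrite /l2 subrK. Qed.
Lemma l2_S t : uhp t -> l2 (- t^-1) = l4 t + 2%:R * lam t.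
Proof. by move=> t0; rewrite /l2 invrN invrK opprK lam_S // mulrN opprK. Qed.

Lemma N_imag (x : R) : cnorm (Complex 0 x) = `|x|.
Proof. by rewrite /= expr0n /= add0r sqrtr_sqr. Qed.

(** The values lie in 2 pi i Z, so a variation of at most 1 is no variation; [seg_const] then
    spreads constancy along segments. *)
Lemma log1_const (f : C -> C) : (forall t, uhp t -> ccont f t) ->
  (forall t, uhp t -> cexp (f t) = 1) -> forall t u, uhp t -> uhp u -> f t = f u.
Proof.
move=> fc f1 t u t0 u0; rewrite -(subrKC u t).
have up s : 0 <= s <= 1 -> uhp (seg u (t - u) s).
  by move=> s01; rewrite /upper_half_plane /seg ImD ImM ReC ImC ImD ImN; move: t0 u0; rewrite /upper_half_plane; nra.
apply: seg_const => // [s s01|s s01 E]; first by apply/fc/up.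
have h1 : 0 < 1 :> R by [].
have [r1 r10 H1] := fc _ (up s s01) _ h1.
exists (Num.min (complex.Im (seg u (t - u) s)) r1); first by rewrite lt_min r10 andbT; apply: up.
move=> h; rewrite lt_min => /andP[hi hr].
have uh : uhp (seg u (t - u) s + h).
  by rewrite /upper_half_plane ImD; have := N_ge_Im h; rewrite ler_norml; lra.
have := H1 _ hr; rewrite E.
have : cexp (f (seg u (t - u) s + h) - f u) = 1 by rewrite cexpB f1 // f1 // divr1.
case/cexp_eq1=> k Ek; rewrite Ek -mulrzr NM.
have -> : cnorm (k%:~R : C) = `|k%:~R : R| by rewrite -(rmorph_int (real_complex R)) Nreal.
rewrite N_imag ger0_norm ?(ltW (twopi_gt0 R)) //.
have [k0|k0] := eqVneq k 0.
  by move=> _; apply/eqP; rewrite -subr_eq0 Ek k0 mulr0z.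
have : 1 <= `|k%:~R : R|.
  by rewrite -intr_norm -[1]/(1%:~R) ler_int; move: k0; case: (k) => [[]|].
by move=> k1 k2; exfalso; move: k1 k2 (pi_ge2 R); clear; nra.
Qed.

(** By [theta3_S] the two sides differ by a multiple of 2 pi i, which is constant. At the fixed
    point ['i] of S it is 0, because [lam 'i] is 0. *)
Lemma l3_S t : uhp t -> l3 (- t^-1) = l3 t + 2%:R * lam t.
Proof.
move=> t0; pose f u := l3 (- u^-1) - (l3 u + 2%:R * lam u).
have i0 : uhp ('i%C : C) by rewrite /upper_half_plane /= ltr01.
suff : f t = f 'i%C.
  have lam_i : lam 'i%C = 0 by rewrite /lam mulNr i_sq opprK clog1.
  rewrite /f iV opprK lam_i mulr0 addr0 subrr.
  by move/eqP; rewrite subr_eq0 => /eqP.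
apply: log1_const => // u u0.
  apply: hol_cont; apply: holB.
    by apply: (hol_comp (g := l3)); [exact: hol_S | exact/hol_l3/uhp_S].
  by apply: holD; [exact: hol_l3 | exact/holZ/hol_lam].
rewrite /f cexpB cexpD (cexp_l3 (uhp_S u0)) (cexp_l3 u0) (cexp_2lam u0) theta3_S //.
rewrite [X in X / _]mulrC divff //; apply: mulf_neq0.
  exact: (mulf_neq0 (expf_neq0 4 (EA_neq0 u0)) (expf_neq0 8 (ED_neq0 u0))).
by rewrite oppr_eq0 expf_neq0 // tau_neq0.
Qed.

(** [l2] is defined through S, which hides its behaviour under T and at the cusp. It differs from
    the logarithm of the product for theta_2^4 by a constant, and the value of that constant does
    not affect either. *)
Lemma l2_explicit : exists c : C, forall t, uhp t ->
  l2 t = c + Complex 0 pi * t + 4%:R * lA t + 8%:R * lB t.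
Proof.
pose c16 : C := clog 16.
have e16 : cexp c16 = 16 by apply: clogK; rewrite (Re_nat R 16).
pose f u := l2 u - (c16 + Complex 0 pi * u + 4%:R * lA u + 8%:R * lB u).
have i0 : uhp ('i%C : C) by rewrite /upper_half_plane /= ltr01.
exists (c16 + f 'i%C) => t t0.
suff E : f t = f 'i%C by rewrite -E /f; ring.
apply: log1_const => // u u0.
  apply: hol_cont; apply: holB; first exact: hol_l2.
  apply: holD; last exact/holZ/hol_lB.
  apply: holD; last exact/holZ/hol_lA.
  by apply: holD; [exact: hol_cst | exact/holZ/hol_id].
rewrite /f cexpB cexp_l2 // !cexpD e16 !cexp_nat /lA /lB !cexp_lE ?NN ?N_ce_lt1 //.
have -> : cexp (Complex 0 pi * u) = ce (u / 8) ^+ 4.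
  rewrite -cexp_nat; congr cexp; rewrite mulrCA.
  have -> : Complex 0 (2 * pi) = 2 * Complex 0 pi :> C.
    by rewrite -(rmorph_nat (real_complex R)); apply: Cext => /=; ring.
  by field.
rewrite divff //; apply: mulf_neq0; last exact: (expf_neq0 8 (EB_neq0 u0)).
apply: mulf_neq0; last exact: (expf_neq0 4 (EA_neq0 u0)).
by apply: mulf_neq0; [rewrite pnatr_eq0 | exact: (expf_neq0 4 (ce_neq0 _))].
Qed.

Lemma l2_T t : uhp t -> l2 (t + 1) = l2 t + Complex 0 pi.
Proof.
move=> t0; have [c H] := l2_explicit.
by rewrite (H _ (uhp_T t0)) (H _ t0) /lA /lB ce_per; ring.
Qed.

Lemma tends_lE (fx : C -> C) : (forall z, uhp z -> cnorm (fx z) <= expR (- (pi * complex.Im z))) ->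
  tends (fun t => lE (ce t) (fx t)) 0.
Proof.
move=> fN e e0; have pi0 := pi_gt0 R.
(* For [p <= 1 / 2] the bound [2 * p / (1 - p) ^+ 2] of [N_lE] is at most [8 * p]. *)
have k0 : 0 < Num.min (1 / 2) (e / 8) by rewrite lt_min; lra.
exists (Num.max 0 (- ln (Num.min (1 / 2) (e / 8)) / pi)) => w.
rewrite gt_max => /andP[w0]; rewrite ltr_pdivrMr // => hw.
have le : expR (- (pi * complex.Im w)) <= Num.min (1 / 2) (e / 8).
  by rewrite -[leRHS]lnK ?posrE // ler_expR; lra.
move: le; rewrite le_min => /andP[l1 l2].
set p := expR _ in l1 l2.
have p1 : p < 1 by lra.
have p0 : 0 <= p by exact: expR_ge0.
rewrite subr0; apply: le_trans (N_lE (N_ce_le w0) p1 (fN _ w0) p1) _.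
rewrite -/p !ler_pdivrMr; try lra.
have : (1 - p) * (1 - p) >= 1 / 4 by nra.
nra.
Qed.

Lemma tendsD (f g : C -> C) c d : tends f c -> tends g d -> tends (fun t => f t + g t) (c + d).
Proof.
move=> H H' e e0; have e2 : 0 < e / 2 by lra.
have [Y {}H] := H _ e2; have [Y' {}H'] := H' _ e2.
exists (Num.max Y Y') => w; rewrite gt_max => /andP[/H h1 /H' h2].
by rewrite opprD addrACA; apply: le_trans (ND _ _) _; lra.
Qed.

Lemma tendsZ (k : C) (f : C -> C) c : tends f c -> tends (fun t => k * f t) (k * c).
Proof.
move=> H e e0; have Nk := N_ge0 k.
have [|Y {}H] := H (e / (cnorm k + 1)); first by rewrite divr_gt0 //; lra.
exists Y => w /H; rewrite -mulrBr NM ler_pdivlMr; last by lra.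
have := N_ge0 (f w - c); nra.
Qed.

Lemma tends_l4 : tends l4 0.
Proof.
rewrite -[0](_ : 4%:R * 0 + 8%:R * 0 = 0); last by ring.
apply: tendsD; apply: tendsZ; apply: tends_lE => z z0; first exact: N_ce_le.
by rewrite N_ce_half_le.
Qed.

Lemma tends_l3 : tends l3 0.
Proof.
by move=> e /tends_l4[Y H]; exists Y => w hw; apply: H; rewrite ImD addr0.
Qed.

Lemma tends_l2 : exists c, tends (fun t => l2 t - Complex 0 pi * t) c.
Proof.
have [c H] := l2_explicit; exists c.
have T : tends (fun t => 4%:R * lA t + 8%:R * lB t) (4%:R * 0 + 8%:R * 0).
  apply: tendsD; apply: tendsZ; apply: tends_lE => z z0; first exact: N_ce_le.
  by rewrite NN; apply: N_ce_le.
move=> e /T[Y HY]; exists (Num.max 0 Y) => w; rewrite gt_max => /andP[w0 /HY].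
by rewrite H // !mulr0 addr0; congr (cnorm _ <= _); ring.
Qed.

End ThetaS.

(** * The modular group *)

Section Modular.
Implicit Types g h : 'M[int]_2.

Lemma ord2 (i : 'I_2) : i = 0 \/ i = 1.
Proof. by case: i => [[|[|i]] Hi]; [left | right | ] => //; apply: val_inj. Qed.

Lemma mx22E g : g = mx22 (g 0 0) (g 0 1) (g 1 0) (g 1 1).
Proof.
by apply/matrixP => i j; rewrite mxE; have [->|->] := ord2 i; have [->|->] := ord2 j.
Qed.

Lemma mx22_00 a b c d : mx22 a b c d 0 0 = a. Proof. by rewrite mxE. Qed.
Lemma mx22_01 a b c d : mx22 a b c d 0 1 = b. Proof. by rewrite mxE. Qed.
Lemma mx22_10 a b c d : mx22 a b c d 1 0 = c. Proof. by rewrite mxE. Qed.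
Lemma mx22_11 a b c d : mx22 a b c d 1 1 = d. Proof. by rewrite mxE. Qed.
Definition mx22e := (mx22_00, mx22_01, mx22_10, mx22_11).

Lemma mulmx2E g h i j : (g *m h) i j = g i 0 * h 0 j + g i 1 * h 1 j.
Proof.
rewrite mxE big_ord_recl big_ord1; congr (_ * h _ _ + g _ _ * h _ _); exact: val_inj.
Qed.

Lemma mx22M a b c d a' b' c' d' : mx22 a b c d *m mx22 a' b' c' d' =
  mx22 (a * a' + b * c') (a * b' + b * d') (c * a' + d * c') (c * b' + d * d').
Proof. by rewrite [LHS]mx22E !mulmx2E !mx22e. Qed.

Lemma mx22_1 : 1%:M = mx22 1 0 0 1.
Proof. by rewrite [LHS]mx22E !mxE. Qed.

Lemma mx22N a b c d : - mx22 a b c d = mx22 (- a) (- b) (- c) (- d).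
Proof. by rewrite [LHS]mx22E !mxE. Qed.

Lemma det2 g : \det g = g 0 0 * g 1 1 - g 0 1 * g 1 0.
Proof.
rewrite (expand_det_row _ 0) big_ord_recl big_ord1 /cofactor !det_mx11 !mxE /=.
rewrite expr0 expr1 mul1r mulN1r mulrN; congr (g _ _ * g _ _ - g _ _ * g _ _); exact: val_inj.
Qed.

Lemma SL2ZP g : SL2Z g <-> g 0 0 * g 1 1 - g 0 1 * g 1 0 = 1.
Proof. by rewrite /SL2Z det2. Qed.

Lemma SL2Z_mx22 a b c d : SL2Z (mx22 a b c d) <-> a * d - b * c = 1.
Proof. by rewrite SL2ZP !mx22e. Qed.

Lemma SL2ZM g h : SL2Z g -> SL2Z h -> SL2Z (g *m h).
Proof. by rewrite /SL2Z det_mulmx => -> ->; rewrite mulr1. Qed.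

Lemma SL2Z1 : SL2Z 1%:M. Proof. by rewrite /SL2Z det1. Qed.

Definition inv2 g := mx22 (g 1 1) (- g 0 1) (- g 1 0) (g 0 0).

Lemma SL2Z_inv g : SL2Z g -> SL2Z (inv2 g).
Proof. by rewrite /inv2 SL2Z_mx22 SL2ZP => <-; ring. Qed.

Lemma inv2K g : SL2Z g -> inv2 g *m g = 1%:M.
Proof.
move=> /SL2ZP D; rewrite {2}[g]mx22E /inv2 mx22M mx22_1 -D.
by congr mx22; ring.
Qed.

Lemma inv2Kr g : SL2Z g -> g *m inv2 g = 1%:M.
Proof.
move=> /SL2ZP D; rewrite {1}[g]mx22E /inv2 mx22M mx22_1 -D.
by congr mx22; ring.
Qed.

Definition mxT := mx22 1 1 0 1.
Definition mxTi := mx22 1 (-1) 0 1.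
Definition mxAi := mx22 1 (-2) 0 1.
Definition mxBi := mx22 1 0 2 1.

Lemma SL2Z_S : SL2Z mxS. Proof. by apply/SL2Z_mx22. Qed.
Lemma SL2Z_T : SL2Z mxT. Proof. by apply/SL2Z_mx22. Qed.
Lemma SL2Z_Ti : SL2Z mxTi. Proof. by apply/SL2Z_mx22. Qed.

Lemma mxSg g : mxS *m g = mx22 (- g 1 0) (- g 1 1) (g 0 0) (g 0 1).
Proof. by rewrite {1}[g]mx22E mx22M; congr mx22; ring. Qed.
Lemma mxTg g : mxT *m g = mx22 (g 0 0 + g 1 0) (g 0 1 + g 1 1) (g 1 0) (g 1 1).
Proof. by rewrite {1}[g]mx22E mx22M; congr mx22; ring. Qed.
Lemma mxTig g : mxTi *m g = mx22 (g 0 0 - g 1 0) (g 0 1 - g 1 1) (g 1 0) (g 1 1).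
Proof. by rewrite {1}[g]mx22E mx22M; congr mx22; ring. Qed.
Lemma mxAg g : mxA *m g = mx22 (g 0 0 + 2 * g 1 0) (g 0 1 + 2 * g 1 1) (g 1 0) (g 1 1).
Proof. by rewrite {1}[g]mx22E mx22M; congr mx22; ring. Qed.
Lemma mxAig g : mxAi *m g = mx22 (g 0 0 - 2 * g 1 0) (g 0 1 - 2 * g 1 1) (g 1 0) (g 1 1).
Proof. by rewrite {1}[g]mx22E mx22M; congr mx22; ring. Qed.
Lemma mxBg g : mxB *m g = mx22 (g 0 0) (g 0 1) (g 1 0 - 2 * g 0 0) (g 1 1 - 2 * g 0 1).
Proof. by rewrite {1}[g]mx22E mx22M; congr mx22; ring. Qed.
Lemma mxBig g : mxBi *m g = mx22 (g 0 0) (g 0 1) (g 1 0 + 2 * g 0 0) (g 1 1 + 2 * g 0 1).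
Proof. by rewrite {1}[g]mx22E mx22M; congr mx22; ring. Qed.
Lemma mxNg g : - 1%:M *m g = mx22 (- g 0 0) (- g 0 1) (- g 1 0) (- g 1 1).
Proof. by rewrite mulNmx mul1mx {1}[g]mx22E mx22N. Qed.

Lemma mxTiT g : mxTi *m (mxT *m g) = g.
Proof. by rewrite mxTg mxTig !mx22e [RHS]mx22E; congr mx22; ring. Qed.
Lemma mxTTi g : mxT *m (mxTi *m g) = g.
Proof. by rewrite mxTig mxTg !mx22e [RHS]mx22E; congr mx22; ring. Qed.
Lemma mxSSSS g : mxS *m (mxS *m (mxS *m (mxS *m g))) = g.
Proof. by rewrite !mxSg !mx22e [RHS]mx22E; congr mx22; ring. Qed.
Lemma mxAiA g : mxAi *m (mxA *m g) = g.
Proof. by rewrite mxAg mxAig !mx22e [RHS]mx22E; congr mx22; ring. Qed.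
Lemma mxAAi g : mxA *m (mxAi *m g) = g.
Proof. by rewrite mxAig mxAg !mx22e [RHS]mx22E; congr mx22; ring. Qed.
Lemma mxBiB g : mxBi *m (mxB *m g) = g.
Proof. by rewrite mxBg mxBig !mx22e [RHS]mx22E; congr mx22; ring. Qed.
Lemma mxBBi g : mxB *m (mxBi *m g) = g.
Proof. by rewrite mxBig mxBg !mx22e [RHS]mx22E; congr mx22; ring. Qed.
Lemma mxNN g : - 1%:M *m (- 1%:M *m g) = g.
Proof. by rewrite !mulNmx !mul1mx opprK. Qed.

Definition parity g := [/\ (2 %| g 0%R 0%R - 1)%Z, (2 %| g 0%R 1%R)%Z, (2 %| g 1%R 0%R)%Z & (2 %| g 1%R 1%R - 1)%Z].

Lemma Gamma2P g : Gamma2 g <-> SL2Z g /\ parity g.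
Proof.
split=> [[H D]|[H [h1 h2 h3 h4]]]; split=> //.
  by split; [have := D 0 0 | have := D 0 1 | have := D 1 0 | have := D 1 1];
    rewrite !mxE /= ?subr0.
have E : g - 1%:M = mx22 (g 0 0 - 1) (g 0 1) (g 1 0) (g 1 1 - 1).
  by rewrite [LHS]mx22E !mxE /= !subr0.
move=> i j; rewrite E mxE; by do 2?case: ifP.
Qed.

Lemma Gamma2_mx22 a b c d : a * d - b * c = 1 -> (2 %| a - 1)%Z -> (2 %| b)%Z -> (2 %| c)%Z ->
  (2 %| d - 1)%Z -> Gamma2 (mx22 a b c d).
Proof. by move=> *; apply/Gamma2P; split; [apply/SL2Z_mx22 | rewrite /parity !mx22e]. Qed.

Lemma Gamma2M g h : Gamma2 g -> Gamma2 h -> Gamma2 (g *m h).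
Proof.
move=> /Gamma2P[g1 [a b c d]] /Gamma2P[h1 [a' b' c' d']]; apply/Gamma2P; split; first exact: SL2ZM.
rewrite /parity !mulmx2E; split; [move: a a' b c' | move: a b b' d' | move: a' c c' d | move: b' c d d'];
  move=> /dvdzP[x Ex] /dvdzP[y Ey] /dvdzP[z Ez] /dvdzP[w Ew]; clear -Ex Ey Ez Ew.
- have -> : g 0 0 * h 0 0 + g 0 1 * h 1 0 - 1 = (g 0 0 - 1) * h 0 0 + (h 0 0 - 1) + g 0 1 * h 1 0 by ring.
  by rewrite Ex Ey Ez; apply/dvdzP; exists (x * h 0 0 + y + z * h 1 0); ring.
- by rewrite Ez Ey; apply/dvdzP; exists (g 0 0 * z + y * h 1 1); ring.
- by rewrite Ey Ez; apply/dvdzP; exists (y * h 0 0 + g 1 1 * z); ring.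
- have -> : g 1 0 * h 0 1 + g 1 1 * h 1 1 - 1 = g 1 0 * h 0 1 + (g 1 1 - 1) * h 1 1 + (h 1 1 - 1) by ring.
  by rewrite Ey Ez Ew; apply/dvdzP; exists (y * h 0 1 + z * h 1 1 + w); ring.
Qed.

Lemma Gamma2_1 : Gamma2 1%:M. Proof. by rewrite mx22_1; apply: Gamma2_mx22. Qed.
Lemma Gamma2_A : Gamma2 mxA. Proof. exact: Gamma2_mx22. Qed.
Lemma Gamma2_B : Gamma2 mxB. Proof. exact: Gamma2_mx22. Qed.
Lemma Gamma2_Ai : Gamma2 mxAi. Proof. exact: Gamma2_mx22. Qed.
Lemma Gamma2_Bi : Gamma2 mxBi. Proof. exact: Gamma2_mx22. Qed.
Lemma Gamma2_N1 : Gamma2 (- 1%:M). Proof. by rewrite mx22_1 mx22N; apply: Gamma2_mx22. Qed.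

Lemma unit_pair (a d : int) : a * d = 1 -> (a = 1 /\ d = 1) \/ (a = - 1 /\ d = - 1).
Proof.
move=> H; have : (`|a| * `|d|)%N = 1%N by rewrite -abszM H.
move=> /eqP; rewrite muln_eq1 => /andP[/eqP A /eqP D].
have [a1|a1] : a = 1 \/ a = -1 by lia.
  by rewrite a1 in H; lia.
by rewrite a1 in H; lia.
Qed.

(* Euclid's algorithm on the first column. *)
Lemma SL2Z_ind (P : 'M[int]_2 -> Prop) : P 1%:M ->
  (forall g, SL2Z g -> P g -> P (mxS *m g)) ->
  (forall g, SL2Z g -> P g -> P (mxT *m g)) ->
  (forall g, SL2Z g -> P g -> P (mxTi *m g)) -> forall g, SL2Z g -> P g.
Proof.
move=> P1 PS PT PTi.
have PSi g : SL2Z g -> P (mxS *m g) -> P g.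
  move=> h Pg; rewrite -(mxSSSS g).
  have s1 : SL2Z (mxS *m g) := SL2ZM SL2Z_S h.
  have s2 : SL2Z (mxS *m (mxS *m g)) := SL2ZM SL2Z_S s1.
  have s3 : SL2Z (mxS *m (mxS *m (mxS *m g))) := SL2ZM SL2Z_S s2.
  by apply: (PS _ s3); apply: (PS _ s2); apply: (PS _ s1).
have base (n : nat) g : SL2Z g -> g 1 0 = 0 -> g 0 0 = 1 -> (`|g 0%R 1%R| <= n)%N -> P g.
  elim: n g => [|n IH] g h c0 a1 bn.
    have /SL2ZP := h; rewrite c0 a1 => E.
    have -> : g = 1%:M; last by [].
    by rewrite mx22_1 [LHS]mx22E c0 a1; congr mx22; lia.
  have /SL2ZP := h; rewrite c0 a1 => E.
  have [b0|b0] := lerP 0 (g 0 1).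
    have [b1|b1] := eqVneq (g 0 1) 0; first by apply: IH => //; lia.
    rewrite -(mxTTi g); have h' := SL2ZM SL2Z_Ti h; apply: (PT _ h'); apply: IH => //; rewrite mxTig !mx22e; lia.
  rewrite -(mxTiT g); have h' := SL2ZM SL2Z_T h; apply: (PTi _ h'); apply: IH => //; rewrite mxTg !mx22e; lia.
have base2 g : SL2Z g -> g 1 0 = 0 -> P g.
  move=> h c0; have /SL2ZP := h; rewrite c0 mulr0 subr0 => /unit_pair[[a1 d1]|[a1 d1]].
    exact: (base _ _ h c0 a1 (leqnn _)).
  have s1 : SL2Z (mxS *m g) := SL2ZM SL2Z_S h.
  apply: (PSi _ h); apply: (PSi _ s1); apply: (base _ _ _ _ _ (leqnn _)).
  - exact: (SL2ZM SL2Z_S s1).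
  - by rewrite !mxSg !mx22e c0 oppr0.
  - by rewrite !mxSg !mx22e a1 opprK.
(* S preserves the sum of the two entries and clears the last bit; T and its inverse lower the sum
   but may set the bit, whence the factor 2. *)
move=> g; have [n] := ubnP (2 * (`|g 0%R 0%R| + `|g 1%R 0%R|) + (`|g 0%R 0%R| < `|g 1%R 0%R|))%N.
elim: n g => [//|n IH] g gn h.
have [c0|c0] := eqVneq (g 1 0) 0; first exact: base2.
have [ac|ac] := ltnP `|g 0%R 0%R|%N `|g 1%R 0%R|%N.
  apply: (PSi _ h); apply: IH; last exact: (SL2ZM SL2Z_S h).
  by rewrite mxSg !mx22e; lia.
have [same|opp] := boolP ((0 <= g 0 0) == (0 <= g 1 0)).
  rewrite -(mxTTi g); have h' := SL2ZM SL2Z_Ti h; apply: (PT _ h'); apply: IH => //.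
  by rewrite mxTig !mx22e; lia.
rewrite -(mxTiT g); have h' := SL2ZM SL2Z_T h; apply: (PTi _ h'); apply: IH => //.
by rewrite mxTg !mx22e; lia.
Qed.

(** Euclid's algorithm with steps of twice the smaller entry. In the first column the upper entry is
    odd and the lower one even, so their absolute values differ and each step with a nonzero lower
    entry strictly lowers the sum. *)
Lemma Gamma2_ind (P : 'M[int]_2 -> Prop) : P 1%:M ->
  (forall g, Gamma2 g -> P g -> P (mxA *m g)) ->
  (forall g, Gamma2 g -> P g -> P (mxAi *m g)) ->
  (forall g, Gamma2 g -> P g -> P (mxB *m g)) ->
  (forall g, Gamma2 g -> P g -> P (mxBi *m g)) ->
  (forall g, Gamma2 g -> P g -> P (- 1%:M *m g)) -> forall g, Gamma2 g -> P g.
Proof.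
move=> P1 PA PAi PB PBi PN.
have base (n : nat) g : Gamma2 g -> g 1 0 = 0 -> g 0 0 = 1 -> (`|g 0%R 1%R| <= n)%N -> P g.
  elim: n g => [|n IH] g h c0 a1 bn.
    have /Gamma2P[/SL2ZP] := h; rewrite c0 a1 => E _.
    have -> : g = 1%:M; last by [].
    by rewrite mx22_1 [LHS]mx22E c0 a1; congr mx22; lia.
  have /Gamma2P[/SL2ZP] := h; rewrite c0 a1 => E [_ /dvdzP[x Ex] _ _].
  have [b0|b0] := lerP 0 (g 0 1).
    have [b1|b1] := eqVneq (g 0 1) 0; first by apply: IH => //; lia.
    rewrite -(mxAAi g); have h' := Gamma2M Gamma2_Ai h; apply: (PA _ h'); apply: IH => //; rewrite mxAig !mx22e; lia.
  rewrite -(mxAiA g); have h' := Gamma2M Gamma2_A h; apply: (PAi _ h'); apply: IH => //; rewrite mxAg !mx22e; lia.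
have base2 g : Gamma2 g -> g 1 0 = 0 -> P g.
  move=> h c0; have /Gamma2P[/SL2ZP] := h; rewrite c0 mulr0 subr0 => /unit_pair[[a1 d1]|[a1 d1]] _.
    exact: (base _ _ h c0 a1 (leqnn _)).
  have h' := Gamma2M Gamma2_N1 h.
  rewrite -(mxNN g); apply: (PN _ h'); apply: (base _ _ h' _ _ (leqnn _)); rewrite mxNg !mx22e; lia.
move=> g; have [n] := ubnP (`|g 0%R 0%R| + `|g 1%R 0%R|)%N.
elim: n g => [//|n IH] g gn h.
have [c0|c0] := eqVneq (g 1 0) 0; first exact: base2.
have /Gamma2P[_ [/dvdzP[x Ex] _ /dvdzP[y Ey] _]] := h.
have [ac|ac] := ltnP `|g 0%R 0%R|%N `|g 1%R 0%R|%N.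
  have [same|opp] := boolP ((0 <= g 0 0) == (0 <= g 1 0)).
    rewrite -(mxBiB g); have h' := Gamma2M Gamma2_B h; apply: (PBi _ h'); apply: IH => //.
    by rewrite mxBg !mx22e; lia.
  rewrite -(mxBBi g); have h' := Gamma2M Gamma2_Bi h; apply: (PB _ h'); apply: IH => //.
  by rewrite mxBig !mx22e; lia.
have [same|opp] := boolP ((0 <= g 0 0) == (0 <= g 1 0)).
  rewrite -(mxAAi g); have h' := Gamma2M Gamma2_Ai h; apply: (PA _ h'); apply: IH => //.
  by rewrite mxAig !mx22e; lia.
rewrite -(mxAiA g); have h' := Gamma2M Gamma2_A h; apply: (PAi _ h'); apply: IH => //.
by rewrite mxAg !mx22e; lia.
Qed.

End Modular.

(** * The action on the upper half-plane and the slash operator *)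

Section Slash.
Variable R : realType.
Local Notation C := R[i].
Local Notation "x %:C" := (real_complex R x).
Local Notation uhp := (@upper_half_plane R).
Implicit Types (f : C -> C) (g h : 'M[int]_2) (z : C).

Definition den g z : C := (g 1 0)%:~R * z + (g 1 1)%:~R.
Definition mob g z : C := ((g 0 0)%:~R * z + (g 0 1)%:~R) / den g z.

Lemma slash2E g f z : slash2 g f z = f (mob g z) * den g z ^- 2.
Proof. by []. Qed.

Lemma intC (m : int) : m%:~R = (m%:~R : R)%:C :> C.
Proof. by rewrite -(rmorph_int (real_complex R)). Qed.

Lemma det_neq0 g (x : R) : SL2Z g -> g 1 0 = 0 -> g 1 1 != 0.
Proof.
move=> /SL2ZP E c0; apply: contra_eq_neq E => ->; by rewrite c0 !mulr0 subrr.
Qed.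

Lemma den_neq0 g z : SL2Z g -> uhp z -> den g z != 0.
Proof.
move=> gS z0; apply/eqP => E; have := congr1 (@complex.Im R) E; have := congr1 (@complex.Re R) E.
rewrite /den !intC; case: z z0 {E} => x y; rewrite /upper_half_plane /= => y0.
rewrite !mul0r subr0 !addr0 => E1 /eqP; rewrite mulf_eq0 (gt_eqF y0) orbF intr_eq0 => /eqP c0.
move: E1; rewrite c0 mul0r add0r => /eqP; rewrite intr_eq0; apply/negP; exact: (@det_neq0 g 0).
Qed.

Lemma Im_mob g z : SL2Z g -> uhp z -> complex.Im (mob g z) = complex.Im z / cnorm (den g z) ^+ 2.
Proof.
move=> gS z0; have d0 := den_neq0 gS z0; have /SL2ZP D := gS.
have D' : (g 0 0)%:~R * (g 1 1)%:~R - (g 0 1)%:~R * (g 1 0)%:~R = 1 :> R.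
  by rewrite -!intrM -intrB D.
have s0 : cnorm (den g z) ^+ 2 != 0 by rewrite expf_neq0 // N_eq0.
rewrite sqrN in s0 *; rewrite /mob; move: s0; rewrite /den !intC.
case: z {z0 d0} => x y /=; rewrite !mul0r !subr0 !addr0 => s0.
apply: (canRL (mulfK s0)).
transitivity (((g 0 0)%:~R * (g 1 1)%:~R - (g 0 1)%:~R * (g 1 0)%:~R) * y : R).
  by field.
by rewrite D' mul1r.
Qed.

Lemma uhp_mob g z : SL2Z g -> uhp z -> uhp (mob g z).
Proof.
move=> gS z0; rewrite /upper_half_plane Im_mob // divr_gt0 //.
by rewrite exprn_gt0 // N_gt0 den_neq0.
Qed.

Lemma den_M g h z : SL2Z h -> uhp z -> den (g *m h) z = den g (mob h z) * den h z.
Proof.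
move=> hS z0; have := den_neq0 hS z0; rewrite /mob /den !mulmx2E !intrD !intrM => d0.
by field.
Qed.

Lemma mob_M g h z : SL2Z g -> SL2Z h -> uhp z -> mob (g *m h) z = mob g (mob h z).
Proof.
move=> gS hS z0; have d0 := den_neq0 hS z0; have d1 := den_neq0 gS (uhp_mob hS z0).
have nE : ((g *m h) 0 0)%:~R * z + ((g *m h) 0 1)%:~R =
    ((g 0 0)%:~R * mob h z + (g 0 1)%:~R) * den h z.
  by move: d0; rewrite /mob /den !mulmx2E !intrD !intrM => d0; field.
by rewrite {1}/mob den_M // nE -mulf_div divff // mulr1.
Qed.

Definition off0 f := forall z, ~ uhp z -> f z = 0.

(** The imaginary part of [z] is that of [mob g z] times a positive square, so a point outside the
    half-plane is not mapped into it. *)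
Lemma slash2_off g f : SL2Z g -> off0 f -> off0 (slash2 g f).
Proof.
move=> gS fo z z0; rewrite slash2E fo ?mul0r // => m0; apply: z0.
have [d0|d0] := eqVneq (den g z) 0.
  (* Division by a zero denominator returns 0, which is outside the half-plane. *)
  by move: m0; rewrite /mob d0 invr0 mulr0 /upper_half_plane ltxx.
have /SL2ZP D := gS.
have D' : (g 0 0)%:~R * (g 1 1)%:~R - (g 0 1)%:~R * (g 1 0)%:~R = 1 :> R.
  by rewrite -!intrM -intrB D.
have s0 : 0 < cnorm (den g z) ^+ 2 by rewrite exprn_gt0 // N_gt0.
suff E : complex.Im z = complex.Im (mob g z) * cnorm (den g z) ^+ 2.
  by rewrite /upper_half_plane E mulr_gt0.
move: s0; rewrite sqrN /mob => /gt_eqF/negbT; rewrite /den !intC.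
case: z {d0 m0} => x y /=; rewrite !mul0r !subr0 !addr0 => s0.
have {1}-> : y = ((g 0 0)%:~R * (g 1 1)%:~R - (g 0 1)%:~R * (g 1 0)%:~R) * y by rewrite D' mul1r.
by field.
Qed.

Lemma slash2M g h f : SL2Z g -> SL2Z h -> off0 f -> slash2 (g *m h) f =1 slash2 h (slash2 g f).
Proof.
move=> gS hS fo z; have [z0|z0] := pselect (uhp z); last first.
  by rewrite (slash2_off (SL2ZM gS hS) fo z0) (slash2_off hS (slash2_off gS fo) z0).
rewrite !slash2E mob_M // den_M // exprMn invfM.
by rewrite mulrA.
Qed.

Lemma den_1 z : den 1%:M z = 1.
Proof. by rewrite /den mx22_1 !mx22e mulr0z mulr1z mul0r add0r. Qed.

Lemma mob_1 z : mob 1%:M z = z.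
Proof. by rewrite /mob den_1 mx22_1 !mx22e mulr0z mulr1z mul1r addr0 divr1. Qed.

Lemma slash2_1 f : slash2 1%:M f =1 f.
Proof. by move=> z; rewrite slash2E mob_1 den_1 expr1n invr1 mulr1. Qed.

Lemma slash2_ext g f f' : f =1 f' -> slash2 g f =1 slash2 g f'.
Proof. by move=> E z; rewrite !slash2E E. Qed.

Lemma slash2Z g (c : C) f : slash2 g (fun z => c * f z) =1 (fun z => c * slash2 g f z).
Proof. by move=> z; rewrite !slash2E mulrA. Qed.

Lemma slash2_N g f : slash2 (- g) f =1 slash2 g f.
Proof.
move=> z; rewrite !slash2E.
have -> : den (- g) z = - den g z by rewrite /den !mxE !mulrNz; ring.
have -> : mob (- g) z = mob g z.
  rewrite /mob (_ : den (- g) z = - den g z); last by rewrite /den !mxE !mulrNz; ring.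
  by rewrite !mxE !mulrNz invrN mulrN -mulNr; congr (_ / _); ring.
by rewrite sqrrN.
Qed.

Lemma hol_den g z : hol (den g) z.
Proof. by apply: holD; [apply/holZ/hol_id | exact: hol_cst]. Qed.

Lemma hol_mob g z : SL2Z g -> uhp z -> hol (mob g) z.
Proof.
move=> gS z0; apply: holM; first by apply: holD; [apply/holZ/hol_id | exact: hol_cst].
by apply: holV; [exact: hol_den | exact: den_neq0].
Qed.

Lemma hol_slash2 g f z : SL2Z g -> uhp z -> (forall z, uhp z -> hol f z) -> hol (slash2 g f) z.
Proof.
move=> gS z0 fh; apply: holM.
  by apply: (hol_comp (g := f)); [exact: hol_mob | apply/fh/uhp_mob].
by apply: holV; [apply/holX/hol_den | rewrite expf_neq0 // den_neq0].
Qed.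

(* Inverting in the half-disc |z|^2 < 1/2 at least doubles the imaginary part. *)
Lemma reduction z : uhp z -> exists2 g, SL2Z g &
  1 / 2 <= complex.Im (mob g z) /\ 0 <= complex.Re (mob g z) <= 1.
Proof.
have shift (w : C) : uhp w -> exists2 g, SL2Z g & complex.Im (mob g w) = complex.Im w /\
    - 1 / 2 <= complex.Re (mob g w) <= 1 / 2.
  move=> w0; set k := Num.floor (complex.Re w + 1 / 2).
  exists (mx22 1 (- k) 0 1); first by apply/SL2Z_mx22; rewrite mulr0 subr0.
  have -> : mob (mx22 1 (- k) 0 1) w = w - (k%:~R)%:C.
    by rewrite /mob /den !mx22e mul0r add0r divr1 mul1r mulrNz intC.
  rewrite ImD ImN ReD ReN /= subr0; split=> //.
  by have := Num.Theory.floor_itv (complex.Re w + 1 / 2); rewrite -/k mathcomp_extra.intrD1; lra.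
(* [shift] centres the strip to make inversion efficient; [shift'] ends in [0, 1], the side of the
   rectangle on which compactness is used. *)
have shift' (w : C) : uhp w -> exists2 g, SL2Z g & complex.Im (mob g w) = complex.Im w /\
    0 <= complex.Re (mob g w) <= 1.
  move=> w0; set k := Num.floor (complex.Re w).
  exists (mx22 1 (- k) 0 1); first by apply/SL2Z_mx22; rewrite mulr0 subr0.
  have -> : mob (mx22 1 (- k) 0 1) w = w - (k%:~R)%:C.
    by rewrite /mob /den !mx22e mul0r add0r divr1 mul1r mulrNz intC.
  rewrite ImD ImN ReD ReN /= subr0; split=> //.
  by have := Num.Theory.floor_itv (complex.Re w); rewrite -/k mathcomp_extra.intrD1; lra.
move=> z0; suff [g gS gI] : exists2 g, SL2Z g & 1 / 2 <= complex.Im (mob g z).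
  have [h hS [h1 h2]] := shift' _ (uhp_mob gS z0).
  by exists (h *m g); [exact: SL2ZM | rewrite mob_M // h1].
(* [n] bounds the number of inversions needed to reach height 1/2. *)
have [n /(_ n (leqnn n))] := exists_pow2 (1 / 2) z0.
elim: n z z0 => [|n IH] z z0.
  rewrite expr0 mulr1 => h; exists 1%:M; first exact: SL2Z1.
  by rewrite mob_1 ltW.
move=> h; have [g gS [g1 g2]] := shift z z0; set w := mob g z in g1 g2.
have w0 : uhp w := uhp_mob gS z0.
have [wI|wI] := lerP (1 / 2) (complex.Im w); first by exists g.
have [||k kS kI] := IH (mob mxS w).
- exact: (uhp_mob SL2Z_S).
- rewrite (Im_mob SL2Z_S w0); apply: lt_le_trans h _; rewrite exprS mulrA ler_wpM2r ?exprn_ge0 // -g1.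
  rewrite ler_pdivlMr; last by rewrite exprn_gt0 // N_gt0; apply: den_neq0 SL2Z_S w0.
  have -> : den mxS w = w by rewrite /den /mxS !mx22e mul1r addr0.
  rewrite sqrN.
  have : complex.Re w ^+ 2 <= 1 / 4 by nra.
  have : complex.Im w ^+ 2 <= 1 / 4 by move: w0; rewrite /upper_half_plane; nra.
  by move: w0; rewrite /upper_half_plane; nra.
exists (k *m (mxS *m g)); first by do 2?apply: SL2ZM => //; exact: SL2Z_S.
by rewrite (mob_M kS (SL2ZM SL2Z_S gS) z0) (mob_M SL2Z_S gS z0).
Qed.

End Slash.

(** * Cusp forms *)

Section Constancy.
Variable R : realType.
Local Notation C := R[i].
Local Notation "x %:C" := (real_complex R x).
Local Notation uhp := (@upper_half_plane R).
Implicit Types (f : C -> C) (g : 'M[int]_2) (z w : C).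

Lemma Gamma2_conj g k : SL2Z g -> Gamma2 k -> Gamma2 (g *m k *m inv2 g).
Proof.
move=> gS [kS kD]; split; first by apply: SL2ZM; [exact: SL2ZM | exact: SL2Z_inv].
move=> i j; have -> : g *m k *m inv2 g - 1%:M = g *m (k - 1%:M) *m inv2 g.
  by rewrite mulmxBr mulmxBl mulmx1 inv2Kr.
rewrite !mulmx2E; apply: rpredD; apply: dvdz_mulr; apply: rpredD; exact: dvdz_mull.
Qed.

Lemma uhp_local f f' z : uhp z -> (forall w, uhp w -> f w = f' w) -> hol f z -> hol f' z.
Proof.
move=> z0 E; apply: (@hol_local _ _ _ _ (complex.Im z)) => // h hr; apply: E.
by rewrite /upper_half_plane ImD; have := N_ge_Im h; rewrite ler_norml; lra.
Qed.

Lemma finite_max (I : finType) (x0 : I) (F : I -> R) : exists x, forall y, F y <= F x.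
Proof.
have [x _ H] := @Order.TotalTheory.arg_maxP _ _ I x0 xpredT F isT.
by exists x => y; apply: H.
Qed.

Lemma finite_ub (I : finType) (F : I -> R) : exists Y, forall y, F y <= Y.
Proof.
exists (\sum_x `|F x|) => y; rewrite (bigD1 y) //=.
by apply: le_trans (ler_norm _) _; rewrite lerDl sumr_ge0.
Qed.

Lemma tends_scale f c : tends f c -> tends (fun w => f (2%:R * w)) c.
Proof.
move=> H e /H[Y HY]; exists (`|Y|) => w hw; apply: HY.
rewrite -(rmorph_nat (real_complex R)) ImM /= mul0r addr0.
by have := ler_norm Y; have := normr_ge0 Y; lra.
Qed.

Lemma Im_2 w : complex.Im (2%:R * w) = 2 * complex.Im w.
Proof. by rewrite -(rmorph_nat (real_complex R)) ImM /= mul0r addr0. Qed.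

Lemma Im_half w : complex.Im (w / 2%:R) = complex.Im w / 2.
Proof. by rewrite -(rmorph_nat (real_complex R)) -fmorphV ImM /= mulr0 add0r. Qed.

Lemma two_half w : 2%:R * (w / 2%:R) = w.
Proof. by rewrite mulrC divfK ?pnatr_eq0. Qed.

Section Family.
Variables (I : finType) (h : C -> C) (rep : I -> 'M[int]_2) (c : I -> C).
Hypothesis repS : forall x, SL2Z (rep x).
Hypothesis cover : forall g, SL2Z g -> exists x, forall z, uhp z -> h (mob g z) = h (mob (rep x) z).
Hypothesis hh : forall z, uhp z -> hol h z.
Hypothesis hc : forall x, tends (fun z => h (mob (rep x) z)) (c x).
Hypothesis hper : forall x z, uhp z -> h (mob (rep x) (z + 2%:R)) = h (mob (rep x) z).

Let hinv g z : SL2Z g -> uhp z -> exists2 x, uhp (mob g z) & h z = h (mob (rep x) (mob g z)).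
Proof.
move=> gS z0; have [x Hx] := cover (SL2Z_inv gS); have w0 := uhp_mob gS z0.
by exists x => //; rewrite -Hx // -mob_M ?inv2K ?mob_1 //; exact: SL2Z_inv.
Qed.

Let hmob x z : uhp z -> hol (fun z => h (mob (rep x) z)) z.
Proof.
move=> z0; apply: (hol_comp (g := h)); first exact: hol_mob.
by apply/hh/uhp_mob.
Qed.

Let uhp2 w : 0 < complex.Im w -> uhp (2%:R * w).
Proof. by move=> w0; rewrite /upper_half_plane Im_2; lra. Qed.

(** If some cusp value [c x] dominates [h], the maximum principle at that cusp applies. Otherwise
    every cusp value is exceeded at some point; the largest of these finitely many values dominates
    [h] near all cusps, and the rest of the strip is compact. So the modulus has an interior
    maximum. *)
Lemma modular_const : forall z w, uhp z -> uhp w -> h z = h w.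
Proof.
have [[x Hx]|nx] := pselect (exists x, forall z, uhp z -> cnorm (h z) <= cnorm (c x)).
  (* Doubling the argument turns the period 2 into the period 1 of [cusp_max]. *)
  pose F w := h (mob (rep x) (2%:R * w)).
  have Fc w : 0 < complex.Im w -> F w = c x.
    apply: cusp_max => [z z0|z z0||z z0].
    - by rewrite /F mulrDr mulr1 hper //; apply: uhp2.
    - apply: (hol_comp (g := fun z => h (mob (rep x) z))); first exact/holZ/hol_id.
      by apply/hmob/uhp2.
    - exact: (tends_scale (hc x)).
    - by apply: Hx; apply: uhp_mob => //; apply: uhp2.
  have all z : uhp z -> h z = c x.
    move=> z0; have w0 := uhp_mob (SL2Z_inv (repS x)) z0.
    have E : z = mob (rep x) (mob (inv2 (rep x)) z).
      by rewrite -mob_M ?inv2Kr ?mob_1 //; exact: SL2Z_inv.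
    set w := mob _ z in w0 E; have := Fc (w / 2%:R).
    rewrite /F two_half -E; apply.
    by rewrite Im_half; move: w0; rewrite /upper_half_plane; lra.
  by move=> z w z0 w0; rewrite !all.
have i0 : uhp ('i%C : C) by rewrite /upper_half_plane /= ltr01.
have [x0 _] := cover SL2Z1.
have ex x : exists z, uhp z /\ cnorm (c x) < cnorm (h z).
  apply: contrapT => H; apply: nx; exists x => z z0; rewrite leNgt; apply/negP => hz.
  by apply: H; exists z.
pose zx x := projT1 (cid (ex x)).
have zxP x : uhp (zx x) /\ cnorm (c x) < cnorm (h (zx x)) := projT2 (cid (ex x)).
have [xs Hs] := finite_max x0 (fun x => cnorm (h (zx x))).
set zs := zx xs in Hs; have [zs0 _] := zxP xs.
have exY x : exists Y : R, forall z, Y < complex.Im z -> cnorm (h (mob (rep x) z)) <= cnorm (h zs).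
  have e0 : 0 < cnorm (h zs) - cnorm (c x) by have [_ h1] := zxP x; have := Hs x; lra.
  have [Y HY] := hc x e0; exists Y => z /HY.
  have := ND (h (mob (rep x) z) - c x) (c x); rewrite subrK; lra.
pose Yx x := projT1 (cid (exY x)).
have YxP x := projT2 (cid (exY x)).
have [Y HY] := finite_ub Yx.
pose Z := `|Y| + 1; have Z0 : 0 < Z by rewrite /Z; have := normr_ge0 Y; lra.
(* Parametrizes the part of the strip from height 1/2 up to a height beyond all the thresholds
   [Yx x]. *)
pose pt (s u : R) : C := Complex s (1 / 2 + u * Z).
have pt0 s u : 0 <= u <= 1 -> uhp (pt s u) by move=> hu; rewrite /upper_half_plane /=; nra.
have exm x : exists p, uhp p /\ forall s u, 0 <= s <= 1 -> 0 <= u <= 1 ->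
    cnorm (h (mob (rep x) (pt s u))) <= cnorm (h p).
  have [|s1 [u1 [hs hu H]]] := @usc_max R (fun s u => cnorm (h (mob (rep x) (pt s u)))).
    move=> s u hs hu e e0.
    have [r r0 H] := hol_cont (hmob x (pt0 s u hu)) e0.
    exists (Num.min (r / 2) (r / 2 / Z)); first by rewrite min2_gt0 // !divr_gt0.
    move=> s' u'; rewrite !lt_min => /andP[h1 _] /andP[_]; rewrite ltr_pdivlMr // => h2.
    have E : pt s' u' = pt s u + Complex (s' - s) ((u' - u) * Z).
      by apply: Cext; rewrite /= ?ReD ?ImD /=; ring.
    have hr : cnorm (Complex (s' - s) ((u' - u) * Z)) < r.
      apply: le_lt_trans (N_le_ReIm _) _ => /=.
      by rewrite normrM (ger0_norm (ltW Z0)); lra.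
    rewrite E; have := H _ hr.
    have := N_lerB (h (mob (rep x) (pt s u + Complex (s' - s) ((u' - u) * Z)))) (h (mob (rep x) (pt s u))).
    lra.
  by exists (mob (rep x) (pt s1 u1)); split => //; apply: uhp_mob => //; apply: pt0.
pose px x := projT1 (cid (exm x)).
have pxP x : uhp (px x) /\ forall s u, 0 <= s <= 1 -> 0 <= u <= 1 ->
    cnorm (h (mob (rep x) (pt s u))) <= cnorm (h (px x)) := projT2 (cid (exm x)).
have [xp Hp] := finite_max x0 (fun x => cnorm (h (px x))).
have [pp0 _] := pxP xp.
have bound z : uhp z -> cnorm (h z) <= Num.max (cnorm (h zs)) (cnorm (h (px xp))).
  move=> z0; have [g gS [gI gR]] := reduction z0.
  have [x w0 ->] := hinv gS z0; set w := mob g z in gI gR w0 *.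
  rewrite le_max; apply/orP; have [wY|wY] := ltP (Yx x) (complex.Im w); first by left; apply: YxP.
  right; apply: le_trans (Hp x).
  have -> : w = pt (complex.Re w) ((complex.Im w - 1 / 2) / Z).
    by apply: Cext => //=; field; rewrite gt_eqF.
  apply: (proj2 (pxP x)) => //; rewrite divr_ge0 ?ler_pdivrMr //=; try lra.
  by have := HY x; have := ler_norm Y; rewrite /Z; lra.
have [p p0 pM] : exists2 p, uhp p & forall z, uhp z -> cnorm (h z) <= cnorm (h p).
  have [l|l] := lerP (cnorm (h zs)) (cnorm (h (px xp))).
    by exists (px xp) => // z /bound; rewrite (max_idPr l).
  by exists zs => // z /bound; rewrite (max_idPl (ltW l)).
have all z : uhp z -> h z = h p.
  move=> z0; rewrite -(subrKC p z).
  have up s : 0 <= s <= 1 -> uhp (seg p (z - p) s).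
    move=> s01; rewrite /upper_half_plane /seg ImD ImM ReC ImC ImD ImN.
    by move: z0 p0; rewrite /upper_half_plane; nra.
  apply: seg_const => // [s s01|s s01 E]; first by apply/hol_cont/hh/up.
  exists (complex.Im (seg p (z - p) s)); first exact: up.
  have near k : cnorm k < complex.Im (seg p (z - p) s) -> uhp (seg p (z - p) s + k).
    by move=> hk; rewrite /upper_half_plane ImD; have := N_ge_Im k; rewrite ler_norml; lra.
  move=> k hk; rewrite -E; apply: (max_principle _ _ _ _ hk).
  - exact: up.
  - by apply/hol_cont/hh/up.
  - by move=> k' _ /near/hh.
  - by move=> k' /near k0; rewrite E; apply: pM.
by move=> z w z0 w0; rewrite !all.
Qed.

End Family.
End Constancy.

(** * The functions f_ijk: transformation, cusps, eigenforms *)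

Section Forms.
Variables (R : realType) (n : nat).
Hypothesis n_gt2 : (2 < n)%N.
Local Notation C := R[i].
Local Notation "x %:C" := (real_complex R x).
Local Notation uhp := (@upper_half_plane R).
Local Notation ze := (@zeta R n).
Implicit Types (f : C -> C) (g : 'M[int]_2) (z w : C) (i j k : int).

Lemma nC_neq0 : n%:R != 0 :> C.
Proof. by rewrite pnatr_eq0 -lt0n; apply: leq_trans n_gt2. Qed.

Lemma nR_gt0 : 0 < n%:R :> R.
Proof. by rewrite ltr0n; apply: leq_trans n_gt2. Qed.

Definition ffexp i j k z : C := (i%:~R * l2 z + j%:~R * l4 z + k%:~R * l3 z) / n%:R.

(* theta_2^(4i/n) theta_4^(4j/n) theta_3^(4k/n); with [i + j + k = n] it has weight two. *)
Definition ff i j k z : C := if 0 < complex.Im z then cexp (ffexp i j k z) else 0.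

Lemma ffE i j k z : uhp z -> ff i j k z = cexp (ffexp i j k z).
Proof. by move=> z0; rewrite /ff ifT. Qed.

Lemma ff_off i j k : off0 (ff i j k).
Proof. by move=> z /negP/negbTE z0; rewrite /ff z0. Qed.

Lemma ff_neq0 i j k z : uhp z -> ff i j k z != 0.
Proof. by move=> z0; rewrite ffE // cexp_neq0. Qed.

Lemma hol_ff i j k z : uhp z -> hol (ff i j k) z.
Proof.
move=> z0; apply: (uhp_local (f := fun z => cexp (ffexp i j k z))) => //.
  by move=> w w0; rewrite ffE.
apply: (hol_comp (g := @cexp R)); last exact: hol_cexp.
apply: holM; last exact: hol_cst.
apply: holD; last exact/holZ/hol_l3.
by apply: holD; [exact/holZ/hol_l2 | exact/holZ/hol_l4].
Qed.

(** The scalar produced by T, a square root of zeta^i; it comes from the pi i in [l2_T]. *)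
Definition wT i : C := cexp (Complex 0 pi * (i%:~R / n%:R)).

Lemma zetaE : ze = cexp (Complex 0 (2 * pi) / n%:R).
Proof.
have -> : Complex 0 (2 * pi) / n%:R = Complex 0 (2 * pi / n%:R) :> C.
  by rewrite -(rmorph_nat (real_complex R)) -fmorphV; apply: Cext => /=; ring.
by rewrite /cexp /= expR0 mul1r.
Qed.

Lemma zeta_neq0 : ze != 0. Proof. by rewrite zetaE cexp_neq0. Qed.

Lemma zeta_n : ze ^+ n = 1.
Proof. by rewrite zetaE -cexpMn -[_ *+ n]mulr_natr divfK ?nC_neq0 // cexp_2pi. Qed.

Lemma zetaz i : ze ^ i = cexp (Complex 0 (2 * pi) * (i%:~R / n%:R)).
Proof. by rewrite zetaE -cexpMz -mulrzr; congr cexp; ring. Qed.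

Lemma wT_sq i : wT i * wT i = ze ^ i.
Proof.
rewrite zetaz /wT -cexpD; congr cexp.
have -> : Complex 0 (2 * pi) = 2%:R * Complex 0 pi :> C.
  by rewrite -(rmorph_nat (real_complex R)); apply: Cext => /=; ring.
by ring.
Qed.

Lemma mob_T z : mob mxT z = z + 1 :> C.
Proof. by rewrite /mob /den /mxT !mx22e mulr0z mulr1z mul0r add0r mul1r divr1. Qed.

Lemma den_T z : den mxT z = 1 :> C.
Proof. by rewrite /den /mxT !mx22e mulr0z mulr1z mul0r add0r. Qed.

Lemma mob_S z : mob mxS z = - z^-1 :> C.
Proof. by rewrite /mob /den /mxS !mx22e mulr0z mulr1z mul0r add0r mul1r addr0 mulrNz mulr1z mulN1r. Qed.

Lemma den_S z : den mxS z = z :> C.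
Proof. by rewrite /den /mxS !mx22e mulr0z mulr1z mul1r addr0. Qed.

Lemma slash_T i j k : slash2 mxT (ff i j k) =1 (fun z => wT i * ff i k j z).
Proof.
move=> z; have [z0|z0] := pselect (uhp z); last first.
  by rewrite (slash2_off SL2Z_T (@ff_off i j k) z0) (@ff_off i k j _ z0) mulr0.
rewrite slash2E mob_T den_T expr1n invr1 mulr1 !ffE //; last exact: uhp_T.
rewrite -cexpD; congr cexp; rewrite /ffexp (l2_T z0) l4_T l3_T.
by field; exact: nC_neq0.
Qed.

(** Each of the three logarithms gains [2 * lam], so [i + j + k = n] makes the total exactly
    [2 * lam]. Its exponential [- z ^+ 2] against the slash factor [z ^- 2] leaves the sign. *)
Lemma slash_S i j k : i + j + k = n -> slash2 mxS (ff i j k) =1 (fun z => - 1 * ff j i k z).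
Proof.
move=> E z; have [z0|z0] := pselect (uhp z); last first.
  by rewrite (slash2_off SL2Z_S (@ff_off i j k) z0) (@ff_off j i k _ z0) mulr0.
rewrite slash2E mob_S den_S !ffE //; last exact: uhp_S.
have -> : ffexp i j k (- z^-1) = ffexp j i k z + 2%:R * lam z.
  rewrite /ffexp (l2_S z0) (l4_S z0) (l3_S z0).
  have e : n%:R = i%:~R + j%:~R + k%:~R :> C by rewrite -!intrD E.
  by rewrite e; field; rewrite -e nC_neq0.
rewrite cexpD (cexp_2lam z0); have zn := tau_neq0 z0.
by field.
Qed.

Lemma slash_Ti i j k : slash2 mxTi (ff i j k) =1 (fun z => (wT i)^-1 * ff i k j z).
Proof.
move=> z; have w0 : wT i != 0 by exact: cexp_neq0.
apply: (mulfI w0); rewrite [RHS]mulrA mulfV // mul1r -slash2Z.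
rewrite -(slash2_ext _ (slash_T i k j)) -(slash2M SL2Z_T SL2Z_Ti (@ff_off i k j)).
have -> : mxT *m mxTi = 1%:M by rewrite -[mxTi]mulmx1 mxTTi.
by rewrite slash2_1.
Qed.

Lemma mxTT : mxT *m mxT = mxA. Proof. by rewrite mx22M. Qed.
Lemma mxSAS : mxS *m (mxA *m mxS) = - mxB. Proof. by rewrite !mx22M mx22N. Qed.

Lemma SL2Z_A : SL2Z mxA. Proof. by case: Gamma2_A. Qed.
Lemma SL2Z_B : SL2Z mxB. Proof. by case: Gamma2_B. Qed.

Lemma slash_A i j k : slash2 mxA (ff i j k) =1 (fun z => ze ^ i * ff i j k z).
Proof.
move=> z; rewrite -mxTT slash2M //; [ | exact: SL2Z_T | exact: SL2Z_T | exact: ff_off].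
by rewrite (slash2_ext _ (slash_T i j k)) slash2Z slash_T mulrA wT_sq.
Qed.

Lemma slash_B i j k : i + j + k = n -> slash2 mxB (ff i j k) =1 (fun z => ze ^ j * ff i j k z).
Proof.
move=> E z; have E' : j + i + k = n by rewrite (addrC j).
rewrite -slash2_N -mxSAS slash2M; [ | exact: SL2Z_S | exact: SL2ZM SL2Z_A SL2Z_S | exact: ff_off].
rewrite (slash2_ext _ (slash_S E)) slash2Z slash2M; [ | exact: SL2Z_A | exact: SL2Z_S | exact: ff_off].
rewrite (slash2_ext _ (slash_A j i k)) slash2Z slash_S //; ring.
Qed.

Lemma slash_perm g : SL2Z g -> forall i j k, i + j + k = n ->
  exists c i' j' k', [/\ c != 0, i' + j' + k' = n,
    forall P : int -> Prop, P i -> P j -> P k -> P i'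
    & slash2 g (ff i j k) =1 (fun z => c * ff i' j' k' z)].
Proof.
move: g; apply: SL2Z_ind.
- move=> i j k E; exists 1, i, j, k; split=> //; first exact: oner_neq0.
  by move=> z; rewrite slash2_1 mul1r.
- move=> g gS IH i j k E; have E' : j + i + k = n by rewrite (addrC j).
  have [c [i' [j' [k' [c0 e P H]]]]] := IH j i k E'.
  exists (- 1 * c), i', j', k'; split=> //; first by rewrite mulN1r oppr_eq0.
    by move=> Q Qi Qj Qk; apply: P.
  move=> z; rewrite slash2M; [ | exact: SL2Z_S | exact: gS | exact: ff_off].
  by rewrite (slash2_ext _ (slash_S E)) slash2Z H mulrA.
- move=> g gS IH i j k E; have E' : i + k + j = n by rewrite addrAC.
  have [c [i' [j' [k' [c0 e P H]]]]] := IH i k j E'.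
  exists (wT i * c), i', j', k'; split=> //; first exact: (mulf_neq0 (cexp_neq0 _) c0).
    by move=> Q Qi Qj Qk; apply: P.
  move=> z; rewrite slash2M; [ | exact: SL2Z_T | exact: gS | exact: ff_off].
  by rewrite (slash2_ext _ (slash_T i j k)) slash2Z H mulrA.
- move=> g gS IH i j k E; have E' : i + k + j = n by rewrite addrAC.
  have [c [i' [j' [k' [c0 e P H]]]]] := IH i k j E'.
  exists ((wT i)^-1 * c), i', j', k'; split=> //.
  + by apply: mulf_neq0 => //; rewrite invr_eq0; apply: cexp_neq0.
  + by move=> Q Qi Qj Qk; apply: P.
  move=> z; rewrite slash2M; [ | exact: SL2Z_Ti | exact: gS | exact: ff_off].
  by rewrite (slash2_ext _ (slash_Ti i j k)) slash2Z H mulrA.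
Qed.

Lemma tends_comp f (F : C -> C) c : tends f c -> ccont F c -> tends (fun z => F (f z)) (F c).
Proof.
move=> H Fc e /Fc[r r0 K]; have [|Y HY] := H (r / 2); first by lra.
by exists Y => w /HY h; rewrite -(subrKC c (f w)); apply: K; lra.
Qed.

Definition qq i z : C := cexp (Complex 0 pi * (i%:~R / n%:R) * z).

Lemma N_qq i z : cnorm (qq i z) = expR (- (pi * (i%:~R / n%:R) * complex.Im z)).
Proof.
rewrite N_cexp intC -(rmorph_nat (real_complex R)) -fmorphV -rmorphM /= !ReM ?ImM /=.
by congr expR; ring.
Qed.

(** Only [l2] contributes a power of q at infinity, namely [qq i]. The remaining exponent has a
    limit, so the factor [v] tends to the nonzero [u]. *)
Lemma ff_asym i j k : exists2 u : C, u != 0 & exists Y : R, 0 <= Y /\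
  forall z, Y < complex.Im z -> exists2 v, ff i j k z = v * qq i z & cnorm u / 2 <= cnorm v <= 2 * cnorm u.
Proof.
have [c Hc] := tends_l2 R.
have T : tends (fun z => (i%:~R * (l2 z - Complex 0 pi * z) + j%:~R * l4 z + k%:~R * l3 z) / n%:R)
    ((i%:~R * c + j%:~R * 0 + k%:~R * 0) / n%:R).
  move=> e e0; have T' := tendsZ (n%:R)^-1 (tendsD (tendsD (tendsZ i%:~R Hc) (tendsZ j%:~R (@tends_l4 R))) (tendsZ k%:~R (@tends_l3 R))).
  by have [Y HY] := T' e e0; exists Y => w /HY; rewrite -mulrBr -mulrBl mulrC.
have U := tends_comp T (hol_cont (hol_cexp _)).
set u := cexp _ in U; have u0 : u != 0 by exact: cexp_neq0.
exists u => //; have e0 : 0 < cnorm u / 2 by rewrite divr_gt0 // N_gt0.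
have [Y HY] := U _ e0; exists (Num.max 0 Y); split; first by rewrite le_max lexx.
move=> z; rewrite gt_max => /andP[z0 /HY]; set v := cexp _ => hv.
exists v; last first.
  have := N_lerB u v; have := N_lerB v u; rewrite (NBC u v); lra.
rewrite ffE // /v /qq -cexpD; congr cexp; rewrite /ffexp.
by field; exact: nC_neq0.
Qed.

Lemma qq_small i (e : R) : 0 < i -> 0 < e -> exists Y : R, forall z, Y < complex.Im z -> cnorm (qq i z) <= e.
Proof.
move=> i0 e0; have a0 : 0 < pi * (i%:~R / n%:R) :> R.
  by rewrite mulr_gt0 ?pi_gt0 // divr_gt0 ?ltr0z // nR_gt0.
exists (- ln e / (pi * (i%:~R / n%:R))) => z; rewrite ltr_pdivrMr // => h.
by rewrite N_qq -[leRHS]lnK ?posrE // ler_expR; lra.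
Qed.

Lemma ff_decay i j k (e : R) : 0 < i -> 0 < e ->
  exists Y : R, forall z, Y < complex.Im z -> cnorm (ff i j k z) < e.
Proof.
move=> i0 e0; have [u u0 [Y [Y0 HY]]] := ff_asym i j k.
have Nu : 0 < cnorm u by rewrite N_gt0.
have e1 : 0 < e / (4 * cnorm u) by rewrite divr_gt0 ?mulr_gt0.
have [Y' HY'] := qq_small i0 e1; exists (Num.max Y Y') => z.
rewrite gt_max => /andP[/HY[v -> /andP[_ v2]] /HY'].
rewrite ler_pdivlMr ?mulr_gt0 // (NM v (qq i z)) => h.
apply: le_lt_trans (ler_wpM2r (N_ge0 _) v2) _; lra.
Qed.

Section WithPhi.
Variable phi : 'M[int]_2 -> 'Z_n * 'Z_n.
Hypothesis phiP : fermat_hom phi.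

(** Integer exponents allow negatives, so that inverses and conjugates are again of this form. *)
Definition chi i j (x : 'Z_n * 'Z_n) : C := (ze ^ i) ^+ x.1 * (ze ^ j) ^+ x.2.

Lemma expZn (w : C) (x y : 'Z_n) : w ^+ n = 1 -> w ^+ (x + y)%R = w ^+ x * w ^+ y.
Proof.
move=> wn; have n1 : (1 < n)%N by apply: leq_trans n_gt2.
rewrite -exprD /= -(expr_mod (x + y)%N wn); congr (w ^+ _).
exact: (congr1 (modn (x + y)) (Zp_cast n1)).
Qed.

Lemma zetaz_n i : (ze ^ i) ^+ n = 1.
Proof. by rewrite exprnP exprzAC -exprnP zeta_n exp1rz. Qed.

Lemma chiD i j x y : chi i j (x + y) = chi i j x * chi i j y.
Proof. by rewrite /chi /= !(expZn _ _ (zetaz_n _)) mulrACA. Qed.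

Lemma chi0 i j : chi i j 0 = 1.
Proof. by rewrite /chi !expr0 mulr1. Qed.

Lemma zetaz_neq0 i : ze ^ i != 0. Proof. by rewrite expfz_neq0 // zeta_neq0. Qed.

Lemma chi_neq0 i j x : chi i j x != 0.
Proof. by rewrite mulf_neq0 // expf_neq0 // zetaz_neq0. Qed.

Lemma phi_1 : phi 1%:M = 0.
Proof.
have [pM _ _ _] := phiP; have := pM _ _ Gamma2_1 Gamma2_1; rewrite mulmx1.
by move/eqP; rewrite -[X in X == _]addr0 => /eqP/addrI <-.
Qed.

Lemma chi_A i j : chi i j (phi mxA) = ze ^ i.
Proof.
have [_ _ -> _] := phiP; rewrite /chi /= expr0 mulr1.
by have n1 : (1 < n)%N := leq_trans (isT : 1 < 2)%N (ltnW n_gt2); rewrite modn_small ?Zp_cast ?expr1.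
Qed.

Lemma chi_B i j : chi i j (phi mxB) = ze ^ j.
Proof.
have [_ _ _ ->] := phiP; rewrite /chi /= expr0 mul1r.
by have n1 : (1 < n)%N := leq_trans (isT : 1 < 2)%N (ltnW n_gt2); rewrite modn_small ?Zp_cast ?expr1.
Qed.

Lemma slash_Gamma2 i j f : off0 f -> slash2 mxA f =1 (fun z => ze ^ i * f z) ->
  slash2 mxB f =1 (fun z => ze ^ j * f z) ->
  forall g, Gamma2 g -> slash2 g f =1 (fun z => chi i j (phi g) * f z).
Proof.
move=> fo fA fB; have [pM pN _ _] := phiP.
have S_Ai : SL2Z mxAi by case: Gamma2_Ai.
have S_Bi : SL2Z mxBi by case: Gamma2_Bi.
have fAi : slash2 mxAi f =1 (fun z => (ze ^ i)^-1 * f z).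
  move=> z; apply: (mulfI (zetaz_neq0 i)); rewrite [RHS]mulrA mulfV ?zetaz_neq0 // mul1r -slash2Z.
  rewrite -(slash2_ext _ fA) -slash2M //; last exact: SL2Z_A.
  by rewrite -[mxAi]mulmx1 mxAAi slash2_1.
have fBi : slash2 mxBi f =1 (fun z => (ze ^ j)^-1 * f z).
  move=> z; apply: (mulfI (zetaz_neq0 j)); rewrite [RHS]mulrA mulfV ?zetaz_neq0 // mul1r -slash2Z.
  rewrite -(slash2_ext _ fB) -slash2M //; last exact: SL2Z_B.
  by rewrite -[mxBi]mulmx1 mxBBi slash2_1.
have pAi : phi mxAi = - phi mxA.
  apply/eqP; rewrite -addr_eq0 -pM; [ | exact: Gamma2_Ai | exact: Gamma2_A].
  by rewrite -[mxA]mulmx1 mxAiA phi_1.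
have pBi : phi mxBi = - phi mxB.
  apply/eqP; rewrite -addr_eq0 -pM; [ | exact: Gamma2_Bi | exact: Gamma2_B].
  by rewrite -[mxB]mulmx1 mxBiB phi_1.
have chiN x : chi i j (- x) = (chi i j x)^-1.
  by apply: (mulfI (chi_neq0 i j x)); rewrite -chiD subrr chi0 mulfV ?chi_neq0.
have step g0 c : Gamma2 g0 -> slash2 g0 f =1 (fun z => c * f z) -> chi i j (phi g0) = c ->
    forall g, Gamma2 g -> slash2 g f =1 (fun z => chi i j (phi g) * f z) ->
    slash2 (g0 *m g) f =1 (fun z => chi i j (phi (g0 *m g)) * f z).
  move=> G0 f0 c0 g gG IH z; rewrite pM // chiD c0.
  rewrite slash2M //; [ | by case: G0 | by case: gG].
  by rewrite (slash2_ext _ f0) slash2Z IH mulrA.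
apply: Gamma2_ind.
- by move=> z; rewrite phi_1 chi0 mul1r slash2_1.
- by apply: step fA _; [exact: Gamma2_A | exact: chi_A].
- by apply: step fAi _; [exact: Gamma2_Ai | rewrite pAi chiN chi_A].
- by apply: step fB _; [exact: Gamma2_B | exact: chi_B].
- by apply: step fBi _; [exact: Gamma2_Bi | rewrite pBi chiN chi_B].
- apply: (step _ 1); [exact: Gamma2_N1 | | by rewrite pN chi0].
  by move=> z; rewrite slash2_N slash2_1 mul1r.
Qed.

Lemma ff_Gamma2 i j k g : i + j + k = n -> Gamma2 g ->
  slash2 g (ff i j k) =1 (fun z => chi i j (phi g) * ff i j k z).
Proof.
by move=> E; apply: slash_Gamma2; [exact: ff_off | exact: slash_A | exact: slash_B].
Qed.

Lemma ff_cusp i j k : i + j + k = n -> 0 < i -> 0 < j -> 0 < k ->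
  cusp_form2 (Phi phi) (ff i j k).
Proof.
move=> E i0 j0 k0; split.
- exact: ff_off.
- by move=> z z0; apply/derivable_holP/hol_ff.
- by move=> g [gG g0] z; rewrite (ff_Gamma2 E gG) g0 chi0 mul1r.
- move=> g gS e e0; have [c [i' [j' [k' [c0 _ P H]]]]] := slash_perm gS E.
  have i'0 : 0 < i' by apply: (P (fun x => 0 < x)).
  have Nc : 0 < cnorm c by rewrite N_gt0.
  have e1 : 0 < e / cnorm c by rewrite divr_gt0.
  have [Y HY] := ff_decay j' k' i'0 e1; exists Y => z /HY h.
  by rewrite NE ltcR H (NM c (ff i' j' k' z)) mulrC -ltr_pdivlMr.
Qed.

(* When [f] is an eigenform, [f / ff i j k] is invariant under Gamma(2) and, because
   [i, j <= n], has limits at all cusps, so it is constant by the maximum principle. *)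
Section UpperBound.
Variables (gT : finGroupType) (pr : 'M[int]_2 -> gT).
Hypothesis prP : quotient_of_SL2Z (Phi phi) pr.
Variables (f : C -> C) (i j : int).
Hypothesis fcusp : cusp_form2 (Phi phi) f.
Hypothesis ij : (1 <= i <= n%:Z) /\ (1 <= j <= n%:Z).
Hypothesis fA : slash2 mxA f =1 (fun z => ze ^ i * f z).
Hypothesis fB : slash2 mxB f =1 (fun z => ze ^ j * f z).

Let k : int := n%:Z - i - j.
Let E : i + j + k = n. Proof. by rewrite /k; ring. Qed.
Let h z := f z / ff i j k z.

Let fo : off0 f. Proof. by case: fcusp. Qed.
Let fh z : uhp z -> hol f z. Proof. by case: fcusp => _ H _ _ /H/derivable_holP. Qed.

Let h_mob g z : SL2Z g -> uhp z -> h (mob g z) = slash2 g f z / slash2 g (ff i j k) z.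
Proof.
move=> gS z0; have d0 := den_neq0 gS z0; have f0 := @ff_neq0 i j k _ (uhp_mob gS z0).
by rewrite /h !slash2E; field; rewrite d0.
Qed.

Let h_Gamma2 g z : Gamma2 g -> uhp z -> h (mob g z) = h z.
Proof.
move=> gG z0; rewrite h_mob //; last by case: gG.
rewrite (slash_Gamma2 fo fA fB gG) (ff_Gamma2 E gG) /h.
by rewrite -mulf_div divff ?chi_neq0 // mul1r.
Qed.

Let hol_h z : uhp z -> hol h z.
Proof.
by move=> z0; apply: holM; [exact: fh | apply: holV; [exact: hol_ff | exact: ff_neq0]].
Qed.

Lemma mob_A z : mob mxA z = z + 2%:R :> C.
Proof. by rewrite /mob /den /mxA !mx22e mulr0z mulr1z mul0r add0r mul1r divr1. Qed.

Let h_per g z : SL2Z g -> uhp z -> h (mob g (z + 2%:R)) = h (mob g z).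
Proof.
move=> gS z0; rewrite -mob_A -(mob_M gS SL2Z_A z0).
have -> : g *m mxA = g *m mxA *m inv2 g *m g by rewrite -(mulmxA _ (inv2 g)) (inv2K gS) mulmx1.
have GG := Gamma2_conj gS Gamma2_A.
have [GS _] := GG; rewrite (mob_M GS gS z0).
by apply: h_Gamma2 => //; apply: uhp_mob.
Qed.

(** In the coordinate of width 2, [f] decays and f_ijk has the size of [qq i']. Because [i' <= n],
    the quotient times [ce w] tends to 0, which is the hypothesis of [cusp_limit]. *)
Let h_tends g : SL2Z g -> exists c, tends (fun z => h (mob g z)) c.
Proof.
move=> gS; have [c [i' [j' [k' [c0 e P H]]]]] := slash_perm gS E.
(* [k] is also at most [n], since [i] and [j] are at least 1. *)
have i'n : i' <= n%:Z.
  by apply: (P (fun x => x <= n%:Z)); move: ij; rewrite /k; lia.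
pose F w := h (mob g (2%:R * w)).
have uhp2 w : 0 < complex.Im w -> uhp (2%:R * w).
  by move=> w0; rewrite /upper_half_plane Im_2; lra.
have [|||d Hd] := @cusp_limit R F.
- by move=> z z0; rewrite /F mulrDr mulr1 h_per //; apply: uhp2.
- move=> z z0; apply: (hol_comp (g := fun z => h (mob g z))); first exact/holZ/hol_id.
  apply: (hol_comp (g := h)); first by apply: hol_mob => //; apply: uhp2.
  by apply: hol_h; apply: uhp_mob => //; apply: uhp2.
- move=> e0 e00; have [u u0 [Y [Y0 HY]]] := ff_asym i' j' k'.
  have Nu : 0 < cnorm u by rewrite N_gt0.
  have Nc : 0 < cnorm c by rewrite N_gt0.
  have e1 : 0 < e0 * cnorm c * (cnorm u / 2) by rewrite !mulr_gt0 ?invr_gt0.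
  have [_ _ _ fdec] := fcusp; have [Y' HY'] := fdec g gS _ e1.
  exists (Num.max Y (`|Y'|)) => w; rewrite gt_max => /andP[w1 w2].
  have w0 : 0 < complex.Im w by lra.
  have y1 : Y < complex.Im (2%:R * w) by rewrite Im_2; lra.
  have y2 : Y' < complex.Im (2%:R * w) by rewrite Im_2; have := ler_norm Y'; lra.
  have := HY' _ y2; rewrite NE ltcR => h1.
  have [v vE /andP[v1 _]] := HY _ y1.
  have v0 : 0 < cnorm v by lra.
  have v00 : v != 0 by rewrite -N_gt0.
  rewrite subr0 /F (h_mob gS (uhp2 _ w0)) H vE.
  have q0 : qq i' (2%:R * w) != 0 by exact: cexp_neq0.
  rewrite (_ : ce w * _ = slash2 g f (2%:R * w) / (c * v) * (ce w / qq i' (2%:R * w))); last first.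
    by field; rewrite c0 v00 q0.
  (* The modulus is the exponential of [- 2 pi (1 - i' / n)] times the height of [w]. *)
  have small : cnorm (ce w / qq i' (2%:R * w)) <= 1.
    rewrite (NM (ce w) (_^-1)) NV N_ce N_qq -expRN -expRD -[leRHS]expR0 ler_expR Im_2.
    have : i'%:~R / n%:R <= 1 :> R.
      by rewrite ler_pdivrMr ?nR_gt0 // mul1r -[n%:R]/(n%:Z%:~R) ler_int.
    have := mulr_gt0 (pi_gt0 R) w0; nra.
  rewrite (NM (_ / _) (_ / qq _ _)); apply: le_trans (_ : cnorm (slash2 g f (2%:R * w) / (c * v)) * 1 <= _).
    by rewrite ler_wpM2l ?N_ge0.
  rewrite mulr1 (NM (slash2 g f _) (_^-1)) NV (NM c v) ler_pdivrMr ?mulr_gt0 //.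
  apply: le_trans (ltW h1) _; rewrite [leRHS]mulrA ler_wpM2l //.
  by rewrite mulr_ge0 // ltW.
exists d => e0 /Hd[Y HY]; exists (2 * Y) => z hz.
have := HY (z / 2%:R); rewrite /F two_half; apply.
by rewrite Im_half; lra.
Qed.

Lemma pr_rep : exists rep : gT -> 'M[int]_2, forall x, SL2Z (rep x) /\ pr (rep x) = x.
Proof.
have [_ pS _] := prP.
have ex x : exists g, SL2Z g /\ pr g = x by have [g ? ?] := pS x; exists g.
by exists (fun x => projT1 (cid (ex x))) => x; exact: projT2 (cid (ex x)).
Qed.

Lemma pr_eq g g' : SL2Z g -> SL2Z g' -> pr g = pr g' -> Phi phi (g *m inv2 g').
Proof.
move=> gS gS' e; have [pM _ pK] := prP.
apply/pK; first exact: SL2ZM gS (SL2Z_inv gS').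
rewrite pM //; last exact: SL2Z_inv.
rewrite e -pM //; last exact: SL2Z_inv.
rewrite inv2Kr //; apply/pK; first exact: SL2Z1.
by split; [exact: Gamma2_1 | exact: phi_1].
Qed.

(** The finite family required by [modular_const] consists of one representative for each element of
    [gT]; elements with equal image differ by a factor in Gamma(2) on the left. *)
Lemma h_const : exists c, forall z, f z = c * ff i j k z.
Proof.
have [rep repP] := pr_rep.
have rS x : SL2Z (rep x) by case: (repP x).
pose c x := projT1 (cid (h_tends (rS x))).
have cP x : tends (fun z => h (mob (rep x) z)) (c x) := projT2 (cid (h_tends (rS x))).
have i0 : uhp ('i%C : C) by rewrite /upper_half_plane /= ltr01.
exists (h 'i%C) => z; have [z0|z0] := pselect (uhp z); last by rewrite fo // ff_off // mulr0.
rewrite -(@modular_const R gT h rep c rS _ hol_h cP _ z 'i%C z0 i0).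
- by rewrite /h divfK // ff_neq0.
- move=> g gS; exists (pr g) => w w0; have [_ e] := repP (pr g).
  have [GG _] := pr_eq gS (rS (pr g)) (esym e).
  have eg : g = g *m inv2 (rep (pr g)) *m rep (pr g).
    by rewrite -(mulmxA g) (inv2K (rS _)) mulmx1.
  have [GS _] := GG; rewrite {1}eg (mob_M GS (rS _) w0).
  by apply: h_Gamma2 => //; apply: uhp_mob.
- by move=> x w w0; apply: h_per.
Qed.

Lemma eigen_form : (0 < k /\ exists c, forall z, f z = c * ff i j k z) \/ (k <= 0 /\ forall z, f z = 0).
Proof.
have [c Hc] := h_const; have [k0|k0] := ltP 0 k; first by left; split=> //; exists c.
right; split=> // z.
suff c0 : c = 0 by rewrite Hc c0 mul0r.
have E' : i + k + j = n by rewrite addrAC.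
(* TS brings the exponent [k] to the first place. As [k <= 0], [ff k i j] does not decay at
   infinity, while the transform of the cusp form [f] does. *)
have sTS : slash2 (mxT *m mxS) f =1 (fun z => c * (wT i * (- 1 * ff k i j z))).
  move=> w; rewrite (slash2_ext _ Hc) slash2Z slash2M; [ | exact: SL2Z_T | exact: SL2Z_S | exact: ff_off].
  by rewrite (slash2_ext _ (slash_T i j k)) slash2Z slash_S.
apply/eqP; rewrite -N_eq0 eq_le N_ge0 andbT; apply/ler_addgt0Pl => e e0; rewrite addr0.
have [u u0 [Y [Y0 HY]]] := ff_asym k i j.
have Nu : 0 < cnorm u by rewrite N_gt0.
have w0 : 0 < cnorm (wT i) by rewrite N_gt0 cexp_neq0.
have e1 : 0 < e * (cnorm (wT i) * (cnorm u / 2)) by rewrite !mulr_gt0 ?invr_gt0.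
have [_ _ _ fdec] := fcusp; have [Y' HY'] := fdec _ (SL2ZM SL2Z_T SL2Z_S) _ e1.
pose w : C := Complex 0 (Num.max Y Y' + 1).
have [w1 w2] : Y < complex.Im w /\ Y' < complex.Im w.
  by rewrite /= !ltr_pwDr // le_max lexx ?orbT.
have := HY' _ w2; rewrite NE ltcR sTS (NM c _) (NM (wT i) _) mulN1r NN.
have [v -> /andP[v1 _]] := HY _ w1.
have q1 : 1 <= cnorm (qq k w).
  rewrite N_qq -[leLHS]expR0 ler_expR oppr_ge0 -mulrA mulr_ge0_le0 ?pi_ge0 //.
  rewrite mulr_le0_ge0 //; last by lra.
  by rewrite mulr_le0_ge0 ?lerz0 // invr_ge0 ltW // nR_gt0.
have vq : cnorm u / 2 <= cnorm (v * qq k w).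
  rewrite (NM v (qq k w)); apply: le_trans v1 _.
  by rewrite -[leLHS]mulr1 ler_wpM2l ?N_ge0.
have := ler_wpM2l (N_ge0 c) (ler_wpM2l (ltW w0) vq) => t1 t2.
have := le_lt_trans t1 t2; rewrite ltr_pM2r; last by rewrite mulr_gt0 // divr_gt0.
exact: ltW.
Qed.

End UpperBound.
End WithPhi.
End Forms.

(** * The space of cusp forms and its character *)

Section Space.
Variables (R : realType) (n : nat).
Hypothesis n_gt2 : (2 < n)%N.
Local Notation C := R[i].
Local Notation uhp := (@upper_half_plane R).
Local Notation ze := (@zeta R n).
Variable phi : 'M[int]_2 -> 'Z_n * 'Z_n.
Hypothesis phiP : fermat_hom phi.
Variables (gT : finGroupType) (pr : 'M[int]_2 -> gT).
Hypothesis prP : quotient_of_SL2Z (Phi phi) pr.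
Implicit Types (f : C -> C) (g : 'M[int]_2) (z w : C).
Local Notation V := (@cusp_form2 R (Phi phi)).
Local Notation T := ('Z_n * 'Z_n)%type.
Local Notation chi := (@chi R n).
Implicit Types (i j : int) (t : T).

Let n_gt1 : (1 < n)%N. Proof. exact: ltnW. Qed.

Fixpoint mxpow (g : 'M[int]_2) (k : nat) : 'M[int]_2 :=
  if k is k'.+1 then g *m mxpow g k' else 1%:M.

Lemma Gamma2_pow g k : Gamma2 g -> Gamma2 (mxpow g k).
Proof. by move=> gG; elim: k => [|k IH] /=; [exact: Gamma2_1 | exact: Gamma2M]. Qed.

Lemma phi_pow g k : Gamma2 g -> phi (mxpow g k) = phi g *+ k.
Proof.
move=> gG; have [pM _ _ _] := phiP; elim: k => [|k IH] /=; first by rewrite mulr0n (phi_1 phiP).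
by rewrite pM ?IH ?mulrS //; exact: Gamma2_pow.
Qed.

Definition gam (m k : nat) : 'M[int]_2 := mxpow mxA m *m mxpow mxB k.

Lemma Gamma2_gam m k : Gamma2 (gam m k).
Proof. by apply: Gamma2M; apply: Gamma2_pow; [exact: Gamma2_A | exact: Gamma2_B]. Qed.

Lemma phi_gam m k : phi (gam m k) = (m%:R, k%:R).
Proof.
have [pM _ pA pB] := phiP.
rewrite pM; [ | by apply: Gamma2_pow; exact: Gamma2_A | by apply: Gamma2_pow; exact: Gamma2_B].
rewrite (phi_pow _ Gamma2_A) (phi_pow _ Gamma2_B) pA pB.
have e (x : T) r : x *+ r = (x.1 *+ r, x.2 *+ r).
  by elim: r => [|r IH]; rewrite ?mulr0n // !mulrS IH; case: x {IH}.
rewrite !e /= !mul0rn; apply/eqP; rewrite xpair_eqE /=.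
by rewrite addr0 add0r !eqxx.
Qed.

(** A lift of [t] to Gamma(2): a section of [phi]. *)
Definition gamt (t : T) := gam t.1 t.2.

Lemma Gamma2_gamt t : Gamma2 (gamt t). Proof. exact: Gamma2_gam. Qed.

Lemma SL2Z_gamt t : SL2Z (gamt t). Proof. by case: (Gamma2_gamt t). Qed.

Lemma phi_gamt t : phi (gamt t) = t.
Proof. by rewrite phi_gam !natr_Zp; case: t. Qed.

Lemma V_off f : V f -> off0 f. Proof. by case. Qed.

Lemma V_inv f g g' : V f -> SL2Z g -> SL2Z g' -> pr g = pr g' -> slash2 g f =1 slash2 g' f.
Proof.
move=> fV gS gS' e z; have PK := pr_eq phiP prP gS gS' e.
have eg : g = g *m inv2 g' *m g' by rewrite -(mulmxA g) (inv2K gS') mulmx1.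
have KS : SL2Z (g *m inv2 g') := SL2ZM gS (SL2Z_inv gS').
rewrite eg (slash2M KS gS' (V_off fV)); apply: slash2_ext => w.
by have [_ _ H _] := fV; apply: H.
Qed.

Lemma pr_phi g g' : Gamma2 g -> Gamma2 g' -> phi g = phi g' -> pr g = pr g'.
Proof.
move=> gG gG' e; have gS : SL2Z g by case: gG.
have gS' : SL2Z g' by case: gG'.
have [pM _ pK] := prP; have [hM _ _ _] := phiP.
have iS := SL2Z_inv gS'.
have iG : Gamma2 (inv2 g').
  have := Gamma2_conj iS gG'; rewrite (inv2K gS') mul1mx.
  have -> : inv2 (inv2 g') = g' by rewrite /inv2 !mx22e !opprK [RHS]mx22E.
  move=> /Gamma2P[h1 h2]; move: gG' => /Gamma2P[_ [p1 p2 p3 p4]].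
  apply/Gamma2P; split=> //; rewrite /parity /inv2 !mx22e; split=> //; by rewrite rpredN.
have pI : phi g' + phi (inv2 g') = 0 by rewrite -(hM _ _ gG' iG) (inv2Kr gS') (phi_1 phiP).
have K : pr (g *m inv2 g') = 1%g.
  apply/(pK _ (SL2ZM gS iS)); split; first exact: Gamma2M.
  by rewrite (hM _ _ gG iG) e.
have : pr (g *m inv2 g' *m g') = pr g' by rewrite (pM _ _ (SL2ZM gS iS) gS') K mul1g.
by rewrite -(mulmxA g) (inv2K gS') mulmx1.
Qed.

Lemma V_phi f g g' : V f -> Gamma2 g -> Gamma2 g' -> phi g = phi g' -> slash2 g f =1 slash2 g' f.
Proof.
move=> fV gG gG' e; apply: V_inv => //; [by case: gG | by case: gG' | exact: pr_phi].
Qed.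

(** Invariance uses that the kernel of [pr] is normal: for [k] in it, [g *m k] and [g] have the same
    image, so [V_inv] applies. *)
Lemma V_slash f g : V f -> SL2Z g -> V (slash2 g f).
Proof.
move=> fV gS; have [fo fd fi fc] := fV; split.
- exact: slash2_off.
- by move=> z z0; apply/derivable_holP; apply: hol_slash2 => // w w0; apply/derivable_holP/fd.
- move=> k kP z; have kS : SL2Z k by case: kP => [[]].
  rewrite -(slash2M gS kS fo).
  apply: V_inv => //; first exact: SL2ZM.
  by have [pM _ pK] := prP; rewrite (pM _ _ gS kS) (proj2 (pK _ kS) kP) mulg1.
- move=> g' gS' e e0; have [Y HY] := fc _ (SL2ZM gS gS') e e0; exists Y => z /HY.
  by rewrite (slash2M gS gS' fo).
Qed.

Lemma V_ext f f' : f =1 f' -> V f -> V f'.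
Proof. by move=> /funext ->. Qed.

Lemma slash2D g f f' : slash2 g (fun z => f z + f' z) =1 (fun z => slash2 g f z + slash2 g f' z).
Proof. by move=> z; rewrite !slash2E mulrDl. Qed.

Lemma V_D f f' : V f -> V f' -> V (fun z => f z + f' z).
Proof.
move=> [fo fd fi fc] [fo' fd' fi' fc']; split.
- by move=> z z0; rewrite fo // fo' // addr0.
- move=> z z0; apply/derivable_holP/holD; apply/derivable_holP; [exact: fd | exact: fd'].
- by move=> k kP z; rewrite slash2D fi // fi'.
- move=> g gS e e0; have e2 : 0 < e / 2 by lra.
  have [Y HY] := fc _ gS _ e2; have [Y' HY'] := fc' _ gS _ e2.
  exists (Num.max Y Y') => z; rewrite gt_max => /andP[/HY + /HY'].
  by rewrite !NE !ltcR slash2D => h1 h2; apply: le_lt_trans (ND _ _) _; lra.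
Qed.

Lemma V_Z c f : V f -> V (fun z => c * f z).
Proof.
move=> [fo fd fi fc]; split.
- by move=> z z0; rewrite fo // mulr0.
- by move=> z z0; apply/derivable_holP/holZ/derivable_holP/fd.
- by move=> k kP z; rewrite slash2Z fi.
- move=> g gS e e0; have Nc := N_ge0 c.
  have e1 : 0 < e / (cnorm c + 1) by rewrite divr_gt0 //; lra.
  have [Y HY] := fc _ gS _ e1; exists Y => z /HY.
  rewrite !NE !ltcR slash2Z (NM c (slash2 g f z)) ltr_pdivlMr; last by lra.
  by have := N_ge0 (slash2 g f z); nra.
Qed.

Lemma V_0 : V (fun=> 0).
Proof.
split=> //.
- by move=> k kP z; rewrite slash2E mul0r.
- by move=> g gS e e0; exists 0 => z _; rewrite slash2E mul0r normr0 ltcR.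
Qed.

Lemma V_sum (I : finType) (F : I -> C -> C) : (forall x, V (F x)) -> V (fun z => \sum_x F x z).
Proof.
move=> H; rewrite -[index_enum I]/(index_enum I); elim: (index_enum I) => [|x s IH].
  by apply: V_ext V_0 => z; rewrite big_nil.
by apply: V_ext (V_D (H x) IH) => z; rewrite big_cons.
Qed.

Lemma slash2_sum (I : finType) g (F : I -> C -> C) :
  slash2 g (fun z => \sum_x F x z) =1 (fun z => \sum_x slash2 g (F x) z).
Proof. by move=> z; rewrite slash2E mulr_suml. Qed.

Lemma dvdz_small (m d : int) : (m %| d)%Z -> `|d| < `|m| -> d = 0.
Proof.
rewrite dvdzE => H h; apply/eqP; rewrite -absz_eq0.
by apply: contraTT h => d0; rewrite -leNgt lez_nat dvdn_leq // lt0n.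
Qed.

Lemma geom_root (w : C) : w ^+ n = 1 -> \sum_(i < n) w ^+ i = if w == 1 then n%:R else 0.
Proof.
move=> wn; case: eqP => [->|/eqP w1].
  by rewrite (eq_bigr (fun=> 1)) ?sumr_const ?card_ord // => i _; rewrite expr1n.
apply: (@mulfI _ (w - 1)); first by rewrite subr_eq0.
by rewrite -subrX1 wn subrr mulr0.
Qed.

Lemma sum_Zn (F : nat -> C) : \sum_(t : 'Z_n) F t = \sum_(i < n) F i.
Proof.
have e := Zp_cast n_gt1.
rewrite -(big_mkord xpredT F) -(big_mkord xpredT F); by rewrite e.
Qed.

Lemma zeta_pow_eq1 (i : int) : (ze ^ i == 1) = (n%:Z %| i)%Z.
Proof.
apply/idP/idP => [/eqP|/dvdzP[k ->]]; last by rewrite mulrC -exprz_exp -exprnP zeta_n // exp1rz.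
rewrite zetaz // => /cexp_eq1[k]; rewrite -[_ *~ k]mulrzr => H; have E := mulfI (twopii_neq0 R) H.
apply/dvdzP; exists k; apply: (@intr_inj C); rewrite intrM -[n%:Z%:~R]/(n%:R) -E divfK //.
exact: nC_neq0.
Qed.

Lemma chi_mul i j i' j' t : chi i j t * chi i' j' t = chi (i + i') (j + j') t.
Proof. by rewrite /chi !(expfzDr _ _ (zeta_neq0 R n)) !exprMn; ring. Qed.

Lemma chi_N i j t : chi i j (- t) = chi (- i) (- j) t.
Proof.
apply: (mulfI (chi_neq0 R i j t)).
rewrite -chiD // subrr chi0 chi_mul !subrr /chi !expr0z !expr1n mulr1 //.
Qed.

Lemma sum_chi i j : \sum_(t : T) chi i j t =
  if (n%:Z %| i)%Z && (n%:Z %| j)%Z then n%:R ^+ 2 else 0.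
Proof.
rewrite /chi -(pair_big xpredT xpredT (fun x y : 'Z_n => (ze ^ i) ^+ x * (ze ^ j) ^+ y)) /=.
under eq_bigr => x _ do rewrite -mulr_sumr.
rewrite -mulr_suml (sum_Zn (fun x => (ze ^ i) ^+ x)) (sum_Zn (fun x => (ze ^ j) ^+ x)).
rewrite !geom_root ?zetaz_n // !zeta_pow_eq1.
by case: ifP; case: ifP; rewrite ?mulr0 ?mul0r // expr2.
Qed.

(** Characters are represented by exponents 1..n instead of 0..n-1, the range on which [eigen_form]
    works. *)
Lemma sum_chi_dual t : \sum_(x : 'I_n * 'I_n) chi x.1.+1 x.2.+1 t =
  if t == 0 then n%:R ^+ 2 else 0.
Proof.
have key (y : 'Z_n) : \sum_(i < n) (ze ^ i.+1) ^+ y = if y == 0 then n%:R else 0.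
  have e (i : 'I_n) : (ze ^ i.+1) ^+ y = ze ^+ y * (ze ^+ y) ^+ i.
    by rewrite -exprnP -!exprM -exprD; congr (_ ^+ _); ring.
  rewrite (eq_bigr _ (fun l _ => e l)) -mulr_sumr geom_root; last first.
    by rewrite -exprM mulnC exprM zeta_n // expr1n.
  have -> : (ze ^+ y == 1) = (y == 0).
    rewrite exprnP zeta_pow_eq1 dvdzE /=; have yn : (y < n)%N.
      by rewrite -[X in (_ < X)%N](Zp_cast n_gt1) ltn_ord.
    apply/idP/eqP => [/dvdn_leq H|->]; last by rewrite dvdn0.
    apply: val_inj => /=; case: (posnP y) => // /H; by rewrite leqNgt yn.
  by case: eqP => [->|_]; rewrite ?expr0 ?mul1r ?mulr0.
rewrite -(pair_big xpredT xpredT (fun x y : 'I_n => chi x.+1 y.+1 t)) /= /chi.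
under eq_bigr => x _ do rewrite -mulr_sumr.
rewrite -mulr_suml !key; case: t => x y /=; rewrite xpair_eqE.
by case: (x == 0); case: (y == 0); rewrite ?mulr0 ?mul0r // expr2.
Qed.

(** The stored pair is (i - 1, j - 1), so the condition reads i + j < n. *)
Definition idx := {x : 'I_n * 'I_n | (x.1 + x.2 + 2 < n)%N}.

Definition ii (x : idx) : int := (val x).1.+1.
Definition jj (x : idx) : int := (val x).2.+1.
Definition kk (x : idx) : int := n%:Z - ii x - jj x.

Lemma ijk_sum x : ii x + jj x + kk x = n. Proof. by rewrite /kk; ring. Qed.

Lemma ijk_gt0 x : [/\ 0 < ii x, 0 < jj x & 0 < kk x].
Proof. by split=> //; rewrite /kk /ii /jj; have := valP x; lia. Qed.

Definition bas (x : idx) : C -> C := @ff R n (ii x) (jj x) (kk x).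

Lemma bas_V x : V (bas x).
Proof. by have [i0 j0 k0] := ijk_gt0 x; apply: ff_cusp => //; exact: ijk_sum. Qed.

Definition chix (x : idx) := chi (ii x) (jj x).

Lemma bas_Gamma2 x g : Gamma2 g -> slash2 g (bas x) =1 (fun z => chix x (phi g) * bas x z).
Proof. by move=> gG; apply: ff_Gamma2 => //; exact: ijk_sum. Qed.

Lemma bas_neq0 x z : uhp z -> bas x z != 0. Proof. exact: ff_neq0. Qed.

Lemma uhp_i : uhp ('i%C : C). Proof. by rewrite /upper_half_plane /= ltr01. Qed.

(* The coordinate of [f] on [bas x]: project [f] on the eigenspace of [chix x],
   then compare values at the point ['i]. *)
Definition cd f (x : idx) : C :=
  (\sum_(t : T) chix x (- t) * slash2 (gamt t) f 'i%C) / (n%:R ^+ 2 * bas x 'i%C).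

Lemma cd_ext f f' : f =1 f' -> cd f =1 cd f'.
Proof. by move=> /funext ->. Qed.

Lemma cdZ c f x : cd (fun z => c * f z) x = c * cd f x.
Proof.
rewrite /cd mulrA mulr_sumr; congr (_ / _); apply: eq_bigr => t _.
by rewrite slash2Z; ring.
Qed.

Lemma chix_orth x y : \sum_(t : T) chix x (- t) * chix y t = if x == y then n%:R ^+ 2 else 0.
Proof.
under eq_bigr => t _ do rewrite /chix chi_N chi_mul.
rewrite sum_chi; congr (if _ then _ else _).
have [hx hy] := (valP x, valP y).
apply/andP/eqP => [[/dvdz_small P /dvdz_small Q]|->]; last by rewrite !addNr.
apply: val_inj; move: P Q hx hy; rewrite /ii /jj.
case: (val x) => [[a ha] [b hb]]; case: (val y) => [[a' ha'] [b' hb']] /= P Q hx hy.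
have {}P := P ltac:(lia); have {}Q := Q ltac:(lia).
by congr (_, _); apply: val_inj => /=; lia.
Qed.

Lemma cd_sum (c : idx -> C) x : cd (fun z => \sum_y c y * bas y z) x = c x.
Proof.
rewrite /cd.
under eq_bigr => t _.
  rewrite slash2_sum mulr_sumr.
  under eq_bigr => y _ do rewrite slash2Z (bas_Gamma2 y (Gamma2_gamt t)) phi_gamt.
  over.
rewrite exchange_big /= (bigD1 x) //= [X in _ + X]big1 ?addr0 => [|y yx]; last first.
  rewrite (eq_bigr (fun t => c y * bas y 'i%C * (chix x (- t) * chix y t))); last by move=> t _; ring.
  by rewrite -mulr_sumr chix_orth eq_sym (negbTE yx) mulr0.
rewrite (eq_bigr (fun t => c x * bas x 'i%C * (chix x (- t) * chix x t))); last by move=> t _; ring.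
rewrite -mulr_sumr chix_orth eqxx.
by field; rewrite nC_neq0 // bas_neq0 //; exact: uhp_i.
Qed.

Lemma cd_bas x y : cd (bas y) x = (x == y)%:R.
Proof.
rewrite -(cd_sum (fun u => (u == y)%:R) x); apply: cd_ext => z.
by rewrite (bigD1 y) //= eqxx mul1r big1 ?addr0 // => u /negbTE ->; rewrite mul0r.
Qed.

(** [f] is the sum of its projections [F p] on the eigenspaces of the translations. By [eigen_form]
    each projection is a multiple of a basis form or, outside [idx], zero. *)
Lemma span f : V f -> forall z, f z = \sum_x cd f x * bas x z.
Proof.
move=> fV; suff [c Hc] : exists c : idx -> C, forall z, f z = \sum_x c x * bas x z.
  move=> z; rewrite {1}Hc; apply: eq_bigr => x _; congr (_ * _).
  by rewrite (cd_ext Hc) cd_sum.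
pose F (p : 'I_n * 'I_n) z := (n%:R ^+ 2)^-1 * \sum_(t : T) chi p.1.+1 p.2.+1 (- t) * slash2 (gamt t) f z.
have FV p : V (F p).
  by apply/V_Z/V_sum => t; apply/V_Z/V_slash => //; exact: SL2Z_gamt.
have slashF p g : Gamma2 g -> slash2 g (F p) =1 (fun z => chi p.1.+1 p.2.+1 (phi g) * F p z).
  move=> gG z; have gS : SL2Z g by case: gG.
  rewrite /F slash2Z slash2_sum mulrCA; congr (_ * _); rewrite mulr_sumr.
  rewrite [RHS](reindex_inj (addIr (phi g))) /=; apply: eq_bigr => t _.
  rewrite slash2Z [RHS]mulrA; congr (_ * _).
    by rewrite -chiD // opprD addrCA addrN addr0.
  rewrite -(slash2M (SL2Z_gamt t) gS (V_off fV)).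
  have [pM _ _ _] := phiP.
  apply: V_phi => //; [exact: Gamma2M (Gamma2_gamt t) gG | exact: Gamma2_gamt |].
  by rewrite (pM _ _ (Gamma2_gamt t) gG) !phi_gamt.
have fF z : f z = \sum_p F p z.
  rewrite /F -mulr_sumr exchange_big /=.
  under eq_bigr => t _ do rewrite -mulr_suml sum_chi_dual.
  rewrite (bigD1 (0 : T)) //= [X in _ + X]big1 ?addr0 => [|t t0]; last first.
    by rewrite oppr_eq0 (negbTE t0) mul0r.
  rewrite oppr0 eqxx mulrA mulVf ?expf_neq0 ?nC_neq0 // mul1r.
  rewrite (V_phi fV (Gamma2_gamt 0) Gamma2_1) ?slash2_1 //.
  by rewrite phi_gamt (phi_1 phiP).
have ex p : exists c : C, forall z, F p z =
    if (p.1 + p.2 + 2 < n)%N then c * @ff R n p.1.+1 p.2.+1 (n%:Z - p.1.+1%:Z - p.2.+1%:Z) z else 0.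
  have fA : slash2 mxA (F p) =1 (fun z => ze ^ p.1.+1 * F p z).
    by move=> z; rewrite (slashF p _ Gamma2_A) (chi_A R n_gt2 phiP).
  have fB : slash2 mxB (F p) =1 (fun z => ze ^ p.2.+1 * F p z).
    by move=> z; rewrite (slashF p _ Gamma2_B) (chi_B R n_gt2 phiP).
  have bounds : (1 <= p.1.+1%:Z <= n%:Z) /\ (1 <= p.2.+1%:Z <= n%:Z).
    by have := ltn_ord p.1; have := ltn_ord p.2; lia.
  have [[k0 [c Hc]]|[k0 H0]] := eigen_form n_gt2 phiP prP (FV p) bounds fA fB.
    by exists c => z; rewrite Hc ifT //; move: k0; lia.
  by exists 0 => z; rewrite H0 ifF //; move: k0; lia.
have [c cP] := choice ex.
exists (fun x => c (val x)) => z; rewrite fF.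
rewrite (bigID (fun p : 'I_n * 'I_n => (p.1 + p.2 + 2 < n)%N)) /= [X in _ + X]big1 ?addr0; last first.
  by move=> p /negbTE h; rewrite cP h.
pose FF (p : 'I_n * 'I_n) := c p * @ff R n p.1.+1 p.2.+1 (n%:Z - p.1.+1%:Z - p.2.+1%:Z) z.
rewrite (eq_bigr FF); last by move=> p h; rewrite cP h.
rewrite (reindex_omap (val : idx -> _) insub) => [|p h]; last by rewrite insubT.
by apply: eq_big => [x|//]; rewrite valK eqxx andbT (valP x).
Qed.

Definition rep : gT -> 'M[int]_2 := projT1 (cid (pr_rep prP)).
Lemma repP x : SL2Z (rep x) /\ pr (rep x) = x.
Proof. exact: (projT2 (cid (pr_rep prP)) x). Qed.

Definition psi (x : gT) : C := \sum_y cd (slash2 (rep x) (bas y)) y.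

Lemma psi_pr g : SL2Z g -> psi (pr g) = \sum_y cd (slash2 g (bas y)) y.
Proof.
move=> gS; apply: eq_bigr => y _; apply: cd_ext.
have [rS e] := repP (pr g); exact: V_inv (bas_V y) rS gS e.
Qed.

Lemma psi_character : canonical_character (Phi phi) pr psi.
Proof.
move=> g gS; pose b (l : 'I_#|{: idx}|) := bas (enum_val l).
exists #|{: idx}|, b, (\matrix_(l, k) cd (slash2 g (b l)) (enum_val k)).
have sumE (F : idx -> C) : \sum_x F x = \sum_(l < #|{: idx}|) F (enum_val l).
  by rewrite (reindex _ (onW_bij _ (enum_val_bij idx))).
split.
- by move=> l; exact: bas_V.
- move=> f fV; exists (\row_l cd f (enum_val l)); split.
    move=> z; rewrite {1}(span fV) sumE; apply: eq_bigr => l _; by rewrite mxE.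
  move=> c Hc; apply/rowP => l; rewrite mxE.
  pose d x := c 0 (enum_rank x).
  rewrite (cd_ext (f' := fun z => \sum_x d x * bas x z)) ?cd_sum /d ?enum_valK // => z.
  by rewrite Hc sumE; apply: eq_bigr => k _; rewrite /d enum_valK.
- move=> l z; rewrite {1}(span (V_slash (bas_V _) gS)) sumE.
  by apply: eq_bigr => k _; rewrite mxE.
- rewrite psi_pr // sumE; apply: eq_bigr => l _; by rewrite mxE.
Qed.

(** The coordinate matrices [M] are multiplicative, so this is the symmetry of the trace of a
    product. *)
Lemma psi_conj (x y : gT) : psi (x ^ y)%g = psi x.
Proof.
pose M g : idx -> idx -> C := fun x y => cd (slash2 g (bas x)) y.
have MM g h : SL2Z g -> SL2Z h -> forall x y, M (g *m h) x y = \sum_u M g x u * M h u y.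
  move=> gS hS u v; rewrite /M -(cd_sum (fun v => \sum_w cd (slash2 g (bas u)) w * cd (slash2 h (bas w)) v) v).
  apply: cd_ext => z; rewrite (slash2M gS hS (V_off (bas_V u))).
  rewrite (slash2_ext _ (span (V_slash (bas_V u) gS))) slash2_sum.
  under [RHS]eq_bigr => w _ do rewrite mulr_suml.
  rewrite exchange_big /=; apply: eq_bigr => w _; rewrite slash2Z (span (V_slash (bas_V w) hS)).
  by rewrite mulr_sumr; apply: eq_bigr => v' _; rewrite mulrA.
have [pM pS _] := prP.
have [g gS <-] := pS x; have [h hS <-] := pS y.
have [k kS kE] := pS ((pr h)^-1)%g.
have -> : (pr g ^ pr h)%g = pr (k *m (g *m h)).
  by rewrite (pM _ _ kS (SL2ZM gS hS)) (pM _ _ gS hS) kE conjgE.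
have e : pr g = pr (g *m h *m k).
  by rewrite (pM _ _ (SL2ZM gS hS) kS) (pM _ _ gS hS) kE mulgK.
rewrite e !psi_pr; [ | exact: SL2ZM (SL2ZM gS hS) kS | exact: SL2ZM kS (SL2ZM gS hS)].
rewrite -/(M _) (eq_bigr _ (fun y _ => MM _ _ kS (SL2ZM gS hS) y y)).
rewrite [RHS](eq_bigr _ (fun y _ => MM _ _ (SL2ZM gS hS) kS y y)).
by rewrite exchange_big /=; apply: eq_bigr => u _; apply: eq_bigr => v _; rewrite mulrC.
Qed.

Lemma psi_gamt t g : SL2Z g ->
  psi (pr (gamt t) * pr g)%g = \sum_y chix y t * cd (slash2 g (bas y)) y.
Proof.
move=> gS; have [pM _ _] := prP.
rewrite -(pM _ _ (SL2Z_gamt t) gS) psi_pr; last exact: SL2ZM (SL2Z_gamt t) gS.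
apply: eq_bigr => y _; rewrite -cdZ; apply: cd_ext => z.
rewrite (slash2M (SL2Z_gamt t) gS (V_off (bas_V y))).
by rewrite (slash2_ext _ (bas_Gamma2 y (Gamma2_gamt t))) slash2Z phi_gamt.
Qed.

Lemma psi_tau t : psi (pr (gamt t)) = \sum_y chix y t.
Proof.
have [pM _ pK] := prP.
have p1 : pr 1%:M = 1%g by apply/(pK _ SL2Z1); split; [exact: Gamma2_1 | exact: (phi_1 phiP)].
have := psi_gamt t SL2Z1; rewrite p1 mulg1 => ->; apply: eq_bigr => y _.
by rewrite (cd_ext (@slash2_1 R (bas y))) cd_bas eqxx mulr1.
Qed.

(** S exchanges i and j up to the sign -1, so only the basis forms with i = j contribute to the
    trace. *)
Lemma psi_tau_s t : psi (pr (gamt t) * pr mxS)%g = - \sum_(y | (val y).1 == (val y).2) chix y t.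
Proof.
rewrite (psi_gamt t SL2Z_S) -sumrN [RHS]big_mkcond; apply: eq_bigr => y _.
have sw : ((val y).2 + (val y).1 + 2 < n)%N by rewrite [((val y).2 + _)%N]addnC; exact: (valP y).
pose y' : idx := exist (fun x : 'I_n * 'I_n => (x.1 + x.2 + 2 < n)%N) ((val y).2, (val y).1) sw.
have E : slash2 mxS (bas y) =1 (fun z => - 1 * bas y' z).
  move=> z; rewrite (slash_S n_gt2 (ijk_sum y)) /bas.
  have -> : kk y' = kk y by rewrite /kk /ii /jj /=; ring.
  by [].
rewrite (cd_ext E) cdZ cd_bas.
have -> : (y == y') = ((val y).1 == (val y).2).
  rewrite -val_eqE /=; case: (val y) => u v /=; rewrite xpair_eqE eq_sym.
  by rewrite [v == u]eq_sym andbb.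
by case: eqP => _; rewrite ?mulr0 // mulr1 mulrN1.
Qed.

(** The exponent i lies strictly between 0 and n, so the character is nontrivial. *)
Lemma sum_chix y : \sum_(t : T) chix y t = 0.
Proof.
rewrite sum_chi ifF //; apply/negP => /andP[/dvdz_small H _].
have [y0 _ _] := ijk_gt0 y; have := valP y; rewrite /ii in y0 H * => h.
by have {}H := H ltac:(lia); lia.
Qed.

End Space.

(** * Multiplicities *)

Section ClassFunctionSums.
Variables (R : realType) (gT : finGroupType).
Implicit Types (psi f xi : gT -> R[i]).

(** Frobenius reciprocity: since [psi] is a class function, each of the [#|gT|] conjugations in the
    induced character contributes the same sum. *)
Lemma multiplicity_ind psi (H : {set gT}) xi : (forall x y, psi (x ^ y)%g = psi x) ->
  multiplicity psi (ind_char H xi) = (#|H|%:R)^-1 * \sum_x psi x * (xi x)^*%C.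
Proof.
move=> psiJ; have G0 : (#|gT|%:R : R[i]) != 0.
  by rewrite pnatr_eq0 -lt0n; apply/card_gt0P; exists 1%g.
rewrite /multiplicity /ind_char.
have e x : psi x * (((#|H|%:R)^-1 * \sum_y xi (x ^ y)%g)^*)%C
    = (#|H|%:R)^-1 * \sum_y psi (x ^ y)%g * (xi (x ^ y)%g)^*%C.
  rewrite rmorphM fmorphV rmorph_nat rmorph_sum mulrCA; congr (_ * _).
  by rewrite mulr_sumr; apply: eq_bigr => y _; rewrite psiJ.
rewrite (eq_bigr _ (fun x _ => e x)) -mulr_sumr exchange_big /= mulrCA; congr (_ * _).
have e' y : \sum_x psi (x ^ y)%g * (xi (x ^ y)%g)^*%C = \sum_x psi x * (xi x)^*%C.
  by rewrite [RHS](reindex_inj (@conjg_inj _ y)).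
rewrite (eq_bigr _ (fun y _ => e' y)) sumr_const.
by rewrite -(mulr_natl (\sum_x psi x * (xi x)^*%C)); apply: mulKf.
Qed.

End ClassFunctionSums.

Section Multiplicities.
Variables (R : realType) (n : nat).
Hypothesis n_gt2 : (2 < n)%N.
Local Notation C := R[i].
Variable phi : 'M[int]_2 -> 'Z_n * 'Z_n.
Hypothesis phiP : fermat_hom phi.
Variables (gT : finGroupType) (pr : 'M[int]_2 -> gT).
Hypothesis prP : quotient_of_SL2Z (Phi phi) pr.
Local Notation T := ('Z_n * 'Z_n)%type.
Local Notation chi := (@chi R n).
Local Notation psi := (psi R prP).
Local Notation ze := (@zeta R n).
Implicit Types (t : T).

Let n_gt1 : (1 < n)%N. Proof. exact: ltnW. Qed.
Let a := pr mxA.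
Let b := pr mxB.
Let s := pr mxS.
Definition tau t : gT := pr (gamt t).

Lemma pr_1 : pr 1%:M = 1%g.
Proof.
by have [_ _ pK] := prP; apply/(pK _ SL2Z1); split; [exact: Gamma2_1 | exact: (phi_1 phiP)].
Qed.

Lemma pr_pow g k : Gamma2 g -> pr (mxpow g k) = (pr g ^+ k)%g.
Proof.
move=> gG; have [pM _ _] := prP; elim: k => [|k IH] /=; first by rewrite pr_1.
by rewrite pM ?IH ?expgS //; [case: gG | case: (Gamma2_pow k gG)].
Qed.

Lemma pr_gam m k : pr (gam m k) = (a ^+ m * b ^+ k)%g.
Proof.
have [pM _ _] := prP; have GA := Gamma2_pow m Gamma2_A; have GB := Gamma2_pow k Gamma2_B.
by rewrite pM ?(pr_pow _ Gamma2_A) ?(pr_pow _ Gamma2_B) //; [case: GA | case: GB].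
Qed.

Lemma tauE t : tau t = (a ^+ t.1 * b ^+ t.2)%g. Proof. exact: pr_gam. Qed.

Lemma tau_nat m k : (a ^+ m * b ^+ k)%g = tau (m%:R, k%:R).
Proof.
rewrite -pr_gam; apply: (pr_phi phiP prP (Gamma2_gam m k) (Gamma2_gamt _)).
by rewrite (phi_gamt phiP) (phi_gam phiP).
Qed.

Lemma tauD t t' : tau (t + t') = (tau t * tau t')%g.
Proof.
have [pM _ _] := prP; have [hM _ _ _] := phiP.
rewrite -(pM _ _ (SL2Z_gamt t) (SL2Z_gamt t')).
apply: (pr_phi phiP prP (Gamma2_gamt _) (Gamma2M (Gamma2_gamt t) (Gamma2_gamt t'))).
by rewrite (hM _ _ (Gamma2_gamt t) (Gamma2_gamt t')) !(phi_gamt phiP).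
Qed.

Lemma tau0 : tau 0 = 1%g. Proof. by rewrite tauE !expg0 mulg1. Qed.

Lemma tau_inj : injective tau.
Proof.
move=> t t' e; have [hM _ _ _] := phiP.
have [KG K0] := pr_eq phiP prP (SL2Z_gamt t) (SL2Z_gamt t') e.
have := hM _ _ KG (Gamma2_gamt t').
rewrite K0 add0r -mulmxA (inv2K (SL2Z_gamt t')) mulmx1.
by rewrite !(phi_gamt phiP).
Qed.

Lemma transl_tau : transl a b = [set tau t | t : T].
Proof.
have gs : group_set [set tau t | t : T].
  apply/group_setP; split; first by apply/imsetP; exists 0; rewrite ?tau0.
  move=> _ _ /imsetP[t _ ->] /imsetP[t' _ ->]; rewrite -tauD; exact: imset_f.
apply/eqP; rewrite finset.eqEsubset; apply/andP; split.
  rewrite -[[set tau _ | _ in _]]/(gval (Group gs)) gen_subG.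
  apply/fintype.subsetP => x; rewrite !inE => /orP[]/eqP->; apply/imsetP.
    by exists (1%:R, 0%:R) => //; rewrite -tau_nat expg1 mulg1.
  by exists (0%:R, 1%:R) => //; rewrite -tau_nat expg1 mul1g.
apply/fintype.subsetP => _ /imsetP[t _ ->]; rewrite tauE.
by rewrite groupM // groupX // mem_gen // !inE eqxx ?orbT.
Qed.

Lemma tau_transl t : tau t \in transl a b.
Proof. by rewrite transl_tau imset_f. Qed.

Lemma card_T : #|{: T}| = (n ^ 2)%N.
Proof. by rewrite card_prod !card_ord Zp_cast. Qed.

Lemma card_transl : #|transl a b| = (n ^ 2)%N.
Proof. by rewrite transl_tau (card_imset _ tau_inj) -card_T; apply: eq_card. Qed.

Lemma natr_ltn (m : 'I_n) : (m%:R : 'Z_n) = m :> nat.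
Proof. by rewrite val_Zp_nat // modn_small. Qed.

Lemma ord_Zp (x : 'Z_n) : exists m : 'I_n, m%:R = x.
Proof.
have xn : (x < n)%N by rewrite -[X in (_ < X)%N](Zp_cast n_gt1) ltn_ord.
by exists (Ordinal xn); rewrite /= natr_Zp.
Qed.

Lemma chi_nat (al be : nat) (m k : 'I_n) : ze ^+ (al * m + be * k) = chi al be (m%:R, k%:R).
Proof. by rewrite /chi /= !natr_ltn -!exprnP -!exprM -exprD. Qed.

Lemma chi_ab_tau (al be : nat) t : chi_ab R n a b al be (tau t) = chi al be t.
Proof.
rewrite /chi_ab; case: pickP => [[m k] /=|H].
  by rewrite tau_nat => /eqP/tau_inj ->; rewrite chi_nat.
case: t H => x y H; have [m mE] := ord_Zp x; have [k kE] := ord_Zp y.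
by have := H (m, k); rewrite /= tau_nat mE kE eqxx.
Qed.

Lemma chi_ab_off (al be : nat) x : x \notin transl a b -> chi_ab R n a b al be x = 0.
Proof.
rewrite /chi_ab; case: pickP => [[m k] /= /eqP->|//].
by rewrite tau_nat tau_transl.
Qed.

Lemma zeta_conj (w : C) : w * w^*%C = 1 -> forall k : int, (w ^ k)^*%C = w ^ (- k).
Proof.
move=> w1; have w0 : w != 0 by apply: contra_eq_neq w1 => ->; rewrite mul0r eq_sym oner_eq0.
have wc : w^*%C = w^-1 by apply: (mulfI w0); rewrite w1 mulfV.
move=> k; rewrite -exprz_inv -wc; case: k => m; rewrite /exprz.
  by rewrite rmorphXn.
by rewrite fmorphV rmorphXn.
Qed.

Lemma conj_chi (i j : int) t : (chi i j t)^*%C = chi i j (- t).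
Proof.
have z1 : ze * ze^*%C = 1.
  rewrite /zeta; simpc; have := cos2Dsin2 (2 * pi / n%:R : R); rewrite !expr2 => e.
  by apply/eqP; rewrite eq_complex /=; apply/andP; split; apply/eqP; nra.
by rewrite (chi_N R n_gt2) /chi rmorphM !rmorphXn /= !(zeta_conj z1).
Qed.

Lemma sum_chix_chi (y : idx n) (al be : nat) : (1 <= al <= n - 1)%N -> (1 <= be <= n - 1)%N ->
  \sum_t chix R y t * chi al be (- t) =
  if (al == (val y).1.+1) && (be == (val y).2.+1) then n%:R ^+ 2 else 0.
Proof.
move=> al1 be1.
under eq_bigr => t _ do rewrite (chi_N R n_gt2) chi_mul.
rewrite (sum_chi R n_gt2); congr (if _ then _ else _).
have h1 := ltn_ord (val y).1; have h2 := ltn_ord (val y).2; rewrite /ii /jj.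
by apply/andP/andP => [[/dvdz_small P /dvdz_small Q]|[/eqP-> /eqP->]];
  [have {}P := P ltac:(lia); have {}Q := Q ltac:(lia); split; apply/eqP; lia | rewrite !subrr].
Qed.

(** At most one index matches, and it exists exactly when al + be < n. The predicate [P] allows the
    restriction to i = j in the trace of a translation times S. *)
Lemma sum_idx (c : C) (al be : nat) (P : pred (idx n)) : (1 <= al <= n - 1)%N -> (1 <= be <= n - 1)%N ->
  (forall y : idx n, al = (val y).1.+1 -> be = (val y).2.+1 -> P y) ->
  \sum_(y : idx n | P y) (if (al == (val y).1.+1) && (be == (val y).2.+1) then c else 0) =
  if (al + be < n)%N then c else 0.
Proof.
move=> al1 be1 HP; case: ifP => h.
  have h1 : (al.-1 < n)%N by lia.
  have h2 : (be.-1 < n)%N by lia.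
  have h3 : (al.-1 + be.-1 + 2 < n)%N by lia.
  pose y : idx n := exist (fun x : 'I_n * 'I_n => (x.1 + x.2 + 2 < n)%N) (Ordinal h1, Ordinal h2) h3.
  have e1 : al = (val y).1.+1 by rewrite /=; lia.
  have e2 : be = (val y).2.+1 by rewrite /=; lia.
  rewrite (bigD1 y) ?HP //= -e1 -e2 !eqxx big1 ?addr0 // => z /andP[_ zy].
  rewrite ifF //; apply/negP => /andP[/eqP f1 /eqP f2]; case/negP: zy; apply/eqP/val_inj.
  by rewrite [LHS]surjective_pairing; congr (_, _); apply: val_inj => /=; lia.
rewrite big1 // => y _; rewrite ifF //; apply/negP => /andP[/eqP f1 /eqP f2].
have hy : ((val y).1 + (val y).2 + 2 < n)%N := valP y; rewrite f1 f2 in h.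
by have {}h : ((val y).1.+1 + (val y).2.+1 < n)%N = false := h; lia.
Qed.

Lemma sum_psi_tau (al be : nat) : (1 <= al <= n - 1)%N -> (1 <= be <= n - 1)%N ->
  \sum_t psi (tau t) * chi al be (- t) = if (al + be < n)%N then n%:R ^+ 2 else 0.
Proof.
move=> al1 be1; rewrite -(@sum_idx _ al be xpredT) //.
under eq_bigr => t _ do rewrite (psi_tau R n_gt2 phiP prP) mulr_suml.
by rewrite exchange_big; apply: eq_bigr => y _; rewrite sum_chix_chi.
Qed.

Lemma sum_psi_tau_s (al : nat) : (1 <= al <= n - 1)%N ->
  \sum_t psi (tau t * s)%g * chi al al (- t) = if (al + al < n)%N then - n%:R ^+ 2 else 0.
Proof.
move=> al1; rewrite -(@sum_idx _ al al (fun y => (val y).1 == (val y).2)) //; last first.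
  by move=> y e; rewrite {1}e => -[e']; apply/eqP/val_inj.
under eq_bigr => t _ do rewrite (psi_tau_s R n_gt2 phiP prP) mulNr mulr_suml.
rewrite sumrN exchange_big -sumrN; apply: eq_bigr => y _; rewrite sum_chix_chi //.
by case: ifP => _; rewrite ?oppr0.
Qed.

Let psiJ : forall x y, psi (x ^ y)%g = psi x := psi_conj R n_gt2 phiP prP.

Let n2_neq0 : (n%:R ^+ 2 : C) != 0.
Proof. by rewrite expf_neq0 // (nC_neq0 R n_gt2). Qed.

Lemma mult_rho_ab (al be : nat) : (1 <= al <= n - 1)%N -> (1 <= be <= n - 1)%N ->
  multiplicity psi (rho_ab R n a b al be) = if (al + be < n)%N then 1 else 0.
Proof.
move=> al1 be1; rewrite (multiplicity_ind _ _ psiJ) card_transl natrX.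
rewrite (bigID (mem (transl a b))) /= [X in _ + X]big1 ?addr0; last first.
  by move=> x xn; rewrite chi_ab_off // conjc0 mulr0.
rewrite transl_tau (big_imset _ (in2W tau_inj)) /=.
under eq_bigr => t _ do rewrite chi_ab_tau conj_chi.
rewrite sum_psi_tau //.
by case: ifP => _; rewrite ?mulr0 // mulVf.
Qed.

Lemma s_sq : (s * s = 1)%g.
Proof.
have [pM _ pK] := prP; have [_ pN _ _] := phiP.
rewrite -(pM _ _ SL2Z_S SL2Z_S).
have -> : mxS *m mxS = - 1%:M by rewrite mxSg !mx22e mx22_1 mx22N; congr mx22.
by apply/pK; [case: Gamma2_N1 | split => //; exact: Gamma2_N1].
Qed.

Lemma pr_N g : SL2Z g -> pr (- 1%:M *m g) = pr g.
Proof.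
move=> gS; have [pM _ pK] := prP; have [_ pN _ _] := phiP.
have NS : SL2Z (- 1%:M) by case: Gamma2_N1.
rewrite (pM _ _ NS gS) (proj2 (pK _ NS)) ?mul1g //; split => //; exact: Gamma2_N1.
Qed.

Lemma conj_s_a : (a ^ s = b)%g.
Proof.
have [pM _ _] := prP.
have sV : (s^-1 = s)%g by apply: (mulgI s); rewrite mulgV s_sq.
have SA := SL2Z_A; have SB : SL2Z mxB by case: Gamma2_B.
rewrite conjgE sV -(pM _ _ SL2Z_A SL2Z_S) -(pM _ _ SL2Z_S (SL2ZM SL2Z_A SL2Z_S)) -[b](pr_N SB).
by congr pr; rewrite mxSg mulmx2E /mxA /mxS /mxB mx22M !mx22e mx22_1 mx22N mx22M; congr mx22.
Qed.

Lemma conj_s_b : (b ^ s = a)%g.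
Proof. by rewrite -conj_s_a -conjgM s_sq conjg1. Qed.

Definition swap t : T := (t.2, t.1).

Lemma tau_s t : (s * tau t = tau (swap t) * s)%g.
Proof.
have sV : (s^-1 = s)%g by apply: (mulgI s); rewrite mulgV s_sq.
have e : (tau t ^ s = tau (swap t))%g.
  rewrite [tau t]tauE conjMg !conjXg conj_s_a conj_s_b.
  have c : (b ^+ t.1 = tau (0%:R, (t.1)%:R))%g by rewrite -tau_nat mul1g.
  have c' : (a ^+ t.2 = tau ((t.2)%:R, 0%:R))%g by rewrite -tau_nat mulg1.
  by rewrite c c' -tauD addrC tauD -c -c' tauE.
by rewrite -e conjgE sV -!mulgA s_sq mulg1.
Qed.

(** Otherwise S would lie in Gamma(2), but its upper left entry is even. *)
Lemma s_transl t t' : tau t != (tau t' * s)%g.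
Proof.
apply/eqP => e; have e' : s = tau (t - t').
  by rewrite addrC tauD e mulgA -tauD addNr tau0 mul1g.
have [KG _] := pr_eq phiP prP SL2Z_S (SL2Z_gamt _) e'.
have := Gamma2M KG (Gamma2_gamt (t - t')).
rewrite -mulmxA (inv2K (SL2Z_gamt _)) mulmx1.
by move=> /Gamma2P[_ [+ _ _ _]]; rewrite mx22e.
Qed.

Definition taus (x : T * bool) : gT := (tau x.1 * s ^+ x.2)%g.

Lemma taus_inj : injective taus.
Proof.
move=> [t [|]] [t' [|]]; rewrite /taus /= ?expg1 ?expg0 ?mulg1.
- by move=> /mulIg/tau_inj ->.
- by move=> e; have := s_transl t' t; rewrite e eqxx.
- by move=> e; have := s_transl t t'; rewrite e eqxx.
- by move=> /tau_inj ->.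
Qed.

Lemma transl_s_taus : transl_s a b s = [set taus x | x : T * bool].
Proof.
have gs : group_set [set taus x | x : T * bool].
  apply/group_setP; split; first by apply/imsetP; exists (0, false); rewrite // /taus tau0 mulg1.
  move=> _ _ /imsetP[[t e] _ ->] /imsetP[[t' e'] _ ->]; rewrite /taus /=.
  case: e => /=.
    rewrite expg1 -mulgA (mulgA s) tau_s mulgA mulgA -tauD -mulgA.
    apply/imsetP; exists (t + swap t', ~~ e') => //; rewrite /taus /=.
    by case: e'; rewrite /= ?s_sq ?mulg1.
  by rewrite mulg1 mulgA -tauD; apply/imsetP; exists (t + t', e').
apply/eqP; rewrite finset.eqEsubset; apply/andP; split.
  rewrite -[[set taus _ | _ in _]]/(gval (Group gs)) gen_subG.
  apply/fintype.subsetP => x; rewrite !inE -orbA => /or3P[]/eqP->; apply/imsetP.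
  - by exists ((1%:R, 0%:R), false) => //; rewrite /taus /= -tau_nat expg1 !mulg1.
  - by exists ((0%:R, 1%:R), false) => //; rewrite /taus /= -tau_nat expg1 mul1g mulg1.
  - by exists (0, true) => //; rewrite /taus /= tau0 mul1g.
apply/fintype.subsetP => _ /imsetP[[t e] _ ->]; rewrite /taus /= tauE.
by rewrite !groupM // groupX // mem_gen // !inE eqxx ?orbT.
Qed.

Lemma card_transl_s : #|transl_s a b s| = (n ^ 2 * 2)%N.
Proof.
rewrite transl_s_taus (card_imset _ taus_inj).
by rewrite -card_T -card_bool -card_prod; apply: eq_card.
Qed.

Lemma ord_bool (e : bool) : (e < 2)%N. Proof. by case: e. Qed.

Lemma taus_nat (m k : nat) (e : 'I_2) :
  (a ^+ m * b ^+ k * s ^+ e)%g = taus ((m%:R, k%:R), e == 1).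
Proof. by rewrite tau_nat /taus /=; case: e => [[|[|e]] he]. Qed.

Lemma chi_s_taus eps (al : nat) t (e : bool) :
  chi_s n a b s eps al (taus (t, e)) = chi al al t * eps ^+ e.
Proof.
rewrite /chi_s; case: pickP => [[[m k] e'] /=|H].
  rewrite taus_nat => /eqP/taus_inj [-> ->]; rewrite chi_nat; congr (_ * _).
  by case: e' => [[|[|e']] he].
case: t H => x y H; have [m mE] := ord_Zp x; have [k kE] := ord_Zp y.
have /negbT/eqP[] := H (m, k, Ordinal (ord_bool e)).
by apply: etrans (esym (taus_nat m k (Ordinal (ord_bool e)))); rewrite mE kE; case: e {H}.
Qed.

Lemma chi_s_off eps (al : nat) x : x \notin transl_s a b s -> chi_s n a b s eps al x = 0 :> C.
Proof.
rewrite /chi_s; case: pickP => [[[m k] e] /= /eqP->|//].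
by rewrite taus_nat transl_s_taus imset_f.
Qed.

(** For 2 al < n the translations contribute [n ^ 2] and their products with S contribute
    [- eps * n ^ 2], over a subgroup of order [2 * n ^ 2]. The formula covers both signs. *)
Lemma mult_rho_pm (eps : C) (al : nat) : eps^*%C = eps -> (1 <= al <= n - 1)%N ->
  multiplicity psi (rho_pm n a b s eps al) = if (al + al < n)%N then (1 - eps) / 2 else 0.
Proof.
move=> epsC al1.
have cE t (e : bool) : (chi_s n a b s eps al (taus (t, e)))^*%C = chi al al (- t) * eps ^+ e.
  rewrite chi_s_taus (rmorphM _ (chi al al t) (eps ^+ e)) /= conj_chi; congr (_ * _).
  by case: e; rewrite ?expr1 ?expr0 ?conjc1.
rewrite (multiplicity_ind _ _ psiJ) card_transl_s.
rewrite (bigID (mem (transl_s a b s))) /= [X in _ + X]big1 ?addr0; last first.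
  by move=> x xn; rewrite chi_s_off // conjc0 mulr0.
rewrite transl_s_taus (big_imset _ (in2W taus_inj)) /=.
rewrite -(pair_big xpredT xpredT (fun t e => psi (taus (t, e)) * (chi_s n a b s eps al (taus (t, e)))^*%C)) /=.
under eq_bigr => t _.
  rewrite big_bool /= !cE expr0 expr1 mulr1 mulrA.
  rewrite {1 2}/taus /= expg1 expg0 mulg1.
  over.
rewrite big_split /= -mulr_suml sum_psi_tau // sum_psi_tau_s // natrM natrX.
have h2 : (2%:R : C) != 0 by rewrite pnatr_eq0.
have h := n2_neq0.
case: ifP => _; last by rewrite mul0r addr0 mulr0.
by field; rewrite (nC_neq0 R n_gt2).
Qed.

(** The sum of [psi] over any coset of the translations vanishes, because each [chix y] sums to
    0. *)
Lemma mult_transl_inv (f : gT -> C) : (forall t x, f (tau t * x)%g = f x) -> multiplicity psi f = 0.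
Proof.
move=> fT; rewrite /multiplicity; apply/eqP; rewrite mulf_eq0; apply/orP; right.
have := n2_neq0; rewrite -natrX -card_T => c0.
(* Repeating the sum once per translation [t] allows the substitution of [tau t * x] for [x] in each
   copy. *)
rewrite -(mulrI_eq0 _ (mulfI c0)) mulr_natl -sumr_const; apply/eqP.
rewrite (eq_bigr (fun t => \sum_x psi (tau t * x)%g * (f x)^*%C)); last first.
  by move=> t _; rewrite (reindex_inj (mulgI (tau t))); apply: eq_bigr => x _; rewrite fT.
rewrite exchange_big big1 // => x _; rewrite -mulr_suml.
have [_ pS _] := prP; have [g gS <-] := pS x.
under eq_bigr => t _ do rewrite (psi_gamt R n_gt2 phiP prP t gS).
rewrite exchange_big big1 ?mul0r // => y _.
by rewrite -mulr_suml (sum_chix R n_gt2) mul0r.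
Qed.

(** Left multiplication by a translation does not change which right cosets contain the element, so
    [pick] sees the same predicate. *)
Lemma s3_proj_tau u t x : s3_proj a b s u (tau t * x) = s3_proj a b s u x.
Proof.
rewrite /s3_proj (eq_pick (Q := fun t : 'I_3 * 'I_2 => x \in (transl a b :* (u ^+ t.1 * s ^+ t.2))%g)) //.
by move=> [i j] /=; rewrite !mem_rcoset -mulgA groupMl // tau_transl.
Qed.

End Multiplicities.

Theorem theorem6p2 (R : realType) (N : nat) (N_gt2 : (2 < N)%N)
    (N_not3 : ~~ (3 %| N)%N)
    (phi : 'M[int]_2 -> 'Z_N * 'Z_N) (phiP : fermat_hom phi)
    (G : finGroupType) (pr : 'M[int]_2 -> G)
    (prP : quotient_of_SL2Z (Phi phi) pr) :
  let a := pr mxA in let b := pr mxB in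
  let s := pr mxS in let u := pr mxU in
  exists2 psi : G -> R[i], canonical_character (Phi phi) pr psi &
    let d := multiplicity psi in
    [/\ [/\ d (@rho1 R G) = 0,
            d (@rho2 R G a b s u) = 0
          & d (@rho3 R G a b s u) = 0],
        forall al : nat, (1 <= al <= N - 1)%N ->
          d (@rho_pm R N G a b s 1 al) = 0,
        forall al : nat, (1 <= al <= N - 1)%N ->
          d (@rho_pm R N G a b s (-1) al)
            = if (al <= (N - 1) %/ 2)%N then 1 else 0
      & forall al be : nat, (1 <= al <= N - 1)%N -> (1 <= be <= N - 1)%N ->
          @orbit_size R N G a b s u al be = 6%N ->
          d (@rho_ab R N G a b al be)
            = if (al + be < N)%N then 1 else 0].
Proof.
move=> a b s u; exists (psi R prP); first exact: psi_character.
move=> d; split.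
- by split; apply: (mult_transl_inv N_gt2 phiP) => t x //; rewrite /rho2 /rho3 (s3_proj_tau phiP prP).
- move=> al al1; rewrite /d mult_rho_pm ?conjc1 // subrr mul0r.
  by case: ifP.
- move=> al al1; rewrite /d mult_rho_pm ?rmorphN1 // opprK -[1 + 1]/(2%:R) divff ?pnatr_eq0 //.
  (* 2 al < N is the same as al <= floor((N - 1) / 2). *)
  by congr (if _ then _ else _); lia.
- by move=> al be al1 be1 _; rewrite /d mult_rho_ab.
Qed.
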